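(* Let $d\ge n\ge2$, $1\le s^*\le d$, $\|\beta^*\|_0\le s^*$, and $\|\beta^*\|_2\le1$, and let the data be i.i.d. from the generalized linear model of the context with parameter $\beta^*$. Suppose (D) and (G) of the context hold, and let $0<\alpha\le\gamma<\infty$ and $L^{\rm sp}_{\psi,0}<\infty$ be the restricted-curvature constants described in the context. For a sufficiently large universal constant $C_0$, assume $\lceil C_0(\gamma/\alpha)^2s^*\rceil\le d$, and set $$s=\lceil C_0(\gamma/\alpha)^2s^*\rceil,\qquad \eta^0=\frac2{\alpha+\gamma},\qquad \beta^0=0,$$ $$L_x=C_xK_x\sqrt{\log(ed)},\quad L_\psi=L^{\rm sp}_{\psi,0}+C_\psi K_x\sqrt{\log n},\quad S_\psi=|\psi'(0)|+2c_2L_\psi,\quad R=|\psi'(0)|+c_2L_\psi+C_R\sqrt{c(\sigma)\log n}$$ for sufficiently large absolute constants $C_x,C_\psi,C_R$, and $$B_0=4(R+S_\psi)L_x,\qquad q_0=1-\frac{3\alpha}{4\gamma},\qquad T=\left\lceil\frac{\log n}{-\log q_0}\right\rceil .$$ If $0<\varepsilon\le1$, $0<\delta\le n^{-1}$, and $$n\ \ge\ C_1\sqrt{c(\sigma)}\;\frac{s^*\log d\,\sqrt{\log(ed)}\,\sqrt{\log(1/\delta)}\,\log^{3/2}n}{\varepsilon}$$ with a sufficiently large constant $C_1$, then the private sparse GLM algorithm of the context is $(\varepsilon,\delta)$-differentially private and, with probability at least $1-C'n^{-3}$, its output $\widehat\beta$ satisfies $$\|\widehat\beta-\beta^*\|_2^2\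 \le\ C''c(\sigma)\left\{\frac{s^*\log d}n+\frac{(s^*\log d)^2\log(ed)\log(1/\delta)\log^3n}{n^2\varepsilon^2}\right\}.$$ Moreover, $$\mathbb E_{\beta^*}\|\widehat\beta-\beta^*\|_2^2\ \le\ C''c(\sigma)\left\{\frac{s^*\log d}n+\frac{(s^*\log d)^2\log(ed)\log(1/\delta)\log^3n}{n^2\varepsilon^2}\right\}.$$ The constants $C_1,C',C''$ may depend only on the fixed model ingredients in (D) and (G), the fixed bounds on $c(\sigma)$, and the curvature ratio $\gamma/\alpha$, but not on $n,d,s^*,\varepsilon,\delta$.
   Context: Generalized linear model: $\{(y_i,x_i)\}_{i=1}^n$ i.i.d. with $x\in\mathbb R^d$ of law $f_x$ and, given $x$, $y$ with density (with respect to a fixed dominating measure) $f_\beta(y\mid x)=h(y,\sigma)\exp\{(yx^\top\beta-\psi(x^\top\beta))/c(\sigma)\}$; $\psi,h,c(\sigma)$ fixed and known, and for every $\theta\in\mathbb R$, $h(y,\sigma)\exp\{(y\theta-\psi(\theta))/c(\sigma)\}$ is a probability density. $c(\sigma)>0$ is a fixed constant bounded above and away from zero. (D): $\lambda_{\max}\{\mathbb E(xx^\top)\}\le C$; $\|u^\top x\|_{\psi_2}\le K_x\|u\|_2$ for all $u\in\mathbb R^d$ (sub-Gaussian Orlicz norm); $\mathbb Ex=0$; $\mathbb Exx^\top\succeq C^{-1}I_d$; fixed $C,K_x<\infty$. (G): $\psi\in C^3(\mathbb R)$, $0<\psi''\le c_2$ on $\mathbb R$, $\|\psi'''\|_\infty\le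 c_3$; fixed $c_2,c_3<\infty$. The fixed model ingredients are $C,K_x,c_2,c_3$ and the fixed functions $\psi$ and $\chi$ (below). Clipping and saturation: $[\mathsf C_L^{(\infty)}(x)]_j=\mathrm{sign}(x_j)\min\{|x_j|,L\}$; $\Pi_R(t)$ is projection of $t$ onto $[-R,R]$. Fix an even $C^1$ function $\chi:\mathbb R\to[0,1]$ with $\chi=1$ on $[-1,1]$, $\chi(t)=0$ for $|t|\ge2$, $\|\chi'\|_\infty<\infty$. For $L_\psi\ge1$, $\psi_{L_\psi}'(t)=\psi'(0)+\int_0^t\psi''(u)\chi(u/L_\psi)du$, $\psi_{L_\psi}(t)=\psi(0)+\int_0^t\psi'_{L_\psi}(u)du$. With $\bar x_i=\mathsf C^{(\infty)}_{L_x}(x_i)$ let $\mathcal L^R_{n,L_\psi}(\beta)=\frac1n\sum_i\{\psi_{L_\psi}(x_i^\top\beta)-\Pi_R(y_i)x_i^\top\beta\}$ and $\overline{\mathcal L}^R_{n,L_\psi}(\beta)=\frac1n\sum_i\{\psi_{L_\psi}(\bar x_i^\top\beta)-\Pi_R(y_i)\bar x_i^\top\beta\}$. Restricted-curvature constants: for $s\ge s^*$ let $\mathcal E_{\rm sc}(\alpha,\gamma;L_\psi)$ be the event that for every $I\subset[d]$ with $|I|\le2s+s^*$ and every $\beta$ on a line segment joining $\beta^*$ to an $s$-sparse vector in $\{u:\|u-\beta^*\|_2\le2\}$, $\alpha I_I\preceq[\nabla^2\mathcal L^R_{n,L_\psi}(\beta)]_{I,I}\preceq\gamma I_I$. There are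 constants $0<\alpha\le\gamma<\infty$, $\tilde C<\infty$, $L^{\rm sp}_{\psi,0}<\infty$, depending only on the fixed model ingredients, such that whenever $d\ge n\ge2$, $1\le s^*\le s\le d$, $\|\beta^*\|_0\le s^*$, $\|\beta^*\|_2\le1$, $L_\psi\ge L^{\rm sp}_{\psi,0}$ is deterministic and $n\ge\tilde C(s+s^* )\log(ed)$, one has $\mathbb P\{\mathcal E_{\rm sc}(\alpha,\gamma;L_\psi)\}\ge1-n^{-3}$; $\alpha,\gamma,L^{\rm sp}_{\psi,0}$ in the claim are these constants. NoisyHT$(v,s,\varepsilon,\delta,\lambda)$ for $v\in\mathbb R^d$: set $S=\varnothing$, $b=2\lambda\sqrt{3s\log(1/\delta)}/\varepsilon$. For $r=1,\dots,s$: draw $w_{r1},\dots,w_{rd}$ i.i.d. Laplace$(b)$ and append to $S$ an index in $\arg\max_{j\notin S}\{|v_j|+w_{rj}\}$ (deterministic tie breaking). Draw $\tilde w_1,\dots,\tilde w_d$ i.i.d. Laplace$(b)$ and output $v_S+\tilde w_S$, where $u_S$ keeps the coordinates of $u$ in $S$ and sets the others to zero. Private sparse GLM algorithm: for $t=0,\dots,T-1$ set $\beta^{t+1}=\mathrm{NoisyHT}\big(\beta^t-\eta^0\nabla\overline{\mathcal L}^R_{n,L_\psi}(\beta^t),\,s,\,\varepsilon/T,\,\delta/T,\,\eta^0B_0/n\big)$ with fresh independent noise; output $\widehat\beta$, the Euclidean projection of $\beta^T$ onto the unit ball $\{u:\|u\|_2\le1\}$. Differential privacy: $M$ is $(\varepsilon,\delta)$-differentially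 private if for every two data sets $D,D'$ of size $n$ differing by replacement of one record and every measurable $S$, $\mathbb P(M(D)\in S)\le e^\varepsilon\mathbb P(M(D')\in S)+\delta$ (probability over $M$ only).
   Formalization: How large C_R must be may depend on c_2 (and on nothing else) instead of being absolute; with a C_R independent of c_2 the claim fails, e.g. for Gaussian responses with ψ(t)=Mt²/2, c_2=M large and x~N(0,M^{-2}I). *)

(* Defs.v *)
From HB Require Import structures.
From mathcomp Require Export all_boot all_order all_algebra.
From mathcomp Require Export all_classical all_reals all_analysis.
Export Order.TTheory GRing.Theory Num.Theory.
Export numFieldNormedType.Exports.

Set Implicit Arguments.
Unset Strict Implicit.
Unset Printing Implicit Defensive.

Global Open Scope classical_set_scope.
Global Open Scope ring_scope.

Definition nceil (R : realType) (x : R) : nat := `|Num.ceil x|%N.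

(** * Vectors of R^d (row vectors) *)

(* MathComp's norm on ['rV_d] is the sup norm, hence [l2norm]. *)
Definition dot (R : realType) (d : nat) (x b : 'rV[R]_d) : R :=
  \sum_j x 0 j * b 0 j.

Definition l2norm (R : realType) (d : nat) (x : 'rV[R]_d) : R :=
  Num.sqrt (dot x x).

Definition l0norm (R : realType) (d : nat) (x : 'rV[R]_d) : nat :=
  #|[pred j | x 0 j != 0]|.

Definition nearest_points (R : realType) (d : nat) (K : set 'rV[R]_d)
    (u : 'rV[R]_d) : set 'rV[R]_d :=
  [set v | K v /\ forall z, K z -> l2norm (u - v) <= l2norm (u - z)].

(* The nearest point exists and is unique, as the ball is compact and convex. *)
Definition proj_unit_ball (R : realType) (d : nat) (u : 'rV[R]_d) : 'rV[R]_d :=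
  get (nearest_points [set v | l2norm v <= 1] u).

Definition loewner_le (R : realType) (m : nat) (A B : 'M[R]_m) : Prop :=
  forall u : 'rV[R]_m, 0 <= (u *m (B - A) *m u^T) 0 0.

Definition principal_submx (R : realType) (d : nat) (I : {set 'I_d})
    (A : 'M[R]_d) : 'M[R]_#|I| :=
  mxsub (fun i : 'I_#|I| => enum_val i) (fun i : 'I_#|I| => enum_val i) A.

Definition grad (R : realType) (d : nat) (f : 'rV[R]_d -> R) (b : 'rV[R]_d) :
    'rV[R]_d :=
  \row_j 'D_(delta_mx 0 j) f b.

Definition hess (R : realType) (d : nat) (f : 'rV[R]_d -> R) (b : 'rV[R]_d) :
    'M[R]_d :=
  \matrix_(j, k) 'D_(delta_mx 0 j) (fun v => 'D_(delta_mx 0 k) f v) b.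

(** * Probability *)

Notation borelType T := (g_sigma_algebraType (@open T)).

Notation record R d := (R * 'rV[R]_d)%type.

Definition sigma_of d d' (T : measurableType d) (T' : measurableType d')
    (X : T -> T') : set (set T) :=
  preimage_set_system setT X measurable.

(* Since each [F i] below is a sigma-algebra, and thus contains [setT],
   the product rule for the whole family yields it for every subfamily. *)
Definition independent_sigma d (T : measurableType d) (R : realType)
    (P : probability T R) (I : finType) (F : I -> set (set T)) : Prop :=
  forall A : I -> set T, (forall i, F i (A i)) ->
    P (\bigcap_(i in setT) A i) = (\prod_(i : I) fine (P (A i)))%:E.

Definition psi2_norm d (T : measurableType d) (R : realType)
    (P : probability T R) (X : T -> R) : \bar R :=
  ereal_inf [set t%:E | t in
    [set t : R | 0 < t /\ ('E_P[fun w => (expR ((X w / t) ^+ 2))%R] <= 2%:E)%E]].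

Definition has_laplace_law d (T : measurableType d) (R : realType)
    (P : probability T R) (b : R) (X : {RV P >-> R}) : Prop :=
  forall B : set R, measurable B ->
    P (X @^-1` B) =
    (\int[lebesgue_measure]_(x in B) (expR (- (`|x| / b)) / (2 * b))%:E)%E.

(** * The generalized linear model *)

(* [h] and [c] stand for h(., sigma) and c(sigma): sigma is fixed. *)
Definition glm_density (R : realType) (h : R -> R) (c : R) (psi : R -> R)
    (theta y : R) : R :=
  h y * expR ((y * theta - psi theta) / c).

Definition glm_family (R : realType)
    (mu : {measure set (measurableTypeR R) -> \bar R})
    (h : R -> R) (c : R) (psi : R -> R) : Prop :=
  0 < c /\ forall theta : R,
    [/\ measurable_fun setT (glm_density h c psi theta),
        forall y, 0 <= glm_density h c psi theta y &
        (\int[mu]_y (glm_density h c psi theta y)%:E = 1)%E].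

(* The records are the pairs (y_i, x_i); [fx] is the law of x. *)
Definition glm_sample (R : realType) (n d : nat)
    (fx : probability (borelType 'rV[R]_d) R)
    (mu : {measure set (measurableTypeR R) -> \bar R})
    (h : R -> R) (c : R) (psi : R -> R) (beta : 'rV[R]_d)
    dO (O : measurableType dO) (P : probability O R)
    (D : 'I_n -> {RV P >-> borelType (record R d)}) : Prop :=
  independent_sigma P (fun i => sigma_of (D i)) /\
  forall (i : 'I_n) (B : set R) (A : set 'rV[R]_d),
    measurable B -> <<s open >> A ->
    P (D i @^-1` (B `*` A)) =
    (\int[fx]_(x in A)
       \int[mu]_(y in B) (glm_density h c psi (dot x beta) y)%:E)%E.

Definition second_moment (R : realType) (d : nat)
    (fx : probability (borelType 'rV[R]_d) R) : 'M[R]_d :=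
  \matrix_(j, k) fine ('E_fx[fun x : 'rV[R]_d => (x 0 j * x 0 k)%R])%E.

Definition condD (R : realType) (C Kx : R) (d : nat)
    (fx : probability (borelType 'rV[R]_d) R) : Prop :=
  [/\ forall a, eigenvalue (second_moment fx) a -> a <= C,
      forall u : 'rV[R]_d,
        (psi2_norm fx (fun x : 'rV[R]_d => dot u x) <= (Kx * l2norm u)%:E)%E,
      forall j, ('E_fx[fun x : 'rV[R]_d => (x 0 j)%R] = 0)%E,
      0 < C & loewner_le (C^-1)%:M (second_moment fx)].

Definition C_k (R : realType) (k : nat) (f : R -> R) : Prop :=
  (forall i t, (i < k)%N -> derivable (derive1n i f) t 1) /\
  continuous (derive1n k f).

Definition condG (R : realType) (c2 c3 : R) (psi : R -> R) : Prop :=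
  [/\ C_k 3 psi,
      forall t, 0 < derive1n 2 psi t <= c2 &
      forall t, `|derive1n 3 psi t| <= c3].

(** * Clipping and saturation *)

Definition is_cutoff (R : realType) (chi : R -> R) : Prop :=
  [/\ (forall t, chi (- t) = chi t) /\ C_k 1 chi,
      forall t, 0 <= chi t <= 1,
      forall t, `|t| <= 1 -> chi t = 1,
      forall t, 2 <= `|t| -> chi t = 0 &
      exists M, forall t, `|derive1 chi t| <= M].

(* The oriented integral of f from 0 to t. *)
Definition int0 (R : realType) (f : R -> R) (t : R) : R :=
  if 0 <= t then \int[lebesgue_measure]_(u in `[0, t]) f u
  else - \int[lebesgue_measure]_(u in `[t, 0]) f u.

Definition psi_sat' (R : realType) (psi chi : R -> R) (L t : R) : R :=
  derive1 psi 0 + int0 (fun u => derive1n 2 psi u * chi (u / L)) t.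

Definition psi_sat (R : realType) (psi chi : R -> R) (L t : R) : R :=
  psi 0 + int0 (psi_sat' psi chi L) t.

Definition trunc (R : realType) (r t : R) : R :=
  Num.max (- r) (Num.min r t).

Definition clip (R : realType) (d : nat) (L : R) (x : 'rV[R]_d) : 'rV[R]_d :=
  \row_j (Num.sg (x 0 j) * Num.min `|x 0 j| L).

Definition clip_data (R : realType) (n d : nat) (L : R)
    (D : 'I_n -> record R d) : 'I_n -> record R d :=
  fun i => ((D i).1, clip L (D i).2).

Definition glm_loss (R : realType) (n d : nat) (psi : R -> R) (r : R)
    (D : 'I_n -> record R d) (b : 'rV[R]_d) : R :=
  n%:R^-1 * \sum_i (psi (dot (D i).2 b) - trunc r (D i).1 * dot (D i).2 b).

(** * Restricted curvature *)

Definition sparse_segment (R : realType) (d s : nat) (bstar b : 'rV[R]_d) :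
    Prop :=
  exists (v : 'rV[R]_d) (t : R),
    [/\ (l0norm v <= s)%N, l2norm (v - bstar) <= 2, 0 <= t <= 1 &
        b = (1 - t) *: bstar + t *: v].

Definition curvature_ok (R : realType) (n d s sstar : nat)
    (bstar : 'rV[R]_d) (psi chi : R -> R) (Lpsi r alpha gamma : R)
    (D : 'I_n -> record R d) : Prop :=
  forall (I : {set 'I_d}) (b : 'rV[R]_d),
    (#|I| <= 2 * s + sstar)%N -> sparse_segment s bstar b ->
    let H := principal_submx I (hess (glm_loss (psi_sat psi chi Lpsi) r D) b) in
    loewner_le alpha%:M H /\ loewner_le H gamma%:M.

(* [1 <= Lsp] because the saturation psi_L is only defined for L >= 1.
   The data law may be any GLM with cumulant function psi and covariate law
   satisfying condD: the constants depend on C, Kx, c2, c3, psi, chi only. *)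
Definition curvature_constants (R : realType) (C Kx : R) (psi chi : R -> R)
    (alpha gamma Ct Lsp : R) : Prop :=
  [/\ 0 < alpha <= gamma, 1 <= Lsp &
  forall (n d s sstar : nat) (bstar : 'rV[R]_d)
    (fx : probability (borelType 'rV[R]_d) R)
    (mu : {measure set (measurableTypeR R) -> \bar R})
    (h : R -> R) (c : R) (Lpsi r : R)
    dO (O : measurableType dO) (P : probability O R)
    (D : 'I_n -> {RV P >-> borelType (record R d)}),
    (2 <= n <= d)%N -> (1 <= sstar)%N -> (sstar <= s <= d)%N ->
    (l0norm bstar <= sstar)%N -> l2norm bstar <= 1 ->
    condD C Kx fx -> glm_family mu h c psi ->
    glm_sample fx mu h c psi bstar D ->
    Lsp <= Lpsi -> 0 <= r ->
    Ct * (s + sstar)%:R * ln (expR 1 * d%:R) <= n%:R ->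
    ((1 - n%:R ^- 3)%:E <=
      P [set w | curvature_ok s sstar bstar psi chi Lpsi r alpha gamma
                   (fun i => D i w)])%E].

(** * NoisyHT and the private algorithm *)

Definition noisyHT_scale (R : realType) (s : nat) (eps delta lambda : R) : R :=
  2 * lambda * Num.sqrt (3 * s%:R * ln delta^-1) / eps.

(* A deterministic tie-breaking rule chooses an element of the argmax set. *)
Definition tie_breaking (d : nat) (tie : {set 'I_d} -> 'I_d) : Prop :=
  forall A : {set 'I_d}, A != finset.set0 -> tie A \in A.

Definition argmax_off (R : realType) (d : nat) (S : {set 'I_d})
    (z : 'I_d -> R) : {set 'I_d} :=
  finset (fun j => (j \notin S) && [forall k, (k \notin S) ==> (z k <= z j)]).

Definition noisyHT_select (R : realType) (d s : nat)
    (tie : {set 'I_d} -> 'I_d) (v : 'rV[R]_d) (w : 'I_s -> 'I_d -> R) :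
    {set 'I_d} :=
  foldl (fun S r => tie (argmax_off S (fun j => `|v 0 j| + w r j)) |: S)%SET
    finset.set0 (enum 'I_s).

(* The output of NoisyHT as a function of its noise [w], [w']. *)
Definition noisyHT (R : realType) (d s : nat) (tie : {set 'I_d} -> 'I_d)
    (v : 'rV[R]_d) (w : 'I_s -> 'I_d -> R) (w' : 'I_d -> R) : 'rV[R]_d :=
  \row_j (if j \in noisyHT_select tie v w then v 0 j + w' j else 0).

(* [psiL] is the saturated psi, [r] the truncation level of the responses. *)
Definition private_glm (R : realType) (n d T s : nat)
    (tie : {set 'I_d} -> 'I_d) (psiL : R -> R) (Lx r eta : R)
    (D : 'I_n -> record R d)
    (w : 'I_T -> 'I_s -> 'I_d -> R) (w' : 'I_T -> 'I_d -> R) : 'rV[R]_d :=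
  proj_unit_ball
    (foldl (fun b t =>
       noisyHT tie (b - eta *: grad (glm_loss psiL r (clip_data Lx D)) b)
         (w t) (w' t)) 0 (enum 'I_T)).

Definition noise_and_data_independent (R : realType) (n d T s : nat)
    dO (O : measurableType dO) (P : probability O R)
    (D : 'I_n -> {RV P >-> borelType (record R d)})
    (w : 'I_T -> 'I_s -> 'I_d -> {RV P >-> R})
    (w' : 'I_T -> 'I_d -> {RV P >-> R}) : Prop :=
  independent_sigma P
    (fun k : 'I_n + ('I_T * 'I_s * 'I_d) + ('I_T * 'I_d) =>
       match k with
       | inl (inl i) => sigma_of (D i)
       | inl (inr (t, r, j)) => sigma_of (w t r j)
       | inr (t, j) => sigma_of (w' t j)
       end).

(** * Differential privacy *)

Definition adjacent (n : nat) (A : Type) (D D' : 'I_n -> A) : Prop :=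
  exists i, forall j, j != i -> D j = D' j.

(* The mechanism is a function of the data set and of its own randomness. *)
Definition differentially_private (R : realType) (n d : nat) (A : Type)
    dO (O : measurableType dO) (P : probability O R)
    (M : ('I_n -> A) -> O -> 'rV[R]_d) (eps delta : R) : Prop :=
  forall D D' : 'I_n -> A, adjacent D D' ->
  forall S : set 'rV[R]_d, <<s open >> S ->
    (P (M D @^-1` S) <= (expR eps)%:E * P (M D' @^-1` S) + delta%:E)%E.

(* Main.v *)
(* Privacy. Changing one record moves each coordinate of a gradient step by at
   most half of the level [lambda] passed to NoisyHT. A selection round is a
   pure differentially private map, hence costs, for the Renyi divergence of order [a], a quantity
   quadratic in the privacy level; so does the release of the noisy values on
   the selected support. The divergences of the [s] rounds and [T] iterations
   add up, and [a = 2 log(1/delta) / eps] converts the total to (eps, delta).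

   Accuracy. On an event of probability [1 - O(n^-3)] nothing is clipped or
   truncated at [bstar], the restricted Hessian lies between [alpha] and
   [gamma], the gradient at [bstar] is uniformly [O(sqrt(c log d / n))] and all
   Laplace variables are at most [7 b log d]. There a gradient step restricted
   to the relevant coordinates contracts by [(gamma - alpha) / (gamma + alpha)],
   and hard thresholding at level [s >> sstar] expands by a factor so close to
   1 that the error contracts by [q0] per iteration up to an additive term of
   the order of the claimed rate. Off the event the error is at most 4. *)

Require Import Defs.
From HB Require Import structures.
From mathcomp Require Import measurable_realfun ring lra.
Import HBNNSimple.

Set Implicit Arguments.
Unset Strict Implicit.
Unset Printing Implicit Defensive.

(** * Integrals under densities and independence *)

(** Adding the pure privacy levels of the [s * T] selection rounds would cost a factor [sqrt s] too
    much for the scale [noisyHT_scale]; a loss quadratic in the level is what fits it. The laws of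
    the iterates are mixtures without usable densities, so every divergence bound is a bound on
    expectations of test functions with values in [0, 1]: [E f(X) <= K * (E f(Y)^p)^(1/p)] with
    [p = a / (a - 1)]. Stages chain because the inner root and the outer power cancel, and at an
    indicator the bound compares probabilities.

    The curvature hypothesis covers only segments from [bstar] to sparse vectors within distance 2,
    and concerns unclipped data. Hence the sample size must also make the additive error per
    iteration so small that no iterate leaves this ball. The same condition forces [ln n >= 8],
    hence [T >= 4] and [ln(1/delta) >= 4], which the privacy budget uses.

    Two points of measure theory need care: the dominating measure is arbitrary, possibly not
    sigma-finite, and the curvature event is not given as measurable. *)

Lemma integral_density d (T : measurableType d) (R : realType)
    (m mu : {measure set T -> \bar R}) (p : T -> R) (f : T -> \bar R) :
  measurable_fun setT p -> (forall x, 0 <= p x) ->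
  (forall A, measurable A -> m A = \int[mu]_(x in A) (p x)%:E)%E ->
  measurable_fun setT f -> (forall x, (0 <= f x)%E) ->
  (\int[m]_x f x = \int[mu]_x (f x * (p x)%:E))%E.
Proof.
move=> mp p0 mE mf f0.
have mpE : measurable_fun setT (EFin \o p) by exact/measurable_EFinP.
pose h := nnsfun_approx measurableT mf.
have cvgh x : (EFin \o h n) x @[n --> \oo] --> f x.
  by apply: cvg_nnsfun_approx => // y _; exact: f0.
have -> : (\int[m]_x f x = lim (\int[m]_x (EFin \o h n) x @[n --> \oo]))%E.
  have fE x : f x = lim ((EFin \o h n) x @[n --> \oo]) by exact/esym/cvg_lim.
  under eq_integral => x _ do rewrite fE.
  apply: monotone_convergence => //.
  - by move=> n; apply/measurable_EFinP.
  - by move=> n x _ //=; rewrite lee_fin.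
  - by move=> x _ a b ab; rewrite lee_fin; exact/lefP/nd_nnsfun_approx.
have -> : (\int[mu]_x (f x * (p x)%:E) =
    lim (\int[mu]_x ((EFin \o h n) x * (p x)%:E) @[n --> \oo]))%E.
  have fg x : (f x * (p x)%:E = lim ((EFin \o h n) x * (p x)%:E @[n --> \oo]))%E.
    by apply/esym/cvg_lim => //; apply: cvgeZr.
  under eq_integral => x _ do rewrite fg.
  apply: monotone_convergence => [//| | |].
  - by move=> n; apply/emeasurable_funM => //; exact/measurable_EFinP.
  - by move=> n x _ /=; rewrite mule_ge0 ?lee_fin.
  - by move=> x _ a b ab/=; rewrite lee_wpmul2r ?lee_fin//; exact/lefP/nd_nnsfun_approx.
suff suf n : (\int[mu]_x ((EFin \o h n) x * (p x)%:E) =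
    \int[m]_x (EFin \o h n) x)%E by under [in RHS]eq_fun do rewrite suf.
transitivity (\int[m]_x
   (\sum_(y \in range (h n)) (y * \1_(h n @^-1` [set y]) x)%:E))%E; last first.
  by apply: eq_integral => t tE; rewrite /= fimfunE -fsumEFin.
have indich r : measurable_fun setT (fun x => (r * \1_(h n @^-1` [set r]) x)%:E).
  by apply/measurable_EFinP; exact: measurable_funM.
rewrite ge0_integral_fsum//; last by move=> y x _; exact: nnfun_muleindic_ge0.
transitivity (\int[mu]_x (\sum_(y \in range (h n))
    (y * \1_(h n @^-1` [set y]) x)%:E * (p x)%:E))%E.
  under [RHS]eq_integral => x xE.
    rewrite -ge0_mule_fsuml => [|y]; last exact: nnfun_muleindic_ge0.
    rewrite fsumEFin // -(fimfunE _ x); over.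
  by [].
rewrite ge0_integral_fsum//; last 2 first.
  - by move=> y; exact: emeasurable_funM.
  - by move=> y x _; rewrite mule_ge0 ?lee_fin// -lee_fin nnfun_muleindic_ge0.
apply: eq_fsbigr => r rhn.
under [RHS]eq_integral do rewrite EFinM.
rewrite integralZl_indic_nnsfun => //.
under eq_integral do rewrite EFinM -muleA.
rewrite ge0_integralZl//.
- under eq_integral do rewrite muleC.
  rewrite (eq_integral ((EFin \o p) \_ (h n @^-1` [set r]))); last first.
    by move=> x xE; rewrite epatch_indic.
  by rewrite -integral_mkcond -mE// integral_indic// setIT.
- by apply: emeasurable_funM => //; exact/measurable_EFinP.
- by move=> t Et; rewrite mule_ge0 ?lee_fin.
- by move: rhn; rewrite inE => -[t _ <-]; rewrite lee_fin.
Qed.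

(** The product rule on rectangles identifies the law of [(X, Y)] with the product of the marginal
    laws; Tonelli then separates the two variables. *)
Lemma integral_indep d d1 d2 (O : measurableType d) (T1 : measurableType d1)
    (T2 : measurableType d2) (R : realType) (P : probability O R)
    (X : O -> T1) (Y : O -> T2) (H : T1 * T2 -> \bar R) :
  measurable_fun setT X -> measurable_fun setT Y ->
  (forall A B, measurable A -> measurable B ->
     P (X @^-1` A `&` Y @^-1` B) = (P (X @^-1` A) * P (Y @^-1` B))%E) ->
  measurable_fun setT H -> (forall z, (0 <= H z)%E) ->
  (\int[P]_o H (X o, Y o) = \int[P]_o \int[P]_o' H (X o, Y o'))%E.
Proof.
move=> mX mY XY mH H0.
pose Xm : {mfun O >-> T1} := HB.pack X (isMeasurableFun.Build _ _ _ _ _ mX).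
pose Ym : {mfun O >-> T2} := HB.pack Y (isMeasurableFun.Build _ _ _ _ _ mY).
have mXY : measurable_fun setT (fun o => (X o, Y o)).
  exact: measurable_fun_pair.
pose XYm : {mfun O >-> (T1 * T2)%type} :=
  HB.pack (fun o => (X o, Y o)) (isMeasurableFun.Build _ _ _ _ _ mXY).
transitivity (\int[distribution P XYm]_z H z)%E.
  by rewrite ge0_integral_pushforward.
transitivity (\int[distribution P Xm \x distribution P Ym]_z H z)%E.
  apply: eq_measure_integral => A mA _; apply/esym.
  exact: product_measure_unique.
rewrite fubini_tonelli1// /fubini_F.
have EY x : (\int[distribution P Ym]_y H (x, y) = \int[P]_o' H (x, Y o'))%E.
  by rewrite ge0_integral_pushforward//; exact: measurableT_comp.
under eq_integral do rewrite EY.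
rewrite ge0_integral_pushforward//.
  rewrite (_ : (fun _ => _) = fubini_F (distribution P Ym) H).
    exact: measurable_fun_fubini_tonelli_F.
  by apply/funext => x; rewrite /fubini_F EY.
by move=> x _; exact: integral_ge0.
Qed.

(** A pi-system generating the sigma-algebra of the group [K]. Families are padded with [setT]
    outside [K] because [independent_sigma] speaks of full families only. *)
Definition cylinders (O : Type) (I : finType) (F : I -> set (set O))
    (K : set I) : set (set O) :=
  [set B | exists A : I -> set O,
     [/\ forall i, F i (A i), forall i, ~ K i -> A i = setT &
         B = \bigcap_(i in setT) A i]].

Lemma finType_finite_set (I : finType) (K : set I) : finite_set K.
Proof. exact: finite_finset. Qed.

Lemma cylinders_indep d (O : measurableType d) (R : realType)
    (P : probability O R) (I : finType) (F : I -> set (set O)) (K L : set I) :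
  independent_sigma P F ->
  (forall i, F i `<=` measurable) -> (forall i, setI_closed (F i)) ->
  K `&` L = set0 ->
  forall A B, cylinders F K A -> cylinders F L B ->
  P (A `&` B) = (P A * P B)%E.
Proof.
move=> indF Fm FI KL A B [A' [FA KA ->]] [B' [FB LB ->]].
rewrite -bigcapI indF; last by move=> i; exact: FI.
rewrite !indF// -EFinM -big_split/=; congr (_%:E).
apply: eq_bigr => i _.
have [Ki|nKi] := pselect (K i).
  have nLi : ~ L i by move=> Li; have : (K `&` L) i by []; rewrite KL.
  by rewrite (LB _ nLi) setIT probability_setT mulr1.
by rewrite (KA _ nKi) setTI probability_setT mul1r.
Qed.

Lemma cylinders_setI (O : Type) (I : finType) (F : I -> set (set O))
    (K : set I) :
  (forall i, setI_closed (F i)) -> setI_closed (cylinders F K).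
Proof.
move=> FI A B [A' [FA KA ->]] [B' [FB KB ->]].
exists (fun i => A' i `&` B' i); split; first by move=> i; exact: FI.
- by move=> i nKi; rewrite KA// KB// setIT.
- by rewrite bigcapI.
Qed.

Lemma cylinders_measurable d (O : measurableType d) (I : finType)
    (F : I -> set (set O)) (K : set I) :
  (forall i, F i `<=` measurable) -> cylinders F K `<=` measurable.
Proof.
move=> Fm A [A' [FA KA ->]]; apply: fin_bigcap_measurable.
  exact: finType_finite_set.
by move=> i _; exact/Fm.
Qed.

Lemma sub_cylinders (O : Type) (I : finType) (F : I -> set (set O))
    (K : set I) : (forall i, F i setT) ->
  <<s \bigcup_(i in K) F i >> `<=` <<s cylinders F K >>.
Proof.
move=> FT; apply: smallest_sub; first exact: smallest_sigma_algebra.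
move=> A [i Ki FiA]; apply: sub_sigma_algebra.
exists (fun j => if j == i then A else setT); split.
- by move=> j; case: eqP => [->|].
- by move=> j nKj; case: eqP => // ji; rewrite ji in nKj.
- rewrite eqEsubset; split => [x Ax j _|x /(_ i Logic.I)]; last by rewrite eqxx.
  by case: eqP.
Qed.

(** Uniqueness of measures that agree on a pi-system, applied twice: for a fixed event [C], the
    measures [D |-> P (D & C)] and [D |-> P C * P D] agree on cylinders, hence on the sigma-algebra
    they generate. This is done in one argument and then in the other. *)
Lemma independent_groups d (O : measurableType d) (R : realType)
    (P : probability O R) (I : finType) (F : I -> set (set O)) (K L : set I) :
  independent_sigma P F ->
  (forall i, F i `<=` measurable) -> (forall i, setI_closed (F i)) ->
  (forall i, F i setT) ->
  K `&` L = set0 ->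
  forall A B, <<s \bigcup_(i in K) F i >> A -> <<s \bigcup_(i in L) F i >> B ->
  P (A `&` B) = (P A * P B)%E.
Proof.
move=> indF Fm FI FT KL A B /(sub_cylinders FT) sA /(sub_cylinders FT) sB.
have cylT M : cylinders F M setT.
  exists (fun=> setT); split => //.
  by rewrite eqEsubset; split.
have coverT : \bigcup_(k : nat) (fun=> [set: O]) k = setT by rewrite bigcup_const//; exists 0%N.
have finB D : measurable D -> P D = (fine (P D))%:E.
  by move=> mD; rewrite fineK// fin_num_measure.
have step M C : measurable C ->
    (forall D, cylinders F M D -> P (D `&` C) = (P D * P C)%E) ->
    forall D, <<s cylinders F M >> D -> P (D `&` C) = (P D * P C)%E.
  move=> mC Hc D sD.
  have PC0 : 0 <= fine (P C) by exact: fine_ge0.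
  have E : mrestr P mC D = mscale (NngNum PC0) P D.
    apply: (@g_sigma_algebra_measure_unique _ _ _ (cylinders F M)
      (cylinders_measurable Fm) (fun=> setT)) sD => //.
    - exact: cylinders_setI.
    - move=> E cE; transitivity (P E * P C)%E; first exact: Hc.
      by rewrite muleC [X in (X * _)%E]finB.
    - move=> _; apply: (@le_lt_trans _ _ 1%E); last exact: ltry.
      by apply: probability_le1; exact: measurableI.
  by move: E; rewrite /mrestr /mscale/= => ->; rewrite muleC -finB.
have mgen M : <<s cylinders F M >> `<=` measurable.
  by apply: smallest_sub; [exact: sigma_algebra_measurable|exact: cylinders_measurable].
apply: (step K) => //; first exact: mgen sB.
move=> D cD; rewrite setIC muleC; apply: (step L) => //.
  exact: (cylinders_measurable Fm cD).
move=> E cE; rewrite setIC muleC; exact: (cylinders_indep indF Fm FI KL).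
Qed.

Lemma sigma_of_measurable d d' (T : measurableType d) (T' : measurableType d')
    (X : T -> T') : measurable_fun setT X -> sigma_of X `<=` measurable.
Proof. by move=> mX A [B mB <-]; exact: mX. Qed.

Lemma sigma_ofI d d' (T : measurableType d) (T' : measurableType d')
    (X : T -> T') : setI_closed (sigma_of X).
Proof.
move=> A B [A' mA <-] [B' mB <-]; exists (A' `&` B'); first exact: measurableI.
by rewrite !setTI preimage_setI.
Qed.

Lemma sigma_ofT d d' (T : measurableType d) (T' : measurableType d')
    (X : T -> T') : sigma_of X setT.
Proof. by exists setT => //; rewrite setTI. Qed.

(** * Borel measurability of vector-valued maps *)

Lemma continuous_preimage_borel (T : topologicalType) (R : realType) (f : T -> R)
    (B : set R) : continuous f -> measurable B -> <<s @open T >> (f @^-1` B).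
Proof.
move=> /continuousP cf; rewrite [X in X B](RGenOpens.measurableE R) => mB.
have : preimage_set_system setT f <<s (@RGenOpens.G R) >> (f @^-1` B).
  by exists B => //; rewrite setTI.
rewrite -g_sigma_preimageE; apply: smallest_sub; first exact: smallest_sigma_algebra.
move=> _ [_ [a [b ->]] <-]; rewrite setTI; apply: sub_sigma_algebra.
exact/cf/interval_open.
Qed.

Lemma rational_row_near (R : realType) (n : nat) (x : 'rV[R]_n) (e : R) :
  0 < e -> exists q : 'rV[rat]_n, forall j, `|ratr (q 0 j) - x 0 j| < e.
Proof.
move=> e0.
have /choice[q Hq] : forall j, exists q : rat, `|ratr q - x 0 j| < e.
  move=> j; have [q] := @rat_in_itvoo R (x 0 j - e) (x 0 j + e) ltac:(lra).
  rewrite in_itv/= => /andP[q1 q2]; exists q; rewrite ltr_norml; apply/andP.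
  by split; lra.
by exists (\row_j q j) => j; rewrite mxE.
Qed.

(** The Borel structure on row vectors is generated by the open sets of the sup norm. An open set is
    the countable union of the rational cubes it contains, and the preimage of a cube is a finite
    intersection of coordinate conditions. Cubes not inside [U] contribute the empty set, so that
    the union runs over all pairs of a rational centre and an integer. *)
Lemma measurable_rV d (O : measurableType d) (R : realType) (n : nat)
    (f : O -> 'rV[R]_n) :
  (forall j, measurable_fun setT (fun o => f o 0 j)) ->
  measurable_fun setT (f : O -> borelType 'rV[R]_n).
Proof.
move=> mf; have mE : @measurable _ (borelType 'rV[R]_n) = <<s @open 'rV[R]_n >> by [].
apply: (measurability _ mE).
move=> _ [U oU <-]; rewrite setTI.
pose cube (qk : 'rV[rat]_n * nat) : set 'rV[R]_n :=
  [set x | forall j, `|ratr (qk.1 0 j) - x 0 j| < qk.2.+1%:R^-1].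
pose cubeU qk : set O := if pselect (cube qk `<=` U) then f @^-1` cube qk else set0.
rewrite (_ : f @^-1` U = \bigcup_qk cubeU qk); last first.
  rewrite eqEsubset; split => o; last first.
    case=> qk _; rewrite /cubeU.
    by case: pselect => // sU; exact: sU.
  move=> /= Ufo.
  have /nbhs_ballP[e /= e0 eU] : nbhs (f o) U by exact: open_nbhs_nbhs.
  have [k k2e] : exists k : nat, k.+1%:R^-1 < e / 2.
    near \oo => k; exists k; near: k; apply: near_infty_natSinv_lt (PosNum _).
    by rewrite divr_gt0.
  have k0 : 0 < k.+1%:R^-1 :> R by rewrite invr_gt0.
  have [q Hq] := rational_row_near (f o) k0.
  exists (q, k) => //; rewrite /cubeU; case: pselect => //= nsub.
  exfalso; apply: nsub => x /= cx; apply: eU; split => // i j.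
  rewrite (ord1 i) /ball/= -(subrKA (ratr (q 0 j))).
  have := cx j; have := Hq j; set a := ratr (q 0 j).
  move=> /= h1 h2; rewrite (le_lt_trans (ler_normD _ _))// (distrC (f o 0 j))//.
  move: k2e h1 h2; set r := _%:R^-1; lra.
apply: countable_bigcupT_measurable => [|qk]; first exact: countableP.
rewrite /cubeU; case: pselect => _ //=.
rewrite (_ : f @^-1` cube qk = \bigcap_(j in setT) ((fun o => `|ratr (qk.1 0 j) - f o 0 j|) @^-1` `]-oo, qk.2.+1%:R^-1[)); last first.
  rewrite eqEsubset; split => o ho j.
    by move=> _ /=; rewrite in_itv/=; exact: ho.
  by have := ho j Logic.I; rewrite /= in_itv.
apply: fin_bigcap_measurable; first exact: finType_finite_set.
move=> j _; rewrite -[X in measurable X]setTI.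
have : measurable_fun setT (fun o => `|ratr (qk.1 0 j) - f o 0 j|).
  by apply: measurableT_comp => //; apply: measurable_funB.
by apply => //.
Unshelve. all: by end_near.
Qed.

Lemma measurable_coord d (O : measurableType d) (R : realType) (n : nat)
    (f : O -> 'rV[R]_n) (j : 'I_n) :
  measurable_fun setT (f : O -> borelType 'rV[R]_n) ->
  measurable_fun setT (fun o => f o 0 j).
Proof.
move=> mf; apply: (@measurableT_comp _ _ _ _ _ _ (fun x : borelType 'rV[R]_n => x 0 j)) => //.
move=> _ B mB; rewrite setTI.
apply: (continuous_preimage_borel (f := fun x : 'rV[R]_n => x 0 j)) => //; exact: coord_continuous.
Qed.

(** Measurability from [groupType O F K] expresses that a map depends only on the random sources
    indexed by [K]. *)
Notation groupType O F K := (g_sigma_algebraType (\bigcup_(i in K) F i : set (set O))).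

Lemma groupType_measurable_coord d d' (O : measurableType d) (T : measurableType d')
    (I : Type) (F : I -> set (set O)) (K : set I) (i : I) (X : O -> T) :
  K i -> F i = sigma_of X ->
  measurable_fun setT (X : groupType O F K -> T).
Proof.
move=> Ki FX _ A mA; apply: sub_sigma_algebra; exists i => //.
by rewrite FX; exists A.
Qed.

Lemma groupType_measurable d d' (O : measurableType d) (T : measurableType d')
    (I : Type) (F : I -> set (set O)) (K : set I) (X : O -> T) :
  (forall i, F i `<=` measurable) ->
  measurable_fun setT (X : groupType O F K -> T) ->
  measurable_fun setT (X : O -> T).
Proof.
move=> Fm mX _ A mA.
have := mX measurableT A mA; apply: smallest_sub.
  exact: sigma_algebra_measurable.
by move=> B [i _ FB]; exact: (Fm i).
Qed.

(** * Translation of Laplace noise *)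

Lemma lebesgue_measure_shift (R : realType) (a : R) (A : set R) : measurable A ->
  pushforward lebesgue_measure ((fun x => x + a) : _ -> measurableTypeR R) A =
  lebesgue_measure A.
Proof.
move=> mA.
have ms : measurable_fun setT ((fun x => x + a) : measurableTypeR R -> measurableTypeR R).
  exact: measurable_funD.
pose s : {mfun measurableTypeR R >-> measurableTypeR R} :=
  HB.pack (fun x : R => x + a) (isMeasurableFun.Build _ _ _ _ _ ms).
apply/esym; apply: (@lebesgue_measure_unique _ (pushforward lebesgue_measure s)) => //.
move=> _ [[x y] _ <-];
transitivity (lebesgue_measure (`]x - a, y - a]%classic : set R)).
  rewrite /= !lebesgue_measure_itv/= !lte_fin.
  by rewrite ltrD2r; case: ifP => // _; rewrite -!EFinB; congr (_%:E); ring.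
rewrite /= /pushforward /=; congr (lebesgue_measure _).
by rewrite eqEsubset; split => z; rewrite /= !in_itv/= => /andP[? ?];
    apply/andP; split; lra.
Qed.

Lemma ge0_integral_shift (R : realType) (a : R) (f : R -> \bar R) :
  measurable_fun setT f -> (forall x, (0 <= f x)%E) ->
  (\int[lebesgue_measure]_x f (x + a)%R = \int[lebesgue_measure]_x f x)%E.
Proof.
move=> mf f0.
have ms : measurable_fun setT ((fun x => x + a)%R : measurableTypeR R -> measurableTypeR R).
  exact: measurable_funD.
pose s : {mfun measurableTypeR R >-> measurableTypeR R} :=
  HB.pack (fun x : R => x + a)%R (isMeasurableFun.Build _ _ _ _ _ ms).
transitivity (\int[pushforward lebesgue_measure s]_x f x)%E.
  by rewrite ge0_integral_pushforward.
by apply: eq_measure_integral => A mA _; exact: lebesgue_measure_shift.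
Qed.

(** Translation invariance of Lebesgue measure turns a shift of the noise into the likelihood ratio
    [p (x - a) / p x] of the Laplace density [p]. *)
Lemma laplace_shift d (O : measurableType d) (R : realType) (P : probability O R)
    (b : R) (X : {RV P >-> R}) (f : R -> \bar R) (a : R) :
  has_laplace_law b X ->
  measurable_fun setT f -> (forall x, (0 <= f x)%E) ->
  0 < b ->
  (\int[P]_o f (X o + a)%R =
   \int[P]_o ((expR ((`|X o| - `|X o - a|) / b))%:E * f (X o)))%E.
Proof.
move=> lapX mf f0 b0.
pose p (x : R) := expR (- (`|x| / b)) / (2 * b).
have mp : measurable_fun setT p.
  apply: measurable_funM => //; apply: measurableT_comp => //.
  by apply: measurableT_comp => //; apply: measurable_funM => //; exact: normr_measurable.
have p0 x : 0 <= p x by rewrite divr_ge0// ?expR_ge0// mulr_ge0// ltW.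
have E g : measurable_fun setT g -> (forall x, (0 <= g x)%E) ->
    (\int[P]_o g (X o) = \int[lebesgue_measure]_x (g x * (p x)%:E))%E.
  move=> mg g0.
  have mX : measurable_fun setT (X : O -> measurableTypeR R) by exact: measurable_funPT X.
  pose X' : {mfun O >-> measurableTypeR R} :=
    HB.pack (X : O -> R) (isMeasurableFun.Build _ _ _ _ _ mX).
  transitivity (\int[distribution P X']_x g x)%E.
    by rewrite ge0_integral_pushforward.
  by apply: integral_density => // A mA; exact: lapX.
have mfa : measurable_fun setT (fun x : R => f (x + a)%R).
  by apply: measurableT_comp => //; exact: measurable_funD.
have mr : measurable_fun setT (fun x : R => (expR ((`|x| - `|x - a|) / b))%:E).
  apply/measurable_EFinP; apply: measurableT_comp => //; apply: measurable_funM => //.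
  apply: measurable_funB; first exact: normr_measurable.
  by apply: measurableT_comp => //; exact: measurable_funB.
rewrite (E (fun x : R => f (x + a)%R))// (E (fun x => (expR ((`|x| - `|x - a|) / b))%:E * f x)%E)//; last 2 first.
- exact: emeasurable_funM.
- by move=> x; rewrite mule_ge0// lee_fin expR_ge0.
rewrite -(ge0_integral_shift (- a)); last 2 first.
- by apply: emeasurable_funM => //; exact/measurable_EFinP.
- by move=> x; rewrite mule_ge0// lee_fin.
apply: eq_integral => x _; rewrite subrK.
have -> : p (x - a) = expR ((`|x| - `|x - a|) / b) * p x.
  by rewrite /p mulrA -expRD; congr (expR _ / _); ring.
by rewrite EFinM muleA (muleC (f x)).
Qed.

(** * Renyi-type bounds in dual form *)

Lemma expR_le_quadratic (R : realType) (x : R) :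
  `|x| <= 1 / 2 -> expR x <= 1 + x + 2 * x ^+ 2.
Proof.
move=> /ler_normlP[x1 x2].
have := expR_ge1Dx (- x); rewrite expRN => h.
have x3 : 0 < 1 - x by lra.
have h2 : expR x <= (1 - x)^-1.
  by rewrite -[expR x]invrK lef_pV2 ?posrE ?invr_gt0 ?expR_gt0//; lra.
apply: (le_trans h2); rewrite -[X in _ <= X](@mulfK _ (1 - x)) ?gt_eqF//.
rewrite ler_pdivlMr// mulVf ?gt_eqF//.
nra.
Qed.

(** The correction [c0 * (r - 1)] has mean zero when [r] is a likelihood ratio. For [a * e <= 1/2]
    it absorbs the linear term of the expansion of [expR (a * ln r)], since [ln r <= r - 1]; only
    the quadratic term remains. For larger [a * e] the crude bound [expR (a * e)] is already below
    [expR (2 * (a * e) ^+ 2)], and [c0 = 0] will do. *)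
Lemma powR_ratio_le (R : realType) (a e : R) : 1 <= a -> 0 < e ->
  exists2 c0 : R, 0 <= c0 &
  forall r, expR (- e) <= r <= expR e ->
    r `^ a <= expR (2 * (a * e) ^+ 2) + c0 * (r - 1).
Proof.
move=> a1 e0; have [ae|ae] := leP (a * e) (1 / 2).
  exists a => [|r /andP[r1 r2]]; first by lra.
  have r0 : 0 < r by apply: lt_le_trans r1; exact: expR_gt0.
  set u := ln r.
  have ru : r = expR u by rewrite lnK.
  have u1 : `|u| <= e.
    by rewrite ler_norml -ler_expR -ru r1/= -ler_expR -ru.
  have au : `|a * u| <= a * e.
    by rewrite normrM ger0_norm ?ler_pM//; lra.
  have h1 : expR (u * a) <= 1 + a * u + 2 * (a * u) ^+ 2.
    rewrite (mulrC u); apply: expR_le_quadratic; lra.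
  have h2 : (a * u) ^+ 2 <= (a * e) ^+ 2.
    by rewrite -(real_normK (num_real (a * u))) lerXn2r ?nnegrE//; nra.
  have h3 := expR_ge1Dx (2 * (a * e) ^+ 2).
  have h4 := expR_ge1Dx u; rewrite -ru in h4.
  have h5 : a * u <= a * (r - 1) by rewrite ler_pM2l; lra.
  have -> : r `^ a = expR (u * a) by rewrite ru -expRM.
  lra.
exists 0 => [//|r /andP[r1 r2]].
have r0 : 0 < r by apply: lt_le_trans r1; exact: expR_gt0.
rewrite mul0r addr0.
apply: (@le_trans _ _ ((expR e) `^ a)).
  by rewrite ge0_ler_powR ?nnegrE ?expR_ge0//; lra.
rewrite -expRM ler_expR; nra.
Qed.

(* Young's inequality for [(r / K) * (f / N)], with [r `^ a] replaced by an
   affine majorant of mean at most [K `^ a] under the law for which [r] has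
   mean [1]. *)
Lemma young_ratio (R : realType) (a e : R) : 1 < a -> 0 < e ->
  let K := expR (2 * a * e ^+ 2) in
  exists2 c1 : R, 0 <= c1 &
  forall N r f, 0 < N -> expR (- e) <= r <= expR e -> 0 <= f ->
    r * f + K * N * c1 <=
    K * N * (a^-1 + c1 * r + (1 - a^-1) * ((f / N) `^ (a / (a - 1)))).
Proof.
move=> a1 e0 K.
have [c0 c00 Hc] := powR_ratio_le (ltW a1) e0.
have K0 : 0 < K by exact: expR_gt0.
have Ka : K `^ a = expR (2 * (a * e) ^+ 2).
  by rewrite /K -expRM; congr expR; ring.
have a0 : 0 < a by lra.
exists (c0 / (a * K `^ a)) => [|N r f N0 rb f0].
  by rewrite divr_ge0// mulr_ge0 ?powR_ge0// ltW.
have r0 : 0 < r by case/andP: rb => + _; apply: lt_le_trans; exact: expR_gt0.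
have p0 : 0 < a / (a - 1) by rewrite divr_gt0//; lra.
have conj : a^-1 + (a / (a - 1))^-1 = 1 by rewrite invf_div; field; lra.
have Y := @conjugate_powR _ (r / K) (f / N) _ _ (divr_ge0 (ltW r0) (ltW K0))
  (divr_ge0 f0 (ltW N0)) a0 p0 conj.
have h1 : (r / K) `^ a <= 1 + c0 * (r - 1) / K `^ a.
  rewrite powRM ?(ltW r0) ?invr_ge0 ?(ltW K0)//.
  have -> : (K^-1) `^ a = (K `^ a)^-1.
    by rewrite /K -expRN -!expRM -expRN; congr expR; ring.
  have Ka0 : 0 < K `^ a by rewrite powR_gt0.
  rewrite ler_pdivrMr// mulrDl mul1r divfK ?gt_eqF// {1}Ka.
  exact: Hc.
have -> : r * f = K * N * ((r / K) * (f / N)).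
  by field; rewrite !gt_eqF.
rewrite -mulrDr ler_pM2l ?mulr_gt0//.
have -> : 1 - a^-1 = (a / (a - 1))^-1 by lra.
have h2 : (r / K) `^ a / a <= a^-1 + c0 / (a * K `^ a) * r - c0 / (a * K `^ a).
  rewrite ler_pdivrMr//; apply: (le_trans h1).
  rewrite le_eqVlt; apply/orP; left; apply/eqP; field.
  by rewrite !gt_eqF ?powR_gt0.
rewrite (mulrC _^-1 (_ `^ _)); lra.
Qed.

(** * Real-valued expectations of bounded functions *)

Definition mean d (O : measurableType d) (R : realType) (P : probability O R)
    (f : O -> R) : R := fine (\int[P]_o (f o)%:E)%E.

Definition bounded_measurable d (O : measurableType d) (R : realType)
    (f : O -> R) := measurable_fun setT f /\ exists M, forall o, `|f o| <= M.

Section mean_theory.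
Context d (O : measurableType d) (R : realType) (P : probability O R).
Implicit Types f g : O -> R.

Lemma bounded_integrable f : bounded_measurable f ->
  P.-integrable setT (EFin \o f).
Proof.
move=> [mf [M fM]]; apply: measurable_bounded_integrable => //.
  by rewrite (le_lt_trans (probability_le1 P measurableT))// ltry.
exists M; split; first exact: num_real.
move=> x Mx o _ /=; exact: le_trans (fM o) (ltW Mx).
Qed.

Lemma meanE f : bounded_measurable f ->
  (\int[P]_o (f o)%:E)%E = (mean P f)%:E.
Proof.
move=> bf; rewrite /mean fineK//.
by apply: integrable_fin_num => //; exact: bounded_integrable.
Qed.

Lemma mean_cst (c : R) : mean P (fun=> c) = c.
Proof. by rewrite /mean integral_cst//= probability_setT mule1. Qed.

Lemma bm_cst (c : R) : bounded_measurable (fun _ : O => c).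
Proof. by split=> //; exists `|c|. Qed.

Lemma bmD f g : bounded_measurable f -> bounded_measurable g ->
  bounded_measurable (fun o => f o + g o).
Proof.
move=> [mf [M fM]] [mg [N gN]]; split; first exact: measurable_funD.
by exists (M + N) => o; apply: (le_trans (ler_normD _ _)); exact: lerD.
Qed.

Lemma bmM f g : bounded_measurable f -> bounded_measurable g ->
  bounded_measurable (fun o => f o * g o).
Proof.
move=> [mf [M fM]] [mg [N gN]]; split; first exact: measurable_funM.
by exists (M * N) => o; rewrite normrM ler_pM.
Qed.

Lemma bm_unit f : measurable_fun setT f -> (forall o, 0 <= f o <= 1) ->
  bounded_measurable f.
Proof.
by move=> mf f01; split=> //; exists 1 => o; have /andP[f0 f1] := f01 o; rewrite ger0_norm.
Qed.

Lemma meanD f g : bounded_measurable f -> bounded_measurable g ->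
  mean P (fun o => f o + g o) = mean P f + mean P g.
Proof.
move=> bf bg; apply: EFin_inj; rewrite -meanE; last exact: bmD.
rewrite EFinD -!meanE//; under eq_integral do rewrite EFinD.
by rewrite integralD//; exact: bounded_integrable.
Qed.

Lemma meanZ c f : bounded_measurable f ->
  mean P (fun o => c * f o) = c * mean P f.
Proof.
move=> bf; apply: EFin_inj; rewrite -meanE; last by apply: bmM => //; exact: bm_cst.
rewrite EFinM -meanE//; under eq_integral do rewrite EFinM.
by rewrite integralZl//; exact: bounded_integrable.
Qed.

Lemma mean_le f g : bounded_measurable f -> bounded_measurable g ->
  (forall o, f o <= g o) -> mean P f <= mean P g.
Proof.
move=> bf bg fg; rewrite -lee_fin -!meanE//; apply: le_integral => //.
- exact: bounded_integrable.
- exact: bounded_integrable.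
- by move=> o _; rewrite lee_fin.
Qed.

Lemma mean_ge0 f : (forall o, 0 <= f o) -> 0 <= mean P f.
Proof. by move=> f0; apply: fine_ge0; apply: integral_ge0 => o _; rewrite lee_fin. Qed.

Lemma mean_unit f : measurable_fun setT f -> (forall o, 0 <= f o <= 1) ->
  0 <= mean P f <= 1.
Proof.
move=> mf f01; apply/andP; split; first by apply: mean_ge0 => o; case/andP: (f01 o).
rewrite -(mean_cst 1); apply: mean_le; [exact: bm_unit|exact: bm_cst|].
by move=> o; case/andP: (f01 o).
Qed.

Lemma mean_sum (I : Type) (s : seq I) (f : I -> O -> R) :
  (forall i, bounded_measurable (f i)) ->
  mean P (fun o => \sum_(i <- s) f i o) = \sum_(i <- s) mean P (f i).
Proof.
move=> bf; elim: s => [|i s IH].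
  by rewrite big_nil; under eq_fun do rewrite big_nil; exact: mean_cst.
rewrite big_cons -IH -meanD//.
  by congr mean; apply/funext => o; rewrite big_cons.
elim: s {IH} => [|j s IH].
  by under eq_fun do rewrite big_nil; exact: bm_cst.
rewrite (_ : (fun o => _) = (fun o => f j o + \sum_(i <- s) f i o)).
  exact: bmD.
by apply/funext => o; rewrite big_cons.
Qed.

Lemma mean_indic A : measurable A -> mean P (\1_A) = fine (P A).
Proof. by move=> mA; rewrite /mean integral_indic// setIT. Qed.

End mean_theory.

Lemma mean_indep d d1 d2 (O : measurableType d) (T1 : measurableType d1)
    (T2 : measurableType d2) (R : realType) (P : probability O R)
    (X : O -> T1) (Y : O -> T2) (H : T1 * T2 -> R) :
  measurable_fun setT X -> measurable_fun setT Y ->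
  (forall A B, measurable A -> measurable B ->
     P (X @^-1` A `&` Y @^-1` B) = (P (X @^-1` A) * P (Y @^-1` B))%E) ->
  measurable_fun setT H -> (forall z, 0 <= H z <= 1) ->
  mean P (fun o => H (X o, Y o)) =
  mean P (fun o => mean P (fun o' => H (X o, Y o'))).
Proof.
move=> mX mY XY mH H01; rewrite {1 2}/mean; congr fine.
rewrite (@integral_indep _ _ _ _ _ _ _ P X Y (EFin \o H))//.
- apply: eq_integral => o _; apply: meanE; apply: bm_unit => //.
  apply: measurableT_comp => //; exact: measurable_fun_pair.
- exact/measurable_EFinP.
- by move=> z; rewrite lee_fin; case/andP: (H01 z).
Qed.

Lemma measurable_mean_section d d1 (O : measurableType d) (T1 : measurableType d1)
    (R : realType) (P : probability O R) (H : T1 * O -> R) :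
  measurable_fun setT H -> (forall z, 0 <= H z <= 1) ->
  measurable_fun setT (fun x => mean P (fun o => H (x, o))).
Proof.
move=> mH H01.
have : measurable_fun setT (fubini_F P (EFin \o H)).
  apply: measurable_fun_fubini_tonelli_F; first exact/measurable_EFinP.
  by move=> z; rewrite /= lee_fin; case/andP: (H01 z).
move=> mF; apply/measurable_EFinP.
rewrite (_ : EFin \o _ = fubini_F P (EFin \o H))//.
apply/funext => x; rewrite /= /fubini_F -meanE//; apply: bm_unit => //.
by apply: measurableT_comp => //; exact: measurable_fun_pair.
Qed.

Lemma powR_unit (R : realType) (x p : R) : 0 <= p -> 0 <= x <= 1 -> 0 <= x `^ p <= 1.
Proof.
move=> p0 /andP[x0 x1]; rewrite powR_ge0/=.
apply: (@le_trans _ _ (1 `^ p)); last by rewrite powR1.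
by rewrite ge0_ler_powR ?nnegrE// ler01.
Qed.

Lemma root_le (R : realType) (a K I m : R) : 1 < a -> 0 < K -> 0 <= I -> 0 <= m ->
  (forall N, 0 < N -> I <= N `^ (a / (a - 1)) -> m <= K * N) ->
  m <= K * I `^ (1 - a^-1).
Proof.
move=> a1 K0 I0 m0 H.
have a0 : 0 < a by lra.
have q0 : 0 < 1 - a^-1 by rewrite subr_gt0 invf_lt1//; lra.
have [I00|In0] := eqVneq I 0.
  rewrite I00 powR0 ?gt_eqF// mulr0.
  have H0 N : 0 < N -> m <= K * N by move=> N0; apply: H => //; rewrite I00 powR_ge0.
  apply/ler_addgt0Pr => e e0; rewrite add0r.
  by have := H0 (e / K); rewrite divr_gt0// mulrC divfK ?gt_eqF//; apply.
have Ip : 0 < I by rewrite lt_neqAle eq_sym In0.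
apply: H; first by rewrite powR_gt0.
rewrite -powRrM (_ : (1 - a^-1) * (a / (a - 1)) = 1) ?powRr1//.
by field; lra.
Qed.

(* The dual form of a bound on the Renyi divergence of order [a]: a density
   ratio [r] in [[e^-e, e^e]] costs the factor [expR (2 a e^2)], quadratic in
   [e], and the exponent. This form involves no density of the mixtures
   arising along the iterations, and it composes by mere substitution. *)
Lemma mean_ratio_le d (O : measurableType d) (R : realType) (P : probability O R)
    (a e : R) (r f : O -> R) : 1 < a -> 0 < e ->
  measurable_fun setT r -> measurable_fun setT f ->
  (forall o, expR (- e) <= r o <= expR e) -> (forall o, 0 <= f o <= 1) ->
  mean P r = 1 ->
  mean P (fun o => r o * f o) <=
  expR (2 * a * e ^+ 2) *
  (mean P (fun o => f o `^ (a / (a - 1)))) `^ (1 - a^-1).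
Proof.
move=> a1 e0 mr mf re f01 r1.
set p := a / (a - 1).
have p0 : 0 < p by rewrite divr_gt0//; lra.
have f0 o : 0 <= f o by case/andP: (f01 o).
have r0 o : 0 <= r o by case/andP: (re o) => + _; apply: le_trans; exact: expR_ge0.
have br : bounded_measurable r.
  by split=> //; exists (expR e) => o; rewrite ger0_norm//; case/andP: (re o).
have bf : bounded_measurable f by exact: bm_unit.
have bfp : bounded_measurable (fun o => f o `^ p).
  apply: bm_unit => [|o]; last by apply: powR_unit => //; exact: ltW.
  exact: (@measurableT_comp _ _ _ _ _ _ (@powR R ^~ p)).
apply: root_le => //; first exact: expR_gt0.
- by apply: mean_ge0 => o; rewrite powR_ge0.
- by apply: mean_ge0 => o; rewrite mulr_ge0.
move=> N N0 IN.
have [c1 c10 Y] := young_ratio a1 e0.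
set K := expR (2 * a * e ^+ 2) in Y *.
have KN : 0 < K * N by rewrite mulr_gt0// expR_gt0.
have brf : bounded_measurable (fun o => r o * f o) by exact: bmM.
(* Integrated form of Young's inequality: the two terms in [c1] cancel because [r] has mean 1. *)
have H : mean P (fun o => r o * f o + K * N * c1) <=
   mean P (fun o => K * N * a^-1 + ((K * N * c1) * r o + (K * N * ((1 - a^-1) / N `^ p)) * (f o `^ p))).
  apply: mean_le.
  - by apply: bmD => //; exact: bm_cst.
  - by apply: bmD; [exact: bm_cst|apply: bmD; apply: bmM => //; exact: bm_cst].
  - move=> o; apply: (le_trans (Y N (r o) (f o) N0 (re o) (f0 o))).
    rewrite powRM ?invr_ge0 ?(ltW N0)// -/p.
    have -> : (N^-1) `^ p = (N `^ p)^-1 by rewrite -(powR_inv1 (ltW N0)) -powRrM mulN1r powRN.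
    by rewrite le_eqVlt; apply/orP; left; apply/eqP; ring.
move: H; rewrite !meanD ?meanZ ?mean_cst ?r1//;
  try by repeat (exact: bm_cst || assumption || apply: bmM || apply: bmD).
set J := mean P (fun o => f o `^ p) => H.
have Np : 0 < N `^ p by rewrite powR_gt0.
have : K * N * ((1 - a^-1) / N `^ p) * J <= K * N * (1 - a^-1).
  rewrite -!mulrA ler_pM2l ?expR_gt0// ler_pM2l//.
  rewrite -[X in _ <= X]mulr1 ler_pM2l; last by rewrite subr_gt0 invf_lt1; lra.
  by rewrite mulrC ler_pdivrMr// mul1r; exact: IN.
have a0 : a != 0 by rewrite gt_eqF//; lra.
rewrite mulrBr mulr1; lra.
Qed.

(** For selected indices and supports: measurability is imposed on each fibre, without equipping the
    finite type with a sigma-algebra. *)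
Definition fin_measurable d (O : measurableType d) (T : finType) (X : O -> T) :=
  forall t, measurable (X @^-1` [set t]).

Section fin_measurable_theory.
Context d (O : measurableType d).

Lemma fin_measurable_preimage (T : finType) (X : O -> T) (A : set T) :
  fin_measurable X -> measurable (X @^-1` A).
Proof.
move=> mX; rewrite (_ : X @^-1` A = \bigcup_(t in A) X @^-1` [set t]).
  apply: fin_bigcup_measurable => //; exact: finType_finite_set.
by rewrite eqEsubset; split => [u Au|u [t At /= ->]] //; exists (X u).
Qed.

Lemma fin_measurable_comp (T T' : finType) (h : T -> T') (X : O -> T) :
  fin_measurable X -> fin_measurable (fun o => h (X o)).
Proof.
move=> mX t; rewrite (_ : _ @^-1` _ = X @^-1` [set x | h x = t])//.
exact: fin_measurable_preimage.
Qed.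

Lemma fin_measurable_ffun (I T : finType) (X : I -> O -> T) :
  (forall i, fin_measurable (X i)) ->
  fin_measurable (fun o => [ffun i => X i o]).
Proof.
move=> mX t; rewrite (_ : _ @^-1` _ = \bigcap_(i in setT) X i @^-1` [set t i]).
  apply: fin_bigcap_measurable => [|i _]; first exact: finType_finite_set.
  exact: mX.
rewrite eqEsubset; split => [u /= <- i _|u ho] /=; first by rewrite ffunE.
by apply/ffunP => i; rewrite ffunE; exact: (ho i).
Qed.

Lemma fin_measurable_app (T T' : finType) (Y : T -> O -> T') (X : O -> T) :
  fin_measurable X -> (forall t, fin_measurable (Y t)) ->
  fin_measurable (fun o => Y (X o) o).
Proof.
move=> mX mY t; rewrite (_ : _ @^-1` _ =
    \bigcup_(x in setT) (X @^-1` [set x] `&` Y x @^-1` [set t])).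
  apply: fin_bigcup_measurable => [|x _]; first exact: finType_finite_set.
  by apply: measurableI; [exact: mX|exact: mY].
by rewrite eqEsubset; split => [u /= ho|u [x _ [/= -> ho]]] //; exists (X u).
Qed.

Lemma fin_measurable_bool (b : O -> bool) :
  measurable_fun setT b -> fin_measurable b.
Proof. by move=> mb t; rewrite -[X in measurable X]setTI; exact: mb. Qed.

Lemma measurable_fin_fun d' (T : finType) (T' : measurableType d') (X : O -> T)
    (g : T -> T') :
  fin_measurable X -> measurable_fun setT (fun o => g (X o)).
Proof.
move=> mX _ A mA; rewrite setTI.
by rewrite (_ : _ @^-1` _ = X @^-1` [set t | A (g t)]); [exact: fin_measurable_preimage|].
Qed.

Lemma measurable_fin_app d' (T : finType) (T' : measurableType d')
    (Y : T -> O -> T') (X : O -> T) :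
  fin_measurable X -> (forall t, measurable_fun setT (Y t)) ->
  measurable_fun setT (fun o => Y (X o) o).
Proof.
move=> mX mY _ A mA; rewrite setTI (_ : _ @^-1` _ =
    \bigcup_(x in setT) (X @^-1` [set x] `&` Y x @^-1` A)).
  apply: fin_bigcup_measurable => [|x _]; first exact: finType_finite_set.
  by apply: measurableI; [exact: mX|rewrite -[X in measurable X]setTI; exact: mY].
by rewrite eqEsubset; split => [u /= ho|u [x _ [/= -> ho]]] //; exists (X u).
Qed.

End fin_measurable_theory.

(* The [F i] only need to be pi-systems containing [setT]. *)
Definition indep_family d (O : measurableType d) (R : realType)
    (P : probability O R) (I : finType) (F : I -> set (set O)) :=
  [/\ independent_sigma P F, forall i, F i `<=` measurable,
      forall i, setI_closed (F i) & forall i, F i setT].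

Section group_independence.
Context d (O : measurableType d) (R : realType) (P : probability O R).
Context (I : finType) (F : I -> set (set O)) (indF : indep_family P F).

Lemma group_indep d1 d2 (T1 : measurableType d1) (T2 : measurableType d2)
    (K L : set I) (X : O -> T1) (Y : O -> T2) :
  K `&` L = set0 ->
  measurable_fun setT (X : groupType O F K -> T1) ->
  measurable_fun setT (Y : groupType O F L -> T2) ->
  forall A B, measurable A -> measurable B ->
  P (X @^-1` A `&` Y @^-1` B) = (P (X @^-1` A) * P (Y @^-1` B))%E.
Proof.
move=> KL mX mY A B mA mB; case: indF => iF Fm FI FT.
apply: (independent_groups iF Fm FI FT KL).
  by rewrite -[X in <<s _ >> X]setTI; exact: mX.
by rewrite -[X in <<s _ >> X]setTI; exact: mY.
Qed.

Lemma mean_group_indep d1 d2 (T1 : measurableType d1) (T2 : measurableType d2)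
    (K L : set I) (X : O -> T1) (Y : O -> T2) (H : T1 * T2 -> R) :
  K `&` L = set0 ->
  measurable_fun setT (X : groupType O F K -> T1) ->
  measurable_fun setT (Y : groupType O F L -> T2) ->
  measurable_fun setT H -> (forall z, 0 <= H z <= 1) ->
  mean P (fun o => H (X o, Y o)) =
  mean P (fun o => mean P (fun o' => H (X o, Y o'))).
Proof.
move=> KL mX mY mH H01; case: indF => iF Fm FI FT; apply: mean_indep => //.
- exact: groupType_measurable mX.
- exact: groupType_measurable mY.
- exact: (group_indep KL).
Qed.

Lemma mean_mul_indep (K L : set I) (f g : O -> R) :
  K `&` L = set0 ->
  measurable_fun setT (f : groupType O F K -> R) ->
  measurable_fun setT (g : groupType O F L -> R) ->
  (forall o, 0 <= f o <= 1) -> (forall o, 0 <= g o <= 1) ->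
  mean P (fun o => f o * g o) = mean P f * mean P g.
Proof.
move=> KL mf mg f01 g01.
(* The integrand of [mean_group_indep] must lie in [0, 1] on the whole plane; clamping ensures this
   without changing the values that [f] and [g] take. *)
pose cl (x : R) := Num.max 0 (Num.min x 1).
have mcl : measurable_fun setT cl.
  by apply: measurable_maxr => //; exact: measurable_minr.
have cl01 x : 0 <= cl x <= 1 by rewrite /cl; apply/andP; split; [rewrite le_max lexx|rewrite ge_max ler01 ge_min lexx orbT].
have clE x : 0 <= x <= 1 -> cl x = x.
  by move=> /andP[x0 x1]; rewrite /cl (min_idPl x1) (max_idPr x0).
pose H (z : R * R) := cl z.1 * cl z.2.
have mH : measurable_fun setT H.
  by apply: measurable_funM; apply: measurableT_comp.
have H01 z : 0 <= H z <= 1.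
  have /andP[a0 a1] := cl01 z.1; have /andP[b0 b1] := cl01 z.2.
  by rewrite mulr_ge0//= mulr_ile1.
transitivity (mean P (fun o => H (f o, g o))).
  by congr mean; apply/funext => o; rewrite /H/= !clE.
rewrite (mean_group_indep KL)//.
have bmg : bounded_measurable g.
  by apply: bm_unit => //; case: indF => _ Fm _ _; exact: groupType_measurable mg.
have bmf : bounded_measurable f.
  by apply: bm_unit => //; case: indF => _ Fm _ _; exact: groupType_measurable mf.
rewrite mulrC -meanZ//; congr mean; apply/funext => o.
rewrite mulrC -meanZ//; congr mean; apply/funext => o'.
by rewrite /H/= !clE.
Qed.

End group_independence.

(** * Likelihood ratio and tail of the Laplace law *)

Section laplace_mean.
Context d (O : measurableType d) (R : realType) (P : probability O R).

Lemma laplace_ratio_bounds (b x t : R) : 0 < b ->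
  expR (- (`|t| / b)) <= expR ((`|x| - `|x - t|) / b) <= expR (`|t| / b).
Proof.
move=> b0; rewrite !ler_expR -mulNr !ler_pM2r ?invr_gt0//.
have h1 := ler_normD (x - t) t; rewrite subrK in h1.
have h2 := ler_normB x t; lra.
Qed.

Lemma measurable_laplace_ratio (b t : R) :
  measurable_fun setT (fun x : R => expR ((`|x| - `|x - t|) / b)).
Proof.
apply: measurableT_comp => //; apply: measurable_funM => //.
apply: measurable_funB; first exact: normr_measurable.
by apply: measurableT_comp => //; exact: measurable_funB.
Qed.

Lemma mean_laplace_shift (b : R) (X : {RV P >-> R}) (f : R -> R) (t : R) :
  0 < b -> has_laplace_law b X ->
  measurable_fun setT f -> (forall x, 0 <= f x <= 1) ->
  mean P (fun o => f (X o + t)) =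
  mean P (fun o => expR ((`|X o| - `|X o - t|) / b) * f (X o)).
Proof.
move=> b0 lX mf f01; rewrite /mean; congr fine.
rewrite (@laplace_shift _ _ _ P b X (EFin \o f) t lX)//.
- exact/measurable_EFinP.
- by move=> x; rewrite lee_fin; case/andP: (f01 x).
Qed.

Lemma mean_laplace_shift_le (b : R) (X : {RV P >-> R}) (f : R -> R) (t : R) :
  0 < b -> has_laplace_law b X ->
  measurable_fun setT f -> (forall x, 0 <= f x <= 1) ->
  mean P (fun o => f (X o + t)) <= expR (`|t| / b) * mean P (fun o => f (X o)).
Proof.
move=> b0 lX mf f01; rewrite (mean_laplace_shift t b0 lX)//.
have bf : bounded_measurable (fun o => f (X o)).
  by apply: bm_unit => //; exact: measurableT_comp.
rewrite -meanZ//; apply: mean_le.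
- apply: bmM => //; split.
    exact: (measurableT_comp (measurable_laplace_ratio b t)).
  exists (expR (`|t| / b)) => o; rewrite ger0_norm ?expR_ge0//.
  by case/andP: (laplace_ratio_bounds (X o) t b0).
- by apply: bmM => //; exact: bm_cst.
- move=> o; apply: ler_wpM2r; first by case/andP: (f01 (X o)).
  by case/andP: (laplace_ratio_bounds (X o) t b0).
Qed.

Lemma laplace_renyi (b : R) (X : {RV P >-> R}) (f : R -> R) (t e a : R) :
  0 < b -> has_laplace_law b X ->
  measurable_fun setT f -> (forall x, 0 <= f x <= 1) ->
  1 < a -> 0 < e -> `|t| / b <= e ->
  mean P (fun o => f (X o + t)) <=
  expR (2 * a * e ^+ 2) *
  (mean P (fun o => f (X o) `^ (a / (a - 1)))) `^ (1 - a^-1).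
Proof.
move=> b0 lX mf f01 a1 e0 te; rewrite (mean_laplace_shift t b0 lX)//.
apply: mean_ratio_le => //.
- exact: (measurableT_comp (measurable_laplace_ratio b t)).
- exact: measurableT_comp.
- move=> o; have /andP[h1 h2] := laplace_ratio_bounds (X o) t b0.
  apply/andP; split; first by apply: le_trans h1; rewrite ler_expR lerN2.
  by apply: (le_trans h2); rewrite ler_expR.
(* The likelihood ratio has mean 1: shift the constant function 1. *)
- have := @mean_laplace_shift b X (fun=> 1) t b0 lX.
  rewrite mean_cst => -> //; last by move=> _; rewrite ler01 lexx.
  by congr mean; apply/funext => o; rewrite mulr1.
Qed.

(** No integral is computed: a half-line beyond [t * b] is the half-line at the origin shifted by
    [t * b], and on the latter the likelihood ratio of that shift is exactly [expR (- t)]. Each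
    half-line at the origin has mass at most 1, whence the factor 2. *)
Lemma laplace_tail (b : R) (X : {RV P >-> R}) (t : R) :
  0 < b -> 0 <= t -> has_laplace_law b X ->
  (P [set o | (t * b < `|X o|)%R] <= (2 * expR (- t))%:E)%E.
Proof.
move=> b0 t0 lX.
have half (A : set R) (u : R) : measurable A ->
    `|u| = t * b -> (forall x, A x -> `|x| - `|x + u| <= - (t * b)) ->
    (P (X @^-1` [set x | A (x - u)%R]) <= (expR (- t))%:E)%E.
  move=> mA utb Ax.
  have mXA : measurable (X @^-1` [set x | A (x - u)]).
    rewrite -[_ @^-1` _]setTI (_ : X @^-1` _ = (fun o => X o - u) @^-1` A)//.
    by apply: measurable_funB => //.
  rewrite -[P _]fineK ?fin_num_measure// lee_fin -mean_indic//.
  have -> : \1_(X @^-1` [set x | A (x - u)]) = (fun o => \1_A (X o - u)) :> (O -> R).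
    by apply/funext => o; rewrite !indicE; congr (_%:R); congr nat_of_bool;
      apply/idP/idP; rewrite !inE.
  rewrite (@mean_laplace_shift b X (\1_A) (- u) b0 lX)//; last first.
    by move=> x; rewrite indicE; case: (x \in A); rewrite ?lexx ?ler01.
  rewrite -(mean_cst P (expR (- t))); apply: mean_le.
  - split.
      apply: measurable_funM; first exact: (measurableT_comp (measurable_laplace_ratio b (- u))).
      exact: measurableT_comp.
    exists (expR (`|- u| / b)) => o; rewrite normrM ger0_norm ?expR_ge0//.
    rewrite -[X in _ <= X]mulr1 ler_pM ?expR_ge0//.
      by case/andP: (laplace_ratio_bounds (X o) (- u) b0).
    by rewrite indicE; case: (_ \in A); rewrite ?normr1 ?normr0.
  - exact: bm_cst.
  - move=> o; rewrite indicE; case: (boolP (X o \in A)) => [|_]; last by rewrite mulr0 expR_ge0.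
    by rewrite inE mulr1 ler_expR ler_pdivrMr// mulNr opprK; exact: Ax.
have tb0 : 0 <= t * b by rewrite mulr_ge0// ltW.
have h1 := @half `]0, +oo[%classic (t * b) (measurable_itv _) (ger0_norm tb0).
have h2 := @half `]-oo, 0[%classic (- (t * b)) (measurable_itv _).
have mX (u v : itv_bound R) : measurable (X @^-1` [set` Interval u v]).
  by rewrite -[_ @^-1` _]setTI; exact: measurable_funPT.
rewrite (_ : [set o | _] = X @^-1` `]t * b, +oo[ `|` X @^-1` `]-oo, - (t * b)[); last first.
  rewrite eqEsubset; split => u /=; rewrite !in_itv/= andbT.
    by rewrite lter_normr ltrNr => /orP[]; [left|right].
  by rewrite lter_normr ltrNr => -[->|->]; rewrite ?orbT.
apply: (le_trans (measureU2 _ _ _)) => //.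
rewrite mulr_natl mulr2n EFinD; apply: leeD.
- rewrite (_ : `]t * b, +oo[%classic = [set x | `]0, +oo[%classic (x - t * b)]); last first.
    by rewrite eqEsubset; split => x /=; rewrite !in_itv/= !andbT subr_gt0.
  by apply: h1 => x /=; rewrite in_itv/= andbT => x0; rewrite !ger0_norm; lra.
- rewrite (_ : `]-oo, - (t * b)[%classic = [set x | `]-oo, 0[%classic (x - - (t * b))]); last first.
    by rewrite eqEsubset; split => x /=; rewrite !in_itv/= subr_lt0.
  apply: h2; first by rewrite normrN ger0_norm.
  by move=> x /=; rewrite in_itv/= => x0; rewrite !ler0_norm; lra.
Qed.

End laplace_mean.

(** * Privacy of one noisy hard-thresholding stage *)

Definition upd (R : realType) (d : nat) (j : 'I_d) (u : 'rV[R]_d) (x : R) :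
    'rV[R]_d := \row_k (if k == j then x else u 0 k).

Lemma updK (R : realType) (d : nat) (j : 'I_d) (u : 'rV[R]_d) (x y : R) :
  upd j (upd j u x) y = upd j u y.
Proof. by apply/rowP => k; rewrite !mxE; case: eqP. Qed.

Lemma upd_id (R : realType) (d : nat) (j : 'I_d) (u : 'rV[R]_d) :
  upd j u (u 0 j) = u.
Proof. by apply/rowP => k; rewrite !mxE; case: eqP => [->|]. Qed.

Lemma upd_add (R : realType) (d : nat) (j : 'I_d) (u : 'rV[R]_d) (x t : R) :
  upd j u (x + t) = upd j u x + t *: delta_mx 0 j.
Proof.
by apply/rowP => k; rewrite !mxE eqxx/=; case: eqP => _; rewrite ?mulr1 ?mulr0 ?addr0.
Qed.

Lemma measurable_upd d' (O : measurableType d') (R : realType) (d : nat)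
    (j : 'I_d) (u : O -> 'rV[R]_d) (x : O -> R) :
  measurable_fun setT (u : O -> borelType 'rV[R]_d) ->
  measurable_fun setT x ->
  measurable_fun setT (fun o => upd j (u o) (x o) : borelType 'rV[R]_d).
Proof.
move=> mu mx; apply: measurable_rV => k.
rewrite (_ : (fun o => _) = (fun o => if k == j then x o else u o 0 k)).
  by case: eqP => // _; exact: measurable_coord.
by apply/funext => o; rewrite mxE.
Qed.

Lemma argmax_off_neq0 (R : realType) (d : nat) (S : {set 'I_d}) (z : 'I_d -> R) :
  S != [set: 'I_d]%SET -> argmax_off S z != finset.set0.
Proof.
move=> ST; have /set0Pn[i0 i0S] : (~: S)%SET != finset.set0.
  by apply: contra ST => /eqP h; rewrite -(finset.setCK S) h finset.setC0.
rewrite inE in i0S; pose i := [arg max_(i > i0 | i \notin S) z i]%O.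
apply/set0Pn; exists i; rewrite inE /i; case: arg_maxP => //= k kS kmax.
by rewrite kS/=; apply/forallP => l; apply/implyP => lS; exact: kmax.
Qed.

Definition noisy_pick (R : realType) (d : nat) (tie : {set 'I_d} -> 'I_d)
    (v : 'rV[R]_d) (S : {set 'I_d}) (z : 'I_d -> R) : 'I_d :=
  tie (argmax_off S (fun j => `|v 0 j| + z j)).

Lemma noisy_pick_max (R : realType) (d : nat) (tie : {set 'I_d} -> 'I_d)
    (v : 'rV[R]_d) (S : {set 'I_d}) (z : 'I_d -> R) :
  tie_breaking tie -> S != [set: 'I_d]%SET ->
  let i := noisy_pick tie v S z in
  i \notin S /\ forall k, k \notin S -> `|v 0 k| + z k <= `|v 0 i| + z i.
Proof.
move=> tb ST i.
have := tb _ (argmax_off_neq0 (fun j => `|v 0 j| + z j) ST).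
rewrite -/(noisy_pick tie v S z) -/i inE => /andP[iS /forallP h]; split=> // k kS.
by have /implyP/(_ kS) := h k.
Qed.

Lemma noisy_pick_uniq (R : realType) (d : nat) (tie : {set 'I_d} -> 'I_d)
    (v : 'rV[R]_d) (S : {set 'I_d}) (z : 'I_d -> R) (j : 'I_d) :
  tie_breaking tie -> j \notin S ->
  (forall k, k \notin S -> k != j -> `|v 0 k| + z k < `|v 0 j| + z j) ->
  noisy_pick tie v S z = j.
Proof.
move=> tb jS H.
have ST : S != [set: 'I_d]%SET by apply: contra jS => /eqP ->; rewrite inE.
have [iS imax] := noisy_pick_max v z tb ST.
apply/eqP/negP => /negP nij.
by have := lt_le_trans (H _ iS nij) (imax j jS); rewrite ltxx.
Qed.

(** Passing from [v] to [v'] moves every score by at most [D], so a gap shrinks by at most [2 * D],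
    less than the raise [t]. The strict inequality makes [j] the only maximizer, so the tie rule
    cannot interfere. *)
Lemma noisy_pick_shift (R : realType) (d : nat) (tie : {set 'I_d} -> 'I_d)
    (v v' : 'rV[R]_d) (S : {set 'I_d}) (z : 'I_d -> R) (j : 'I_d) (D t : R) :
  tie_breaking tie -> S != [set: 'I_d]%SET ->
  (forall k, `|v 0 k - v' 0 k| <= D) -> 2 * D < t ->
  noisy_pick tie v S z = j ->
  noisy_pick tie v' S (fun k => if k == j then z k + t else z k) = j.
Proof.
move=> tb ST vv Dt ij; have [iS imax] := noisy_pick_max v z tb ST.
rewrite ij in iS imax.
apply: noisy_pick_uniq => // k kS kj; rewrite (negbTE kj) eqxx.
have h1 := imax k kS.
have h2 := le_trans (lerB_dist (v' 0 k) (v 0 k)) _.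
have h3 : `|v' 0 k| - `|v 0 k| <= D by apply: h2; rewrite distrC.
have h4 : `|v 0 j| - `|v' 0 j| <= D by apply: le_trans (vv j); exact: lerB_dist.
lra.
Qed.

Lemma noisy_pick_fin_measurable d' (O : measurableType d') (R : realType)
    (d : nat) (tie : {set 'I_d} -> 'I_d)
    (v : O -> 'rV[R]_d) (S : {set 'I_d}) (z : 'I_d -> O -> R) :
  (forall k, measurable_fun setT (fun o => v o 0 k)) ->
  (forall k, measurable_fun setT (z k)) ->
  fin_measurable (fun o => noisy_pick tie (v o) S (fun k => z k o)).
Proof.
move=> mv mz.
(* The pick depends on the scores only through the finite table of their pairwise comparisons. *)
pose B o := [ffun p : 'I_d * 'I_d =>
  `|v o 0 p.1| + z p.1 o <= `|v o 0 p.2| + z p.2 o].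
have mB : fin_measurable B.
  apply: fin_measurable_ffun => p; apply: fin_measurable_bool.
  apply: measurable_fun_ler; apply: measurable_funD => //; apply: measurableT_comp => //.
rewrite (_ : (fun o => _) = (fun o => tie (finset (fun j => (j \notin S) &&
    [forall k, (k \notin S) ==> B o (k, j)])))).
  exact: (fin_measurable_comp (fun b : {ffun 'I_d * 'I_d -> bool} => tie
    (finset (fun j => (j \notin S) && [forall k, (k \notin S) ==> b (k, j)])))).
apply/funext => o; rewrite /noisy_pick /argmax_off; congr tie.
by apply/setP => j; rewrite !inE; congr (_ && _); apply: eq_forallb => k; rewrite ffunE.
Qed.

Lemma indicator_unit (R : realType) (b : bool) : 0 <= (b%:R : R) <= 1.
Proof. by case: b; rewrite ?lexx ?ler01. Qed.

Lemma measurable_indicator d (O : measurableType d) (R : realType) (T : finType)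
    (X : O -> T) (t : T) : fin_measurable X ->
  measurable_fun setT (fun o => (X o == t)%:R : R).
Proof. by move=> mX; exact: (measurable_fin_fun (fun x => (x == t)%:R : R) mX). Qed.

(** The limit [e -> 0] of [mean_ratio_le] with the constant ratio 1. *)
Lemma jensen_root d (O : measurableType d) (R : realType) (P : probability O R)
    (a : R) (f : O -> R) : 1 < a ->
  measurable_fun setT f -> (forall o, 0 <= f o <= 1) ->
  mean P f <= (mean P (fun o => f o `^ (a / (a - 1)))) `^ (1 - a^-1).
Proof.
move=> a1 mf f01; set J := _ `^ (1 - a^-1).
have J0 : 0 <= J by rewrite powR_ge0.
have H e : 0 < e -> mean P f <= expR (2 * a * e ^+ 2) * J.
  move=> e0.
  have := @mean_ratio_le _ _ _ P a e (fun=> 1) f a1 e0.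
  rewrite (_ : (fun o => 1 * f o) = f); last by apply/funext => o; rewrite mul1r.
  apply => //; last exact: mean_cst.
  by move=> _; rewrite -expR0 !ler_expR; apply/andP; split; lra.
have [J00|Jn0] := eqVneq J 0.
  by have := H 1 ltr01; rewrite J00 mulr0.
have Jp : 0 < J by rewrite lt_neqAle eq_sym Jn0.
rewrite leNgt; apply/negP => Jm.
have q1 : 1 < mean P f / J by rewrite ltr_pdivlMr// mul1r.
have l0 : 0 < ln (mean P f / J) by exact: ln_gt0.
have c0 : 0 < ln (mean P f / J) / (4 * a) by rewrite divr_gt0// mulr_gt0//; lra.
(* With this [e] the loss factor is the square root of [mean P f / J], a quotient supposed to exceed
   1; it would then be at most its own square root. *)
have := H (Num.sqrt (ln (mean P f / J) / (4 * a))).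
rewrite sqrtr_gt0 c0 => /(_ isT); rewrite sqr_sqrtr ?(ltW c0)//.
rewrite -ler_pdivrMr// -[X in X <= _]lnK ?posrE; last by apply: lt_trans q1.
rewrite ler_expR (_ : 2 * a * _ = ln (mean P f / J) / 2); first by lra.
by field; lra.
Qed.

Section finite_mean.
Context d (O : measurableType d) (R : realType) (P : probability O R).
Context (T : finType).

Lemma sum_indicator (x : T) (g : T -> R) : \sum_t ((x == t)%:R * g t) = g x.
Proof.
rewrite (bigD1 x)//= eqxx mul1r big1 ?addr0// => t tx.
by rewrite eq_sym (negbTE tx) mul0r.
Qed.

Lemma mean_fin (X : O -> T) (g : T -> R) : fin_measurable X ->
  mean P (fun o => g (X o)) = \sum_t mean P (fun o => (X o == t)%:R) * g t.
Proof.
move=> mX.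
have bX t : bounded_measurable (fun o => (X o == t)%:R : R).
  by apply: bm_unit => [|o]; [exact: measurable_indicator|exact: indicator_unit].
transitivity (mean P (fun o => \sum_t g t * (X o == t)%:R)).
  congr mean; apply/funext => o; rewrite -(sum_indicator (X o) g).
  by apply: eq_bigr => t _; rewrite mulrC.
rewrite mean_sum; last by move=> t; apply: bmM => //; exact: bm_cst.
by apply: eq_bigr => t _; rewrite meanZ// mulrC.
Qed.

Lemma fin_renyi (X Y : O -> T) (g : T -> R) (a e : R) :
  fin_measurable X -> fin_measurable Y -> 1 < a -> 0 < e ->
  (forall t, 0 <= g t <= 1) ->
  (forall t, mean P (fun o => (X o == t)%:R) <=
     expR e * mean P (fun o => (Y o == t)%:R)) ->
  (forall t, mean P (fun o => (Y o == t)%:R) <=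
     expR e * mean P (fun o => (X o == t)%:R)) ->
  mean P (fun o => g (X o)) <= expR (2 * a * e ^+ 2) *
    (mean P (fun o => g (Y o) `^ (a / (a - 1)))) `^ (1 - a^-1).
Proof.
move=> mX mY a1 e0 g01.
set p := fun t => mean P (fun o => (X o == t)%:R).
set q := fun t => mean P (fun o => (Y o == t)%:R).
move=> pq qp.
have p0 t : 0 <= p t by apply: mean_ge0 => o; case/andP: (indicator_unit R (X o == t)).
have q0 t : 0 <= q t by apply: mean_ge0 => o; case/andP: (indicator_unit R (Y o == t)).
(* At atoms of mass zero for [Y] the mass for [X] vanishes too; the default 1 keeps the ratio
   between [expR (- e)] and [expR e]. *)
pose r t := if q t == 0 then 1 else p t / q t.
have rq t : q t * r t = p t.
  rewrite /r; case: eqP => [q00|/eqP qn0]; last by rewrite mulrC divfK.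
  by rewrite mulr1 q00; apply/eqP; rewrite eq_le p0/=; have := pq t; rewrite -/(p t) -/(q t) q00 mulr0.
have re t : expR (- e) <= r t <= expR e.
  rewrite /r; case: eqP => [q00|/eqP qn0].
    by rewrite -expR0 !ler_expR; apply/andP; split; lra.
  have qt : 0 < q t by rewrite lt_neqAle eq_sym qn0 q0.
  apply/andP; split; last by rewrite ler_pdivrMr//; exact: pq.
  rewrite ler_pdivlMr// expRN mulrC ler_pdivrMr ?expR_gt0//.
  by rewrite mulrC; exact: qp.
rewrite (mean_fin g mX).
have -> : \sum_t p t * g t = mean P (fun o => r (Y o) * g (Y o)).
  rewrite (mean_fin (fun t => r t * g t) mY); apply: eq_bigr => t _.
  by rewrite mulrA rq.
apply: mean_ratio_le => //.
- exact: measurable_fin_fun.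
- exact: measurable_fin_fun.
- rewrite (mean_fin r mY); transitivity (\sum_t p t); first by apply: eq_bigr => t _; rewrite rq.
  rewrite -[RHS](mean_cst P 1) (mean_fin (fun=> 1) mX).
  by apply: eq_bigr => t _; rewrite mulr1.
Qed.

End finite_mean.

(** * Vectors of independent Laplace variables *)

Section noise_vector.
Context d (O : measurableType d) (R : realType) (P : probability O R).
Context (I : finType) (F : I -> set (set O)) (indF : indep_family P F).
Context (n : nat) (x : 'I_n -> {RV P >-> R}) (ix : 'I_n -> I).
Hypothesis ix_inj : injective ix.
Hypothesis ixF : forall j, F (ix j) = sigma_of (x j).

Definition noise_row (o : O) : 'rV[R]_n := \row_j x j o.

Lemma measurable_noise_row :
  measurable_fun setT (noise_row : O -> borelType 'rV[R]_n).
Proof.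
apply: measurable_rV => j.
by rewrite (_ : (fun o => _) = x j)//; apply/funext => o; rewrite mxE.
Qed.

(** Fubini in one coordinate: the row with coordinate [j] blanked out depends on the other noises
    only, so [x j] may be redrawn independently. *)
Lemma mean_resample (G : borelType 'rV[R]_n -> R) (j : 'I_n) :
  measurable_fun setT G -> (forall u, 0 <= G u <= 1) ->
  mean P (fun o => G (noise_row o)) =
  mean P (fun o => mean P (fun o' => G (upd j (noise_row o) (x j o')))).
Proof.
move=> mG G01.
pose K := [set i | exists2 k, k != j & i = ix k].
pose L := [set ix j].
have KL : K `&` L = set0.
  rewrite -subset0 => i [[k kj ->]] /= /ix_inj kj'.
  by rewrite kj' eqxx in kj.
pose X o : borelType 'rV[R]_n := upd j (noise_row o) 0.
have mX : measurable_fun setT (X : groupType O F K -> _).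
  apply: measurable_rV => k; rewrite /X.
  have [kj|kj] := eqVneq k j.
    rewrite (_ : (fun o => _) = fun=> 0)//.
    by apply/funext => o; rewrite mxE kj eqxx.
  rewrite (_ : (fun o => _) = x k).
    by apply: (groupType_measurable_coord (i := ix k)) => //; exists k.
  by apply/funext => o; rewrite !mxE (negbTE kj).
have mY : measurable_fun setT (x j : groupType O F L -> R).
  exact: (groupType_measurable_coord (i := ix j)).
pose H (z : borelType 'rV[R]_n * R) := G (upd j z.1 z.2).
have mH : measurable_fun setT H.
  by apply: (measurableT_comp mG); apply: measurable_upd.
have := mean_group_indep indF KL mX mY mH (fun z => G01 _).
rewrite (_ : (fun o => H (X o, x j o)) = (fun o => G (noise_row o))); last first.
  apply/funext => o; rewrite /H/= /X updK; congr G.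
  by rewrite -[RHS](upd_id j) mxE.
move=> ->; congr mean; apply/funext => o; congr mean; apply/funext => o'.
by rewrite /H/= /X updK.
Qed.

Variable b : R.
Hypothesis b0 : 0 < b.
Hypothesis lapx : forall j, has_laplace_law b (x j).

Lemma measurable_upd_section (G : borelType 'rV[R]_n -> R) (j : 'I_n) (u : 'rV[R]_n) :
  measurable_fun setT G -> measurable_fun setT (fun y : R => G (upd j u y)).
Proof.
by move=> mG; apply: (measurableT_comp mG); exact: measurable_upd.
Qed.

Lemma measurable_resampled (G : borelType 'rV[R]_n -> R) (j : 'I_n) :
  measurable_fun setT G -> (forall u, 0 <= G u <= 1) ->
  measurable_fun setT (fun u : borelType 'rV[R]_n => mean P (fun o' => G (upd j u (x j o')))).
Proof.
move=> mG G01.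
apply: (@measurable_mean_section _ _ _ _ _ P (fun z : borelType 'rV[R]_n * O => G (upd j z.1 (x j z.2)))) => //.
apply: (measurableT_comp mG); apply: measurable_upd => //.
exact: measurableT_comp.
Qed.

Lemma mean_shift_coord (G : borelType 'rV[R]_n -> R) (j : 'I_n) (t : R) :
  measurable_fun setT G -> (forall u, 0 <= G u <= 1) ->
  mean P (fun o => G (noise_row o + t *: delta_mx 0 j)) <=
  expR (`|t| / b) * mean P (fun o => G (noise_row o)).
Proof.
move=> mG G01.
pose G' (u : borelType 'rV[R]_n) := G (u + t *: delta_mx 0 j).
have mG' : measurable_fun setT G'.
  apply: (measurableT_comp mG); apply: measurable_rV => k.
  rewrite (_ : (fun o => _) = (fun u : 'rV[R]_n => u 0 k + (t *: delta_mx 0 j : 'rV[R]_n) 0 k)).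
    by apply: measurable_funD => //; exact: measurable_coord.
  by apply/funext => u; rewrite mxE.
change (mean P (fun o => G' (noise_row o)) <= expR (`|t| / b) * mean P (fun o => G (noise_row o))).
rewrite (mean_resample (G := G') j)//; last by move=> u; exact: G01.
rewrite (mean_resample (G := G) j)//.
have mR : measurable_fun setT (fun o => mean P (fun o' => G (upd j (noise_row o) (x j o')))).
  by apply: (measurableT_comp (measurable_resampled j mG G01)); exact: measurable_noise_row.
have bR : bounded_measurable (fun o => mean P (fun o' => G (upd j (noise_row o) (x j o')))).
  apply: bm_unit => // o; apply: mean_unit => //.
  by apply: (measurableT_comp (measurable_upd_section j (noise_row o) mG)).
rewrite -meanZ//; apply: mean_le => //.
- apply: bm_unit => [|o].
    by apply: (measurableT_comp (measurable_resampled j mG' (fun u => G01 _))); exact: measurable_noise_row.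
  apply: mean_unit => [|o']; last exact: G01.
  by apply: (measurableT_comp (measurable_upd_section j (noise_row o) mG')).
- by apply: bmM => //; exact: bm_cst.
- move=> o; rewrite /G'.
  under eq_fun do rewrite -upd_add.
  apply: (mean_laplace_shift_le (f := fun y => G (upd j (noise_row o) y))) => //.
  exact: measurable_upd_section.
Qed.

(* Given the noise of the other coordinates, if [j] wins for [v] then it still
   wins for [v'] once its own noise is raised by [2 * lam]. *)
Lemma noisy_pick_ratio (tie : {set 'I_n} -> 'I_n) (v v' : 'rV[R]_n)
    (S : {set 'I_n}) (j : 'I_n) (lam : R) :
  tie_breaking tie -> 0 < lam -> (forall k, `|v 0 k - v' 0 k| <= lam / 2) ->
  mean P (fun o => (noisy_pick tie v S (x ^~ o) == j)%:R) <=
  expR (2 * lam / b) * mean P (fun o => (noisy_pick tie v' S (x ^~ o) == j)%:R).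
Proof.
move=> tb lam0 vv.
have bm v0 : bounded_measurable (fun o => (noisy_pick tie v0 S (x ^~ o) == j)%:R : R).
  apply: bm_unit => [|o]; last exact: indicator_unit.
  by apply: measurable_indicator; apply: noisy_pick_fin_measurable => // k; exact: measurable_cst.
have [ST|ST] := eqVneq S [set: 'I_n]%SET.
  (* No index is left to select: the argmax set is empty and the pick is the default value of [tie],
     the same for [v] and [v']. *)
  have pickT v0 o : noisy_pick tie v0 S (x ^~ o) = tie finset.set0.
    rewrite /noisy_pick; congr tie; apply/setP => k.
    by rewrite finset.in_set0 /argmax_off inE ST finset.in_setT.
  rewrite -meanZ//; apply: mean_le => //; first by apply: bmM => //; exact: bm_cst.
  move=> o; rewrite !pickT; rewrite -[X in X <= _]mul1r ler_wpM2r//.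
  by rewrite -expR0 ler_expR divr_ge0 ?mulr_ge0// ltW.
pose G (u : borelType 'rV[R]_n) : R := (noisy_pick tie v' S (fun k => u 0 k) == j)%:R.
have mG : measurable_fun setT G.
  apply: measurable_indicator; apply: noisy_pick_fin_measurable => k.
    exact: measurable_cst.
  exact: measurable_coord.
have := @mean_shift_coord G j (2 * lam) mG (fun u => indicator_unit R _).
have GE : (fun o => G (noise_row o)) = (fun o => (noisy_pick tie v' S (x ^~ o) == j)%:R).
  apply/funext => o; rewrite /G; congr ((noisy_pick _ _ _ _ == _)%:R).
  by apply/funext => k; rewrite mxE.
rewrite GE ger0_norm ?mulr_ge0 ?(ltW lam0)//.
apply: le_trans; apply: mean_le => //.
  apply: bm_unit => [|o]; last exact: indicator_unit.
  apply: (@measurableT_comp _ _ _ _ _ _ G) => //; apply: measurable_rV => k.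
  rewrite (_ : (fun o => _) = (fun o => x k o + (2 * lam *: delta_mx 0 j : 'rV[R]_n) 0 k)).
    by apply: measurable_funD.
  by apply/funext => u; rewrite !mxE.
move=> o; rewrite /G; case: eqP => [pj|_]; last by case/andP: (indicator_unit R (noisy_pick tie v' S (fun k => (noise_row o + (2 * lam) *: delta_mx 0 j) 0 k) == j)).
(* Scores move by at most [lam / 2], so gaps move by at most [lam], and a raise of [2 * lam]
   strictly exceeds this. *)
have lt2 : 2 * (lam / 2) < 2 * lam by lra.
rewrite -[X in noisy_pick _ _ _ X == _](_ : (fun k => if k == j then x k o + 2 * lam else x k o) = _).
  by rewrite (noisy_pick_shift tb ST vv lt2 pj) eqxx.
by apply/funext => k; rewrite !mxE eqxx/=; case: eqP => _; rewrite ?mulr1 ?mulr0 ?addr0.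
Qed.

(** One shifted coordinate at a time. Given the others, the one-dimensional bound yields [A]^
    th[, with]A[the conditional mean of]G [^ p]. The induction hypothesis is applied to the test
    function [A]^ th[; since]th * p =
    1[, its]p[-th power is]A[again, and averaging]A[restores the mean of]G [^ p]. *)
Lemma noise_row_renyi (l : seq 'I_n) (t : 'I_n -> R) (G : borelType 'rV[R]_n -> R)
    (a e : R) :
  1 < a -> 0 < e -> uniq l -> (forall j, `|t j| / b <= e) ->
  measurable_fun setT G -> (forall u, 0 <= G u <= 1) ->
  mean P (fun o => G (noise_row o + \sum_(j <- l) t j *: delta_mx 0 j)) <=
  expR (2 * a * e ^+ 2) ^+ size l *
  (mean P (fun o => G (noise_row o) `^ (a / (a - 1)))) `^ (1 - a^-1).
Proof.
move=> a1 e0 + te; set K := expR _; set p := a / (a - 1); set th := 1 - a^-1.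
have p0 : 0 < p by rewrite divr_gt0//; lra.
have th0 : 0 < th by rewrite subr_gt0 invf_lt1//; lra.
have thp : th * p = 1 by rewrite /th /p; field; lra.
have K0 : 0 < K by exact: expR_gt0.
have mpw (r : R) d2 (T2 : measurableType d2) (f : T2 -> R) : measurable_fun setT f -> measurable_fun setT (fun y => f y `^ r).
  by move=> mf; exact: (@measurableT_comp _ _ _ _ _ _ (@powR R ^~ r)).
elim: l G => [|j l IH] G.
  move=> _ mG G01; rewrite expr0 mul1r; under eq_fun do rewrite big_nil addr0.
  by apply: jensen_root => //; exact: (measurableT_comp mG measurable_noise_row).
move=> /= /andP[jl ul] mG G01.
have mGp : measurable_fun setT (fun u : borelType 'rV[R]_n => G u `^ p) by exact: mpw.
have Gp01 u : 0 <= G u `^ p <= 1 by apply: powR_unit => //; exact: ltW.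
pose A (u : borelType 'rV[R]_n) := mean P (fun o' => G (upd j u (x j o')) `^ p).
have mA : measurable_fun setT A by exact: (measurable_resampled j mGp).
have A01 u : 0 <= A u <= 1.
  by apply: mean_unit => //; exact: (measurableT_comp (measurable_upd_section j u mGp)).
have mAth : measurable_fun setT (fun u => A u `^ th) by exact: mpw.
have Ath01 u : 0 <= A u `^ th <= 1 by apply: powR_unit => //; exact: ltW.
pose tail : 'rV[R]_n := \sum_(k <- l) t k *: delta_mx 0 k.
have tailj : tail 0 j = 0.
  rewrite /tail summxE big_seq big1// => k kl; rewrite !mxE eqxx/=.
  by case: eqP => [jk|]; rewrite ?mulr0//; rewrite jk kl in jl.
pose G1 (u : borelType 'rV[R]_n) := G (u + (t j *: delta_mx 0 j + tail)).
have mtr (c : 'rV[R]_n) : measurable_fun setT (fun u : borelType 'rV[R]_n => u + c : borelType 'rV[R]_n).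
  apply: measurable_rV => k.
  rewrite (_ : (fun o => _) = (fun u : 'rV[R]_n => u 0 k + c 0 k)).
    by apply: measurable_funD => //; exact: measurable_coord.
  by apply/funext => u; rewrite mxE.
have mG1 : measurable_fun setT G1 by exact: (measurableT_comp mG).
under eq_fun do rewrite big_cons.
change (mean P (fun o => G1 (noise_row o)) <= K ^+ (size l).+1 * (mean P (fun o => G (noise_row o) `^ p)) `^ th).
rewrite (mean_resample (G := G1) j)//; last by move=> u; exact: G01.
have step u : mean P (fun o' => G1 (upd j u (x j o'))) <= K * (A (u + tail)) `^ th.
  have E y : G1 (upd j u y) = G (upd j (u + tail) (y + t j)).
    rewrite /G1; congr G; apply/rowP => k; rewrite !mxE eqxx/=.
    case: eqP => [->|_]; last by rewrite mulr0 add0r.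
    by rewrite mulr1 tailj addr0.
  under eq_fun do rewrite E.
  apply: (laplace_renyi (b := b) (f := fun y => G (upd j (u + tail) y))) => //.
  exact: measurable_upd_section.
have bA : bounded_measurable (fun o => A (noise_row o + tail) `^ th).
  apply: bm_unit => //.
  apply: (measurableT_comp mAth); apply: (measurableT_comp (mtr tail)); exact: measurable_noise_row.
apply: (@le_trans _ _ (K * mean P (fun o => A (noise_row o + tail) `^ th))).
  rewrite -meanZ//; apply: mean_le => //.
  - apply: bm_unit => [|o].
      apply: (measurableT_comp (measurable_resampled j mG1 (fun u => G01 _))); exact: measurable_noise_row.
    apply: mean_unit => [|o']; last exact: G01.
    exact: (measurableT_comp (measurable_upd_section j (noise_row o) mG1)).
  - by apply: bmM => //; exact: bm_cst.
rewrite exprS -mulrA ler_pM2l//.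
apply: (le_trans (IH (fun u => A u `^ th) ul mAth Ath01)).
apply: ler_wpM2l; first by apply: exprn_ge0; exact: ltW.
rewrite le_eqVlt; apply/orP; left; apply/eqP; congr (_ `^ _).
rewrite [RHS](mean_resample (G := fun u => G u `^ p) j)//.
congr mean; apply/funext => o.
rewrite -powRrM thp powRr1//; by case/andP: (A01 (noise_row o)).
Qed.

End noise_vector.

(** Arbitrary initial set and list of rounds, for the inductions; [noisyHT_select] is the case of
    the empty set and [enum 'I_s]. *)
Definition pick_fold (R : realType) (d s : nat) (tie : {set 'I_d} -> 'I_d)
    (v : 'rV[R]_d) (w : 'I_s -> 'I_d -> R) (S : {set 'I_d}) (l : seq 'I_s) :
    {set 'I_d} :=
  foldl (fun S r => noisy_pick tie v S (w r) |: S)%SET S l.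

Lemma pick_fold_card (R : realType) (d s : nat) (tie : {set 'I_d} -> 'I_d)
    (v : 'rV[R]_d) (w : 'I_s -> 'I_d -> R) (S : {set 'I_d}) (l : seq 'I_s) :
  (#|pick_fold tie v w S l| <= #|S| + size l)%N.
Proof.
elim: l S => [|r l IH] S; first by rewrite addn0.
apply: (leq_trans (IH _)); rewrite /= addnS -addSn leq_add2r.
by rewrite cardsU1; case: (_ \notin _).
Qed.

Lemma pick_fold_fin_measurable d' (O : measurableType d') (R : realType)
    (d s : nat) (tie : {set 'I_d} -> 'I_d) (v : O -> 'rV[R]_d)
    (w : 'I_s -> 'I_d -> O -> R) (S : {set 'I_d}) (l : seq 'I_s) :
  (forall k, measurable_fun setT (fun o => v o 0 k)) ->
  (forall r k, r \in l -> measurable_fun setT (w r k)) ->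
  fin_measurable (fun o => pick_fold tie (v o) (fun r k => w r k o) S l).
Proof.
move=> mv; elim: l S => [|r l IH] S mw; first by move=> t; rewrite preimage_cst; case: ifP.
have mp : fin_measurable (fun o => noisy_pick tie (v o) S (fun k => w r k o)).
  by apply: noisy_pick_fin_measurable => // k; apply: mw; rewrite mem_head.
apply: (fin_measurable_app (Y := fun j o =>
  pick_fold tie (v o) (fun r k => w r k o) (j |: S)%SET l) mp) => j.
by apply: IH => r' k r'l; apply: mw; rewrite in_cons r'l orbT.
Qed.

Definition keep (R : realType) (d : nat) (S : {set 'I_d}) (u : 'rV[R]_d) :
    'rV[R]_d := \row_j (if j \in S then u 0 j else 0).

Lemma measurable_keep d' (O : measurableType d') (R : realType) (d : nat)
    (S : {set 'I_d}) (u : O -> 'rV[R]_d) :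
  (forall k, measurable_fun setT (fun o => u o 0 k)) ->
  measurable_fun setT (fun o => keep S (u o) : borelType 'rV[R]_d).
Proof.
move=> mu; apply: measurable_rV => k.
rewrite (_ : (fun o => _) = (fun o => if k \in S then u o 0 k else 0)).
  by case: (k \in S).
by apply/funext => o; rewrite mxE.
Qed.

Lemma noisyHTE (R : realType) (d s : nat) (tie : {set 'I_d} -> 'I_d)
    (v : 'rV[R]_d) (w : 'I_s -> 'I_d -> R) (w' : 'I_d -> R) :
  noisyHT tie v w w' = keep (noisyHT_select tie v w) (v + \row_j w' j).
Proof. by apply/rowP => j; rewrite !mxE. Qed.

Lemma measurable_noisyHT d' (O : measurableType d') (R : realType)
    (d s : nat) (tie : {set 'I_d} -> 'I_d) (v : O -> 'rV[R]_d)
    (w : 'I_s -> 'I_d -> O -> R) (w' : 'I_d -> O -> R) :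
  (forall k, measurable_fun setT (fun o => v o 0 k)) ->
  (forall r k, measurable_fun setT (w r k)) ->
  (forall k, measurable_fun setT (w' k)) ->
  measurable_fun setT (fun o => noisyHT tie (v o) (fun r k => w r k o)
    (fun k => w' k o) : borelType 'rV[R]_d).
Proof.
move=> mv mw mw'.
rewrite (_ : (fun o => _) = (fun o => keep
    (pick_fold tie (v o) (fun r k => w r k o) finset.set0 (enum 'I_s))
    (v o + \row_k w' k o))); last by apply/funext => o; rewrite noisyHTE.
apply: (measurable_fin_app (Y := fun S o => keep S (v o + \row_k w' k o) : borelType 'rV[R]_d)).
  by apply: pick_fold_fin_measurable => // r k _.
move=> S; apply: measurable_keep => k.
rewrite (_ : (fun o => _) = (fun o => v o 0 k + w' k o)).
  exact: measurable_funD.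
by apply/funext => o; rewrite !mxE.
Qed.

(** * One stage: selection, then release on the selected support *)

Section stage.
Context d' (O : measurableType d') (R : realType) (P : probability O R).
Context (I : finType) (F : I -> set (set O)) (indF : indep_family P F).
Context (d s : nat) (tie : {set 'I_d} -> 'I_d) (tb : tie_breaking tie).
Context (w : 'I_s -> 'I_d -> {RV P >-> R}) (w' : 'I_d -> {RV P >-> R}).
Context (ix : 'I_s * 'I_d + 'I_d -> I) (ix_inj : injective ix).
Hypothesis wF : forall r j, F (ix (inl (r, j))) = sigma_of (w r j).
Hypothesis w'F : forall j, F (ix (inr j)) = sigma_of (w' j).
Context (b lam a : R) (b0 : 0 < b) (lam0 : 0 < lam) (a1 : 1 < a).
Hypothesis lapw : forall r j, has_laplace_law b (w r j).
Hypothesis lapw' : forall j, has_laplace_law b (w' j).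

(** [pw] is the exponent conjugate to [a] and [th] its inverse. [e1] and [e2] are the pure privacy
    levels of a selection round and of a released coordinate, [K1] and [K2] the corresponding loss
    factors. *)
Let pw := a / (a - 1).
Let th := 1 - a^-1.
Let e1 := 2 * lam / b.
Let e2 := lam / 2 / b.
Let K1 := expR (2 * a * e1 ^+ 2).
Let K2 := expR (2 * a * e2 ^+ 2).

Let p0 : 0 < pw. Proof. by rewrite divr_gt0//; have := a1; lra. Qed.
Let th0 : 0 < th.
Proof. by have := a1; rewrite /th => ?; rewrite subr_gt0 invf_lt1//; lra. Qed.
Let thp : th * pw = 1.
Proof. by rewrite /th /pw; have := a1 => ?; field; lra. Qed.
Let e10 : 0 < e1. Proof. by rewrite divr_gt0// mulr_gt0. Qed.
Let e20 : 0 < e2. Proof. by rewrite !divr_gt0. Qed.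

Let pf v S l := fun o => pick_fold tie v (fun r k => w r k o) S l.
Let pk v S r := fun o => noisy_pick tie v S (fun k => w r k o).

Let mpk v S r : fin_measurable (pk v S r).
Proof. by apply: noisy_pick_fin_measurable => // k; exact: measurable_cst. Qed.

Let mpf v S l : fin_measurable (pf v S l).
Proof. by apply: pick_fold_fin_measurable => // k; exact: measurable_cst. Qed.

Let mean_pf_unit v S l (g : {set 'I_d} -> R) : (forall S, 0 <= g S <= 1) ->
  0 <= mean P (fun o => g (pf v S l o)) <= 1.
Proof. by move=> g01; apply: mean_unit => //; exact: measurable_fin_fun. Qed.

(** The first pick uses the noise of round [r] alone; with its value fixed, the remaining picks use
    the independent noises of the rounds in [l]. *)
Lemma pick_fold_peel (v : 'rV[R]_d) (S : {set 'I_d}) (r : 'I_s) (l : seq 'I_s) (g : {set 'I_d} -> R) :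
  r \notin l -> (forall S, 0 <= g S <= 1) ->
  mean P (fun o => g (pf v S (r :: l) o)) =
  \sum_j mean P (fun o => (pk v S r o == j)%:R) *
         mean P (fun o => g (pf v (j |: S)%SET l o)).
Proof.
move=> rl g01.
have mg v0 S0 l0 : measurable_fun setT (fun o => g (pf v0 S0 l0 o)) by exact: measurable_fin_fun.
have bg v0 S0 l0 : bounded_measurable (fun o => g (pf v0 S0 l0 o)) by exact: bm_unit.
have bp j : bounded_measurable (fun o => (pk v S r o == j)%:R : R).
  by apply: bm_unit => [|o]; [exact: measurable_indicator|exact: indicator_unit].
transitivity (mean P (fun o => \sum_j (pk v S r o == j)%:R * g (pf v (j |: S)%SET l o))).
  congr mean; apply/funext => o.
  by rewrite (sum_indicator (pk v S r o) (fun j => g (pf v (j |: S)%SET l o))).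
rewrite mean_sum; last by move=> j; exact: bmM.
apply: eq_bigr => j _.
apply: (mean_mul_indep indF (K := [set i | exists k, i = ix (inl (r, k))])
  (L := [set i | exists r' k, r' \in l /\ i = ix (inl (r', k))])) => //.
- rewrite -subset0 => i [[k ->]] [r' [k' [r'l /ix_inj[rr' _]]]].
  by rewrite rr' r'l in rl.
- apply: measurable_indicator; apply: noisy_pick_fin_measurable => k.
    exact: measurable_cst.
  by apply: (groupType_measurable_coord (i := ix (inl (r, k)))) => //; exists k.
- apply: measurable_fin_fun; apply: pick_fold_fin_measurable => [k|r' k r'l].
    exact: measurable_cst.
  by apply: (groupType_measurable_coord (i := ix (inl (r', k)))) => //; exists r', k.
- by move=> o; exact: indicator_unit.
Qed.

(** Adaptive composition: with the first pick fixed at [j], the induction hypothesis produces [M j]^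
    th[, where]M j[is the mean of]g [^ pw] over the later rounds run on [v']. The bound for the
    first pick raises this to the power [pw], which gives back [M j]. *)
Lemma pick_fold_renyi (v v' : 'rV[R]_d) (l : seq 'I_s) (S : {set 'I_d}) (g : {set 'I_d} -> R) :
  uniq l -> (forall S, 0 <= g S <= 1) ->
  (forall k, `|v 0 k - v' 0 k| <= lam / 2) ->
  mean P (fun o => g (pf v S l o)) <=
  K1 ^+ size l * (mean P (fun o => g (pf v' S l o) `^ pw)) `^ th.
Proof.
move=> + g01 vv; elim: l S => [|r l IH] S /=.
  rewrite /pf/= !mean_cst expr0 mul1r -powRrM mulrC thp powRr1//.
  by case/andP: (g01 S).
move=> /andP[rl ul].
have gp01 S' : 0 <= g S' `^ pw <= 1 by apply: powR_unit => //; exact: ltW.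
rewrite (pick_fold_peel v S rl g01) (pick_fold_peel v' S (g := fun S => g S `^ pw) rl gp01).
pose M j := mean P (fun o => g (pf v' (j |: S)%SET l o) `^ pw).
have M01 j : 0 <= M j <= 1 by exact: (mean_pf_unit v' (j |: S)%SET l gp01).
have Mt01 j : 0 <= M j `^ th <= 1 by apply: powR_unit => //; exact: ltW.
apply: (@le_trans _ _ (K1 ^+ size l * \sum_j mean P (fun o => (pk v S r o == j)%:R) * M j `^ th)).
  rewrite mulr_sumr; apply: ler_sum => j _; rewrite mulrCA ler_wpM2l//.
    by apply: mean_ge0 => o; case/andP: (indicator_unit R (pk v S r o == j)).
  exact: IH.
rewrite exprSr -mulrA ler_pM2l ?exprn_gt0 ?expR_gt0//.
rewrite -(mean_fin P (fun j => M j `^ th) (mpk v S r)).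
apply: (le_trans (fin_renyi (mpk v S r) (mpk v' S r) a1 e10 Mt01 _ _)).
- move=> j; apply: (noisy_pick_ratio (ix := fun k => ix (inl (r, k))) indF) => //.
  by move=> k k' /ix_inj[].
- move=> j; apply: (noisy_pick_ratio (ix := fun k => ix (inl (r, k))) indF) => //.
    by move=> k k' /ix_inj[].
  by move=> k; rewrite distrC.
rewrite ler_pM2l ?expR_gt0// le_eqVlt; apply/orP; left; apply/eqP; congr (_ `^ _).
rewrite (mean_fin P (fun j => (M j `^ th) `^ pw) (mpk v' S r)).
apply: eq_bigr => j _; congr (_ * _).
by rewrite -powRrM thp powRr1//; case/andP: (M01 j).
Qed.

Let W' := noise_row w'.

Let release (S : {set 'I_d}) (v : 'rV[R]_d) (f : borelType 'rV[R]_d -> R) := mean P (fun o => f (keep S (v + W' o))).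

Let mrel (S : {set 'I_d}) (v : 'rV[R]_d) (f : borelType 'rV[R]_d -> R) : measurable_fun setT f ->
  measurable_fun setT (fun o => f (keep S (v + W' o))).
Proof.
move=> mf; apply: (measurableT_comp mf); apply: measurable_keep => k.
rewrite (_ : (fun o => _) = (fun o => v 0 k + w' k o)).
  exact: measurable_funD.
by apply/funext => o; rewrite !mxE.
Qed.

Lemma mean_noisyHT (v : 'rV[R]_d) (f : borelType 'rV[R]_d -> R) :
  measurable_fun setT f -> (forall u, 0 <= f u <= 1) ->
  mean P (fun o => f (noisyHT tie v (fun r k => w r k o) (fun k => w' k o))) =
  mean P (fun o => release (pf v finset.set0 (enum 'I_s) o) v f).
Proof.
move=> mf f01.
set sel := pf v finset.set0 (enum 'I_s).
have msel : fin_measurable sel by exact: mpf.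
rewrite (mean_fin P (fun S => release S v f) msel).
transitivity (mean P (fun o => \sum_S (sel o == S)%:R * f (keep S (v + W' o)))).
  congr mean; apply/funext => o.
  by rewrite (sum_indicator (sel o) (fun S => f (keep S (v + W' o)))) noisyHTE.
rewrite mean_sum; last first.
  move=> S; apply: bmM; apply: bm_unit => //; first exact: measurable_indicator.
    by move=> o; exact: indicator_unit.
  exact: mrel.
apply: eq_bigr => S _.
apply: (mean_mul_indep indF (K := [set i | exists r k, i = ix (inl (r, k))])
  (L := [set i | exists k, i = ix (inr k)])) => //.
- by rewrite -subset0 => i [[r [k ->]]] [k' /ix_inj].
- apply: measurable_indicator; apply: pick_fold_fin_measurable => [k|r k _].
    exact: measurable_cst.
  by apply: (groupType_measurable_coord (i := ix (inl (r, k)))) => //; exists r, k.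
- apply: (measurableT_comp mf); apply: measurable_keep => k.
  rewrite (_ : (fun o => _) = (fun o => v 0 k + w' k o)).
    apply: measurable_funD => //.
    by apply: (groupType_measurable_coord (i := ix (inr k))) => //; exists k.
  by apply/funext => o; rewrite !mxE.
- by move=> o; exact: indicator_unit.
Qed.

(** Only the coordinates in [S] are visible, so replacing [v'] by [v] amounts to shifting the [#|S|]
    noises on [S] by the entries of [v - v']. *)
Lemma release_renyi (S : {set 'I_d}) (v v' : 'rV[R]_d) (f : borelType 'rV[R]_d -> R) :
  measurable_fun setT f -> (forall u, 0 <= f u <= 1) ->
  (forall k, `|v 0 k - v' 0 k| <= lam / 2) ->
  release S v f <=
  K2 ^+ #|S| * (release S v' (fun u => f u `^ pw)) `^ th.
Proof.
move=> mf f01 vv.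
pose G (u : borelType 'rV[R]_d) := f (keep S (v' + u)).
have mG : measurable_fun setT G.
  apply: (measurableT_comp mf); apply: measurable_keep => k.
  rewrite (_ : (fun o => _) = (fun u : 'rV[R]_d => v' 0 k + u 0 k)).
    by apply: measurable_funD => //; exact: measurable_coord.
  by apply/funext => o; rewrite !mxE.
have te j : `|v 0 j - v' 0 j| / b <= e2 by rewrite ler_pM2r ?invr_gt0.
have := @noise_row_renyi _ _ _ P _ _ indF _ w' (fun k => ix (inr k)) _ w'F b b0 lapw'
  (enum S) (fun j => v 0 j - v' 0 j) G a e2 a1 e20 (enum_uniq _) te mG (fun u => f01 _).
rewrite -cardE => H; rewrite /release (_ : (fun o => f (keep S (v + W' o))) =
    (fun o => G (noise_row w' o + \sum_(j <- enum S) (v 0 j - v' 0 j) *: delta_mx 0 j))).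
  by apply: H => k k' /ix_inj[].
apply/funext => o; rewrite /G; congr f; apply/rowP => k; rewrite !mxE.
case: ifP => // kS; rewrite summxE (bigD1_seq k) ?mem_enum ?enum_uniq//=.
rewrite big1 => [|j jk]; last by rewrite !mxE eqxx/= eq_sym (negbTE jk) mulr0.
by rewrite !mxE !eqxx/= mulr1 addr0; ring.
Qed.

Lemma noisyHT_renyi (v v' : 'rV[R]_d) (f : borelType 'rV[R]_d -> R) :
  measurable_fun setT f -> (forall u, 0 <= f u <= 1) ->
  (forall k, `|v 0 k - v' 0 k| <= lam / 2) ->
  mean P (fun o => f (noisyHT tie v (fun r k => w r k o) (fun k => w' k o))) <=
  (expR (2 * a * ((2 * lam / b) ^+ 2 + (lam / 2 / b) ^+ 2))) ^+ s *
  (mean P (fun o => f (noisyHT tie v' (fun r k => w r k o) (fun k => w' k o))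
     `^ (a / (a - 1)))) `^ (1 - a^-1).
Proof.
move=> mf f01 vv.
have fp01 u : 0 <= f u `^ pw <= 1 by apply: powR_unit => //; exact: ltW.
have mfp : measurable_fun setT (fun u => f u `^ pw).
  exact: (@measurableT_comp _ _ _ _ _ _ (@powR R ^~ pw)).
rewrite (mean_noisyHT v mf f01).
rewrite [X in _ <= _ * X `^ _](mean_noisyHT v' (f := fun u => f u `^ pw) mfp fp01).
pose M S := release S v' (fun u => f u `^ pw).
have M01 S : 0 <= M S <= 1 by apply: mean_unit => [|o]; [exact: (mrel S v' mfp)|exact: fp01].
have Mt01 S : 0 <= M S `^ th <= 1 by apply: powR_unit => //; exact: ltW.
have bsel (g : {set 'I_d} -> R) : (forall S, 0 <= g S <= 1) ->
    bounded_measurable (fun o => g (pf v finset.set0 (enum 'I_s) o)).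
  by move=> g01; apply: bm_unit => //; exact: measurable_fin_fun.
(* The loss of the release depends on the size of the random support; as [K2 >= 1], that size may be
   replaced by its bound [s]. *)
have K21 : 1 <= K2.
  by rewrite -[X in X <= _]expR0 ler_expR mulr_ge0 ?sqr_ge0//; have := a1; lra.
apply: (@le_trans _ _ (K2 ^+ s * mean P (fun o => M (pf v finset.set0 (enum 'I_s) o) `^ th))).
  rewrite -meanZ; last exact: (bsel (fun S => M S `^ th)).
  apply: mean_le.
  - by apply: (bsel (fun S => release S v f)) => S; apply: mean_unit => //; exact: mrel.
  - by apply: bmM; [exact: bm_cst|exact: (bsel (fun S => M S `^ th))].
  - move=> o; set S := pf _ _ _ o.
    apply: (le_trans (release_renyi S mf f01 vv)).
    apply: ler_wpM2r; first by case/andP: (Mt01 S).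
    rewrite ler_weXn2l//.
    have := pick_fold_card tie v (fun r k => w r k o) finset.set0 (enum 'I_s).
    by rewrite finset.cards0 add0n size_enum_ord.
apply: (@le_trans _ _ (K2 ^+ s * (K1 ^+ s * (mean P (fun o => (M (pf v' finset.set0 (enum 'I_s) o) `^ th) `^ pw)) `^ th))).
  rewrite ler_pM2l ?exprn_gt0 ?expR_gt0//.
  have := pick_fold_renyi finset.set0 (g := fun S => M S `^ th) (enum_uniq 'I_s) Mt01 vv.
  by rewrite size_enum_ord.
rewrite mulrA -exprMn -expRD.
have -> : 2 * a * e2 ^+ 2 + 2 * a * e1 ^+ 2 = 2 * a * ((2 * lam / b) ^+ 2 + (lam / 2 / b) ^+ 2).
  by rewrite /e1 /e2; ring.
rewrite ler_pM2l ?exprn_gt0 ?expR_gt0// le_eqVlt; apply/orP; left; apply/eqP.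
congr (_ `^ _); congr mean; apply/funext => o; rewrite -powRrM thp powRr1//.
by case/andP: (M01 (pf v' finset.set0 (enum 'I_s) o)).
Qed.

End stage.

(** * Composition of the stages *)

Definition noisy_run (R : realType) (d s T : nat) (tie : {set 'I_d} -> 'I_d)
    (A : 'rV[R]_d -> 'rV[R]_d) (w : 'I_T -> 'I_s -> 'I_d -> R)
    (w' : 'I_T -> 'I_d -> R) (u : 'rV[R]_d) (l : seq 'I_T) : 'rV[R]_d :=
  foldl (fun b t => noisyHT tie (A b) (w t) (w' t)) u l.

Lemma measurable_noisy_run d' (O : measurableType d') (R : realType)
    (d s T : nat) (tie : {set 'I_d} -> 'I_d) (A : O -> 'rV[R]_d -> 'rV[R]_d)
    (w : 'I_T -> 'I_s -> 'I_d -> O -> R) (w' : 'I_T -> 'I_d -> O -> R)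
    (u : O -> 'rV[R]_d) (l : seq 'I_T) :
  (forall v : O -> 'rV[R]_d,
     measurable_fun setT (v : O -> borelType 'rV[R]_d) ->
     forall k, measurable_fun setT (fun o => A o (v o) 0 k)) ->
  (forall t r k, t \in l -> measurable_fun setT (w t r k)) ->
  (forall t k, t \in l -> measurable_fun setT (w' t k)) ->
  measurable_fun setT (u : O -> borelType 'rV[R]_d) ->
  measurable_fun setT (fun o => noisy_run tie (A o) (fun t r k => w t r k o)
    (fun t k => w' t k o) (u o) l : borelType 'rV[R]_d).
Proof.
move=> mA; elim: l u => [//|t l IH] u mw mw' mu.
apply: (IH (fun o => noisyHT tie (A o (u o)) (fun r k => w t r k o) (fun k => w' t k o))).
- by move=> t' r k t'l; apply: mw; rewrite in_cons t'l orbT.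
- by move=> t' k t'l; apply: mw'; rewrite in_cons t'l orbT.
- apply: (measurable_noisyHT tie (v := fun o => A o (u o))).
  + by move=> k; exact: mA.
  + by move=> r k; apply: mw; rewrite mem_head.
  + by move=> k; apply: mw'; rewrite mem_head.
Qed.

(** Passage from a Renyi-type bound to approximate privacy. Either the left side is at most
    [expR e * q], or [q < expR (a * (k - e))], and inserting this upper bound for [q] on the left
    gives the additive term. *)
Lemma root_to_dp (R : realType) (a e k q : R) : 1 < a -> 0 <= q ->
  expR k * q `^ (1 - a^-1) <= expR e * q + expR (k * a - (a - 1) * e).
Proof.
move=> a1 q0; have a0 : 0 < a by lra.
have th0 : 0 < 1 - a^-1 by rewrite subr_gt0 invf_lt1.
have [->|qn0] := eqVneq q 0.
  by rewrite powR0 ?gt_eqF// !mulr0 add0r expR_ge0.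
have qp : 0 < q by rewrite lt_neqAle eq_sym qn0.
have [y qy] : exists y, q = expR y by exists (ln q); rewrite lnK.
rewrite qy -expRM -!expRD.
have [h|h] := leP (k - y / a) e.
  apply: ler_wpDr; first exact: expR_ge0.
  by rewrite ler_expR; lra.
apply: ler_wpDl; first exact: expR_ge0.
rewrite ler_expR; have : y * (1 - a^-1) = (y / a) * (a - 1) by field; lra.
move=> ->; nra.
Qed.

Section composition.
Context d' (O : measurableType d') (R : realType) (P : probability O R).
Context (I : finType) (F : I -> set (set O)) (indF : indep_family P F).
Context (d s T : nat) (tie : {set 'I_d} -> 'I_d) (tb : tie_breaking tie).
Context (w : 'I_T -> 'I_s -> 'I_d -> {RV P >-> R}) (w' : 'I_T -> 'I_d -> {RV P >-> R}).
Context (ix : 'I_T * ('I_s * 'I_d + 'I_d) -> I) (ix_inj : injective ix).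
Hypothesis wF : forall t r j, F (ix (t, inl (r, j))) = sigma_of (w t r j).
Hypothesis w'F : forall t j, F (ix (t, inr j)) = sigma_of (w' t j).
Context (b lam a : R) (b0 : 0 < b) (lam0 : 0 < lam) (a1 : 1 < a).
Hypothesis lapw : forall t r j, has_laplace_law b (w t r j).
Hypothesis lapw' : forall t j, has_laplace_law b (w' t j).

Let pw := a / (a - 1).
Let th := 1 - a^-1.
Let p0 : 0 < pw. Proof. by rewrite divr_gt0//; have := a1; lra. Qed.
Let th0 : 0 < th.
Proof. by have := a1; rewrite /th => ?; rewrite subr_gt0 invf_lt1//; lra. Qed.
Let thp : th * pw = 1.
Proof. by rewrite /th /pw; have := a1 => ?; field; lra. Qed.
Let Ks := (expR (2 * a * ((2 * lam / b) ^+ 2 + (lam / 2 / b) ^+ 2))) ^+ s.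
Let Ks0 : 0 < Ks. Proof. by rewrite exprn_gt0// expR_gt0. Qed.

Definition borel_map (A : 'rV[R]_d -> 'rV[R]_d) :=
  forall k, measurable_fun setT (fun u : borelType 'rV[R]_d => A u 0 k).

Let run A u l o := noisy_run tie A (fun t r k => w t r k o) (fun t k => w' t k o) u l.

Let mrun A u l : borel_map A ->
  measurable_fun setT (fun o => run A u l o : borelType 'rV[R]_d).
Proof.
move=> mA; apply: (measurable_noisy_run tie (A := fun=> A) (u := fun=> u)
  (w := fun t r k => w t r k) (w' := fun t k => w' t k)) => //.
by move=> v mv k; exact: (measurableT_comp (mA k) mv).
Qed.

Let grp (l : seq 'I_T) := [set i | exists t k, t \in l /\ i = ix (t, k)].

Let mrun_pair A l : borel_map A ->
  measurable_fun setT (fun z : borelType 'rV[R]_d * groupType O F (grp l) =>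
    run A z.1 l z.2 : borelType 'rV[R]_d).
Proof.
move=> mA; apply: (@measurable_noisy_run _
  (borelType 'rV[R]_d * groupType O F (grp l))%type R d s T tie (fun=> A)
  (fun t r k z => w t r k z.2) (fun t k z => w' t k z.2) (fun z => z.1) l) => //.
- by move=> v mv k; exact: (measurableT_comp (mA k) mv).
- move=> t r k tl; apply: (measurableT_comp (f := w t r k : groupType O F (grp l) -> R)) => //.
  apply: (groupType_measurable_coord (i := ix (t, inl (r, k)))) => //.
  by exists t, (inl (r, k)).
- move=> t k tl; apply: (measurableT_comp (f := w' t k : groupType O F (grp l) -> R)) => //.
  apply: (groupType_measurable_coord (i := ix (t, inr k))) => //.
  by exists t, (inr k).
- exact: measurable_fst.
Qed.

Let step (A : 'rV[R]_d -> 'rV[R]_d) (u : 'rV[R]_d) (t : 'I_T) (o : O) := noisyHT tie (A u) (fun r k => w t r k o) (fun k => w' t k o).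

Lemma noisy_run_peel (A : 'rV[R]_d -> 'rV[R]_d) (u : 'rV[R]_d) (t : 'I_T) (l : seq 'I_T) (f : borelType 'rV[R]_d -> R) :
  t \notin l -> borel_map A -> measurable_fun setT f -> (forall v, 0 <= f v <= 1) ->
  mean P (fun o => f (run A u (t :: l) o)) =
  mean P (fun o => mean P (fun o' => f (run A (step A u t o) l o'))).
Proof.
move=> tl mA mf f01.
have KL : grp [:: t] `&` grp l = set0.
  rewrite -subset0 => i [[t1 [k1 [+ ->]]]] [t2 [k2 [t2l /ix_inj[tt _]]]].
  by rewrite inE => /eqP t1t; rewrite -t1t tt t2l in tl.
have mX : measurable_fun setT (step A u t : groupType O F (grp [:: t]) -> borelType 'rV[R]_d).
  apply: (measurable_noisyHT tie (v := fun=> A u)) => [k|r k|k].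
  - exact: measurable_cst.
  - apply: (groupType_measurable_coord (i := ix (t, inl (r, k)))) => //.
    by exists t, (inl (r, k)); rewrite inE.
  - apply: (groupType_measurable_coord (i := ix (t, inr k))) => //.
    by exists t, (inr k); rewrite inE.
(* The second variable is the sample point itself, observed through the noises of the stages in [l]
   only. *)
have mY : measurable_fun setT (id : groupType O F (grp l) -> groupType O F (grp l)).
  exact: measurable_id.
have mH := measurableT_comp mf (@mrun_pair A l mA).
exact: (mean_group_indep indF KL mX mY mH (fun z => f01 _)).
Qed.

Lemma measurable_mean_run (A : 'rV[R]_d -> 'rV[R]_d) (l : seq 'I_T) (f : borelType 'rV[R]_d -> R) :
  borel_map A -> measurable_fun setT f -> (forall v, 0 <= f v <= 1) ->
  measurable_fun setT (fun u : borelType 'rV[R]_d => mean P (fun o' => f (run A u l o'))).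
Proof.
move=> mA mf f01.
apply: (@measurable_mean_section _ _ _ _ _ P
  (fun z : borelType 'rV[R]_d * O => f (run A z.1 l z.2))) => //.
apply: (measurableT_comp mf).
apply: (@measurable_noisy_run _ (borelType 'rV[R]_d * O)%type R d s T tie (fun=> A)
  (fun t r k z => w t r k z.2) (fun t k z => w' t k z.2) (fun z => z.1) l) => //.
- by move=> v mv k; exact: (measurableT_comp (mA k) mv).
- by move=> t r k tl; apply: (measurableT_comp (f := w t r k)).
- by move=> t k tl; apply: (measurableT_comp (f := w' t k)).
- exact: measurable_fst.
Qed.

(** The composition scheme of the selection rounds, one level up. The state handed from stage to
    stage is now a real vector, so the conditional mean [M] must be measurable as a function of the
    state. *)
Lemma noisy_run_renyi (A A' : 'rV[R]_d -> 'rV[R]_d) (u : 'rV[R]_d) (l : seq 'I_T) (f : borelType 'rV[R]_d -> R) :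
  uniq l -> borel_map A -> borel_map A' ->
  (forall v k, `|A v 0 k - A' v 0 k| <= lam / 2) ->
  measurable_fun setT f -> (forall v, 0 <= f v <= 1) ->
  mean P (fun o => f (run A u l o)) <=
  Ks ^+ size l * (mean P (fun o => f (run A' u l o) `^ pw)) `^ th.
Proof.
move=> + mA mA' AA mf f01; elim: l u => [|t l IH] u.
  move=> _; rewrite /run /noisy_run /= !mean_cst expr0 mul1r -powRrM mulrC thp powRr1//.
  by case/andP: (f01 u).
move=> /= /andP[tl ul].
have mfp : measurable_fun setT (fun u => f u `^ pw).
  exact: (@measurableT_comp _ _ _ _ _ _ (@powR R ^~ pw)).
have fp01 v : 0 <= f v `^ pw <= 1 by apply: powR_unit => //; exact: ltW.
rewrite (noisy_run_peel u tl mA mf f01).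
rewrite [X in _ <= _ * X `^ _](noisy_run_peel u (f := fun v => f v `^ pw) tl mA' mfp fp01).
pose M (v : borelType 'rV[R]_d) := mean P (fun o => f (run A' v l o) `^ pw).
have mM : measurable_fun setT M by exact: (measurable_mean_run l mA' mfp fp01).
have M01 v : 0 <= M v <= 1.
  apply: mean_unit => [|o]; last exact: fp01.
  exact: (measurableT_comp mfp (@mrun A' v l mA')).
have Mt01 v : 0 <= M v `^ th <= 1 by apply: powR_unit => //; exact: ltW.
have mMt : measurable_fun setT (fun v => M v `^ th).
  exact: (@measurableT_comp _ _ _ _ _ _ (@powR R ^~ th)).
have mstep B : borel_map B -> measurable_fun setT (fun o => step B u t o : borelType 'rV[R]_d).
  move=> mB; apply: (measurable_noisyHT tie (v := fun=> B u)) => // k; exact: measurable_cst.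
have bMt : bounded_measurable (fun o => M (step A u t o) `^ th).
  by apply: bm_unit => //; exact: (measurableT_comp mMt (mstep A mA)).
apply: (@le_trans _ _ (Ks ^+ size l * mean P (fun o => M (step A u t o) `^ th))).
  rewrite -meanZ//; apply: mean_le => //.
  - apply: bm_unit => [|o].
      exact: (measurableT_comp (measurable_mean_run l mA mf f01) (mstep A mA)).
    apply: mean_unit => //; exact: (measurableT_comp mf (@mrun A _ l mA)).
  - by apply: bmM => //; exact: bm_cst.
  - by move=> o; exact: IH.
rewrite exprSr -mulrA; apply: ler_wpM2l; first by apply: exprn_ge0; exact: ltW.
have := @noisyHT_renyi _ _ _ P _ _ indF d s tie tb (w t) (w' t) (fun k => ix (t, k)) _
  (wF t) (w'F t) b lam a b0 lam0 a1 (lapw t) (lapw' t) (A u) (A' u) (fun v => M v `^ th)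
  mMt Mt01 (AA u).
rewrite -/Ks -/pw -/th.
have -> : (fun o => (M (noisyHT tie (A' u) (fun r k => w t r k o) (fun k => w' t k o)) `^ th) `^ pw) =
   (fun o => mean P (fun o' => f (run A' (step A' u t o) l o') `^ pw)).
  apply/funext => o; rewrite -powRrM thp powRr1//.
  by case/andP: (M01 (step A' u t o)).
by apply; move=> k k' /ix_inj[].
Qed.

Lemma noisy_run_dp (A A' : 'rV[R]_d -> 'rV[R]_d) (u : 'rV[R]_d) (B : set 'rV[R]_d) (eps delta : R) :
  borel_map A -> borel_map A' ->
  (forall v k, `|A v 0 k - A' v 0 k| <= lam / 2) ->
  <<s open >> B -> 0 < delta ->
  2 * a ^+ 2 * ((2 * lam / b) ^+ 2 + (lam / 2 / b) ^+ 2) * (s * T)%:R -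
    (a - 1) * eps <= ln delta ->
  (P ((fun o => run A u (enum 'I_T) o) @^-1` B) <=
   (expR eps)%:E * P ((fun o => run A' u (enum 'I_T) o) @^-1` B) + delta%:E)%E.
Proof.
move=> mA mA' AA mB del0 H.
have mpre C : borel_map C -> measurable ((fun o => run C u (enum 'I_T) o) @^-1` B).
  by move=> mC; rewrite -[X in measurable X]setTI; exact: (@mrun C u (enum 'I_T) mC).
pose f (v : borelType 'rV[R]_d) : R := \1_B v.
have mf : measurable_fun setT f by exact: measurable_indic.
have f01 v : 0 <= f v <= 1.
  by rewrite /f indicE; exact: indicator_unit.
have fE C : borel_map C -> mean P (fun o => f (run C u (enum 'I_T) o)) =
    fine (P ((fun o => run C u (enum 'I_T) o) @^-1` B)).
  by move=> mC; rewrite -mean_indic//; exact: mpre.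
have := noisy_run_renyi u (enum_uniq 'I_T) mA mA' AA mf f01.
(* An indicator equals its own [pw]-th power, so both sides are probabilities. *)
have -> : (fun o => f (run A' u (enum 'I_T) o) `^ pw) = (fun o => f (run A' u (enum 'I_T) o)).
  apply/funext => o; rewrite /f indicE; case: (_ \in B); first by rewrite powR1.
  by rewrite powR0// gt_eqF.
rewrite !fE// size_enum_ord.
set pA := fine _; set pA' := fine _ => HH.
have pA0 : 0 <= pA' by exact: fine_ge0.
have -> : P ((fun o => run A u (enum 'I_T) o) @^-1` B) = pA%:E.
  by rewrite fineK// fin_num_measure//; exact: mpre.
have -> : P ((fun o => run A' u (enum 'I_T) o) @^-1` B) = pA'%:E.
  by rewrite fineK// fin_num_measure//; exact: mpre.
rewrite -EFinM -EFinD lee_fin; apply: (le_trans HH).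
have -> : Ks ^+ T = expR (2 * a * ((2 * lam / b) ^+ 2 + (lam / 2 / b) ^+ 2) * (s * T)%:R).
  by rewrite expRM_natr exprM.
apply: (le_trans (root_to_dp eps _ a1 pA0)).
rewrite lerD2l -[X in _ <= X]lnK// ler_expR.
apply: le_trans H; rewrite le_eqVlt; apply/orP; left; apply/eqP; ring.
Qed.

End composition.

(** * Saturated losses, gradients and projections *)

Section int0_theory.
Context (R : realType).
Local Notation mu := (@lebesgue_measure R).

Lemma continuous_integrable_itv (g : R -> R) (a b : R) : continuous g ->
  mu.-integrable `[a, b] (EFin \o g).
Proof.
move=> cg; apply: continuous_compact_integrable; first exact: segment_compact.
exact: continuous_subspaceT.
Qed.

Lemma int0E (g : R -> R) (a t : R) : continuous g -> a < 0 -> a < t ->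
  int0 g t = \int[mu]_(u in `[a, t]) g u - \int[mu]_(u in `[a, 0]) g u.
Proof.
move=> cg a0 at0; rewrite /int0; have [t0|t0] := leP 0 t.
  rewrite (Rintegral_itvB (continuous_integrable_itv a t cg)) ?bnd_simp// ?ltW//.
  rewrite Rintegral_itv_obnd_cbnd//.
  apply: integrableS (continuous_integrable_itv 0 t cg) => //.
  exact: subset_itv_oc_cc.
apply: oppr_inj; rewrite opprK opprB (Rintegral_itvB (continuous_integrable_itv a 0 cg)) ?bnd_simp// ?ltW//.
rewrite Rintegral_itv_obnd_cbnd//.
apply: integrableS (continuous_integrable_itv t 0 cg) => //.
exact: subset_itv_oc_cc.
Qed.

Lemma is_derive_int0 (g : R -> R) (t : R) : continuous g ->
  is_derive t 1 (int0 g) (g t).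
Proof.
(* A base point below both 0 and [t] writes the oriented integral near [t] as a difference of two
   ordinary ones, without a case split on the sign of [t]. *)
move=> cg; pose a := Num.min 0 t - 1.
have [a0 at0] : a < 0 /\ a < t.
  by rewrite /a; have [] := leP 0 t => ?; split; lra.
pose F x := \int[mu]_(u in `[a, x]) g u.
have [dF F'] := @continuous_FTC1_closed R g a t (t + 1) (ltac:(lra))
  (continuous_integrable_itv a _ cg) at0 (cg t).
have dF' : is_derive t 1 F (g t).
  by rewrite -F' derive1E; exact: derivableP.
have dFc : is_derive t 1 (fun x => F x - F 0) (g t).
  by rewrite -[g t]subr0; apply: is_deriveB.
have na : \forall x \near t, a < x.
  have : open_nbhs t `]a, +oo[%classic.
    by split; [exact: interval_open|rewrite /= in_itv/= andbT].
  by move/open_nbhs_nbhs; apply: filterS => x /=; rewrite in_itv/= andbT.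
apply: near_eq_is_derive dFc; near=> x; rewrite /F -int0E//.
by near: x; exact: na.
Unshelve. all: by end_near.
Qed.

Lemma int0_0 (g : R -> R) : int0 g 0 = 0.
Proof. by rewrite /int0 lexx set_itv1 Rintegral_set1. Qed.

End int0_theory.

Lemma is_derive_continuous (R : realType) (f df : R -> R) :
  (forall t : R, is_derive t 1 f (df t)) -> continuous f.
Proof.
move=> Hf t; apply: differentiable_continuous; apply/derivable1_diffP.
by have [] := Hf t.
Qed.

Lemma MVT_all (R : realType) (f df : R -> R) (a b : R) :
  (forall t : R, is_derive t 1 f (df t)) -> a <= b ->
  exists2 c, a <= c <= b & f b - f a = df c * (b - a).
Proof.
move=> Hf ab; have [|c cab ->] := @MVT_segment R f df a b ab (fun x _ => Hf x).
  exact/continuous_subspaceT/is_derive_continuous.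
by exists c => //; move: cab; rewrite in_itv.
Qed.

Lemma derivative_bound (R : realType) (f df : R -> R) (M a b : R) :
  (forall t : R, is_derive t 1 f (df t)) -> (forall t, `|df t| <= M) ->
  `|f b - f a| <= M * `|b - a|.
Proof.
move=> Hf HM; wlog ab : a b / a <= b => [W|].
  by have [ab|/ltW ba] := leP a b; [exact: W|rewrite distrC (distrC b); exact: W].
have [c _ ->] := MVT_all Hf ab; rewrite normrM.
by rewrite ler_wpM2r.
Qed.

Section saturation.
Context (R : realType) (c2 c3 : R) (psi chi : R -> R).
Hypothesis gpsi : condG c2 c3 psi.
Hypothesis gchi : is_cutoff chi.

Lemma psi_is_derive (t : R) : is_derive t 1 psi (derive1 psi t).
Proof.
case: gpsi => [[/(_ 0%N t isT) d _] _ _].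
by rewrite derive1E; apply: derivableP.
Qed.

Lemma dpsi_is_derive (t : R) : is_derive t 1 (derive1 psi) (derive1n 2 psi t).
Proof.
case: gpsi => [[/(_ 1%N t isT) d _] _ _].
by rewrite derive1nS derive1E; apply: derivableP.
Qed.

Lemma d2psi_continuous : continuous (derive1n 2 psi).
Proof.
case: gpsi => [[d _] _ _] t; apply: differentiable_continuous.
by apply/derivable1_diffP; exact: d.
Qed.

Lemma d2psi_bounds t : 0 < derive1n 2 psi t <= c2.
Proof. by case: gpsi. Qed.

Lemma c2_gt0 : 0 < c2.
Proof. by have /andP[h1 h2] := d2psi_bounds 0; exact: lt_le_trans h2. Qed.

Lemma chi_continuous : continuous chi.
Proof.
case: gchi => [[_ [d _]] _ _ _ _] t; apply: differentiable_continuous.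
by apply/derivable1_diffP; exact: (d 0%N t isT).
Qed.

Definition psi_sat'' (L u : R) := derive1n 2 psi u * chi (u / L).

Lemma psi_sat''_continuous (L : R) : continuous (psi_sat'' L).
Proof.
move=> t; apply: (@cvgM R _ _ _ (derive1n 2 psi) (fun u => chi (u / L))).
  exact: d2psi_continuous.
apply: (@continuous_comp _ _ _ (fun u : R => u / L) chi); last exact: chi_continuous.
exact: mulrr_continuous.
Qed.

Lemma psi_sat''_bounds (L u : R) : 0 <= psi_sat'' L u <= c2.
Proof.
have /andP[h1 h2] := d2psi_bounds u.
have /andP[h3 h4] : 0 <= chi (u / L) <= 1 by case: gchi.
rewrite /psi_sat''; apply/andP; split; first by rewrite mulr_ge0// ltW.
apply: le_trans h2; rewrite -[X in _ <= X]mulr1 ler_pM2l//.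
Qed.

Lemma psi_sat'_is_derive (L t : R) :
  is_derive t 1 (psi_sat' psi chi L) (psi_sat'' L t).
Proof.
rewrite /psi_sat' -[psi_sat'' L t]add0r; apply: is_deriveD.
exact/is_derive_int0/psi_sat''_continuous.
Qed.

Lemma psi_sat_is_derive (L t : R) :
  is_derive t 1 (psi_sat psi chi L) (psi_sat' psi chi L t).
Proof.
rewrite /psi_sat -[psi_sat' psi chi L t]add0r; apply: is_deriveD.
exact/is_derive_int0/(is_derive_continuous (psi_sat'_is_derive L)).
Qed.

Lemma psi_sat'_0 (L : R) : psi_sat' psi chi L 0 = derive1 psi 0.
Proof. by rewrite /psi_sat' int0_0 addr0. Qed.

Lemma psi_sat'_eq (L t : R) : 0 < L -> `|t| <= L ->
  psi_sat' psi chi L t = derive1 psi t.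
Proof.
move=> L0 tL.
pose D x := psi_sat' psi chi L x - derive1 psi x.
have dD (x : R) : is_derive x 1 D (psi_sat'' L x - derive1n 2 psi x).
  apply: is_deriveB; [exact: psi_sat'_is_derive|exact: dpsi_is_derive].
have D0 : D 0 = 0 by rewrite /D psi_sat'_0 subrr.
have dD0 x : `|x| <= L -> psi_sat'' L x - derive1n 2 psi x = 0.
  move=> xL; rewrite /psi_sat''; case: gchi => _ _ h _ _.
  by rewrite h ?mulr1 ?subrr// normrM normfV (gtr0_norm L0) ler_pdivrMr// mul1r.
move/ler_normlP: tL => [tL1 tL2].
apply/eqP; rewrite -subr_eq0 -/(D t); apply/eqP.
have [t0|/ltW t0] := leP 0 t.
  have [c /andP[c0 c1]] := MVT_all dD t0.
  rewrite dD0 ?mul0r ?D0 ?subr0// ger0_norm//; lra.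
have [c /andP[c0 c1]] := MVT_all dD t0.
rewrite dD0 ?mul0r ?D0; first by lra.
rewrite ler0_norm//; lra.
Qed.

(** Up to [2 * L] the mean value theorem from 0 applies with slope at most [c2]; beyond, the cutoff
    kills the second derivative and [psi_sat'] keeps its value at [2 * L] or [- (2 * L)]. This
    uniform bound is the level [Spsi] in the sensitivity. *)
Lemma psi_sat'_bound (L t : R) : 1 <= L ->
  `|psi_sat' psi chi L t| <= `|derive1 psi 0| + 2 * c2 * L.
Proof.
move=> L1; have c20 := c2_gt0.
have L0 : 0 < L by lra.
have H x : `|x| <= 2 * L -> `|psi_sat' psi chi L x| <= `|derive1 psi 0| + 2 * c2 * L.
  move=> xL; have := @derivative_bound R _ _ c2 0 x (psi_sat'_is_derive L) _.
  rewrite psi_sat'_0 subr0 => h.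
  rewrite -[psi_sat' _ _ _ _](subrK (derive1 psi 0)) addrC.
  apply: (le_trans (ler_normD _ _)); rewrite lerD2l.
  apply: le_trans (h _) _.
    by move=> u; have /andP[h0 h1] := psi_sat''_bounds L u; rewrite ger0_norm.
  by rewrite (_ : 2 * c2 * L = c2 * (2 * L)) ?ler_pM2l//; ring.
have z u : 2 * L <= `|u| -> psi_sat'' L u = 0.
  move=> uL; rewrite /psi_sat''; case: gchi => _ _ _ h _.
  by rewrite h ?mulr0// normrM normfV (gtr0_norm L0) ler_pdivlMr//.
have [tl|tg] := leP `|t| (2 * L); first exact: H.
have [t0|/ltW t0] := leP 0 t.
  rewrite ger0_norm// in tg.
  have [c /andP[c0 c1]] := MVT_all (psi_sat'_is_derive L) (ltW tg).
  rewrite z ?mul0r; last by rewrite ger0_norm//; lra.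
  move/eqP; rewrite subr_eq0 => /eqP ->; apply: H; rewrite ger0_norm//; lra.
rewrite ler0_norm// in tg.
have t2 : t <= - (2 * L) by lra.
have [c /andP[c0 c1]] := MVT_all (psi_sat'_is_derive L) t2.
rewrite z ?mul0r; last by rewrite ler0_norm//; lra.
move/eqP; rewrite subr_eq0 => /eqP <-; apply: H; rewrite normrN ger0_norm//; lra.
Qed.

End saturation.

(** * Euclidean geometry and derivatives of the loss *)

Section dot_theory.
Context (R : realType) (d : nat).
Implicit Types x u v : 'rV[R]_d.

Lemma dotC x u : dot x u = dot u x.
Proof. by apply: eq_bigr => j _; rewrite mulrC. Qed.

Lemma dotDr x u v : dot x (u + v) = dot x u + dot x v.
Proof. by rewrite /dot -big_split/=; apply: eq_bigr => j _; rewrite mxE mulrDr. Qed.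

Lemma dotZr x (a : R) u : dot x (a *: u) = a * dot x u.
Proof. by rewrite /dot mulr_sumr; apply: eq_bigr => j _; rewrite mxE mulrCA. Qed.

Lemma dotNr x u : dot x (- u) = - dot x u.
Proof. by rewrite -scaleN1r dotZr mulN1r. Qed.

Lemma dotBr x u v : dot x (u - v) = dot x u - dot x v.
Proof. by rewrite dotDr dotNr. Qed.

Lemma dotDl x u v : dot (u + v) x = dot u x + dot v x.
Proof. by rewrite dotC dotDr !(dotC x). Qed.

Lemma dotZl x (a : R) u : dot (a *: u) x = a * dot u x.
Proof. by rewrite dotC dotZr dotC. Qed.

Lemma dotNl x u : dot (- u) x = - dot u x.
Proof. by rewrite dotC dotNr dotC. Qed.

Lemma dotBl x u v : dot (u - v) x = dot u x - dot v x.
Proof. by rewrite dotDl dotNl. Qed.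

Lemma dot_delta x j : dot x (delta_mx 0 j) = x 0 j.
Proof.
rewrite /dot (bigD1 j)//= mxE !eqxx mulr1 big1 ?addr0// => k kj.
by rewrite mxE eqxx (negbTE kj) mulr0.
Qed.

Lemma dot_ge0 x : 0 <= dot x x.
Proof. by apply: sumr_ge0 => j _; rewrite -expr2 sqr_ge0. Qed.

Lemma l2norm_ge0 x : 0 <= l2norm x.
Proof. exact: sqrtr_ge0. Qed.

Lemma l2norm_sqr x : l2norm x ^+ 2 = dot x x.
Proof. by rewrite sqr_sqrtr// dot_ge0. Qed.

Lemma l2norm_eq0 x : l2norm x = 0 -> x = 0.
Proof.
move=> h; have : dot x x = 0 by rewrite -l2norm_sqr h expr0n.
move/eqP; rewrite psumr_eq0; last by move=> j _; rewrite -expr2 sqr_ge0.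
move=> /allP H; apply/rowP => j; rewrite mxE.
by have := H j (mem_index_enum _); rewrite /= mulf_eq0 orbb => /eqP.
Qed.

Lemma l2norm_gt0 x : x != 0 -> 0 < l2norm x.
Proof.
move=> x0; rewrite lt_neqAle l2norm_ge0 andbT eq_sym.
by apply: contra x0 => /eqP /l2norm_eq0 ->.
Qed.

Lemma l2normZ (a : R) x : l2norm (a *: x) = `|a| * l2norm x.
Proof. by rewrite /l2norm dotZr dotZl mulrA -expr2 sqrtrM ?sqr_ge0// sqrtr_sqr. Qed.

Lemma l2normN x : l2norm (- x) = l2norm x.
Proof. by rewrite -scaleN1r l2normZ normrN1 mul1r. Qed.

Lemma l2norm0 : l2norm (0 : 'rV[R]_d) = 0.
Proof. by rewrite -(scale0r (0 : 'rV[R]_d)) l2normZ normr0 mul0r. Qed.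

Lemma cauchy_schwarz x u : `|dot x u| <= l2norm x * l2norm u.
Proof.
have [->|x0] := eqVneq x 0.
  by rewrite (_ : dot 0 u = 0) ?l2norm0 ?mul0r ?normr0// /dot big1// => j _; rewrite mxE mul0r.
have [->|u0] := eqVneq u 0.
  by rewrite (_ : dot x 0 = 0) ?l2norm0 ?mulr0 ?normr0// /dot big1// => j _; rewrite mxE mulr0.
have a0 := l2norm_gt0 x0; have b0 := l2norm_gt0 u0.
set a := l2norm x in a0 *; set b := l2norm u in b0 *.
have h1 := dot_ge0 (b *: x - a *: u); have h2 := dot_ge0 (b *: x + a *: u).
rewrite !(dotBl, dotBr, dotDl, dotDr, dotZl, dotZr) (dotC u x) -!l2norm_sqr -/a -/b in h1 h2.
have ab : 0 < a * b by exact: mulr_gt0.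
rewrite ler_norml; apply/andP; split; rewrite -(ler_pM2l ab); lra.
Qed.

Lemma l2normD x u : l2norm (x + u) <= l2norm x + l2norm u.
Proof.
rewrite -(@ler_pXn2r _ 2) ?nnegrE ?addr_ge0 ?l2norm_ge0//.
rewrite l2norm_sqr dotDl !dotDr (dotC u x) sqrrD !l2norm_sqr.
have := ler_norm (dot x u); have := cauchy_schwarz x u.
rewrite mulr2n; lra.
Qed.

Lemma is_derive_dir (f : 'rV[R]_d -> R) u v (df : R) :
  is_derive (0 : R) 1 (fun h : R => f (h *: v + u)) df -> is_derive u v f df.
Proof.
move=> [H1 H2].
have E : (fun h : R => h^-1 *: (((fun h : R => f (h *: v + u)) \o shift 0) (h *: (1 : R)) - (fun h : R => f (h *: v + u)) 0)) =
   (fun h : R => h^-1 *: ((f \o shift u) (h *: v) - f u)).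
  by apply/funext => h /=; rewrite scale0r add0r addr0 /GRing.scale/= mulr1.
split.
  by rewrite /derivable -E.
by rewrite /derive -E.
Qed.

(** The loss, its partial derivatives and the gradient paired with a fixed vector are all sums of
    functions of the [dot (x i) b], with different profiles [phi i]; one rule differentiates them
    all. *)
Lemma is_derive_ridge_line (n : nat) (x : 'I_n -> 'rV[R]_d)
    (phi dphi : 'I_n -> R -> R) (c : R) u v (s : R) :
  (forall i (t : R), is_derive t 1 (phi i) (dphi i t)) ->
  is_derive s 1 (fun h : R => c * \sum_i phi i (dot (x i) (h *: v + u)))
    (c * \sum_i dphi i (dot (x i) (s *: v + u)) * dot (x i) v).
Proof.
move=> H.
have Hi i : is_derive s 1 (fun h => phi i (dot (x i) (h *: v + u)))
    (dphi i (dot (x i) (s *: v + u)) * dot (x i) v).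
  rewrite (_ : (fun h => _) = phi i \o (fun h : R => h * dot (x i) v + dot (x i) u)); last first.
    by apply/funext => h /=; rewrite dotDr dotZr.
  have dg : is_derive s 1 (fun h : R => h * dot (x i) v + dot (x i) u) (dot (x i) v).
    have dgg := is_deriveD (is_deriveM (is_derive_id s 1)
      (is_derive_cst (dot (x i) v) s 1)) (is_derive_cst (dot (x i) u) s 1).
    apply: (is_derive_eq dgg); rewrite scaler0 add0r addr0 /GRing.scale/= mulr1.
    by [].
  by apply: is_derive1_comp; rewrite dotDr dotZr; exact: H.
rewrite (_ : (fun h => _) = c \*: (\sum_(i < n) (fun h => phi i (dot (x i) (h *: v + u))))); last first.
  by apply/funext => h; rewrite /= fct_sumE.
apply: is_deriveZ.
Qed.

Lemma is_derive_ridge (n : nat) (x : 'I_n -> 'rV[R]_d) (phi dphi : 'I_n -> R -> R)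
    (c : R) u v :
  (forall i (t : R), is_derive t 1 (phi i) (dphi i t)) ->
  is_derive u v (fun b => c * \sum_i phi i (dot (x i) b))
    (c * \sum_i dphi i (dot (x i) u) * dot (x i) v).
Proof.
move=> H; apply: is_derive_dir.
have := is_derive_ridge_line x c u v 0 H.
by rewrite scale0r add0r.
Qed.

End dot_theory.

Section glm_derivatives.
Context (R : realType) (n d : nat) (psi dpsi ddpsi : R -> R) (r : R).
Context (D : 'I_n -> record R d).
Hypothesis Hpsi : forall t : R, is_derive t 1 psi (dpsi t).
Hypothesis Hdpsi : forall t : R, is_derive t 1 dpsi (ddpsi t).

Lemma derive_glm_loss (b v : 'rV[R]_d) :
  'D_v (glm_loss psi r D) b =
  n%:R^-1 * \sum_i (dpsi (dot (D i).2 b) - trunc r (D i).1) * dot (D i).2 v.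
Proof.
have H i (t : R) : is_derive t 1 (fun t => psi t - trunc r (D i).1 * t)
    (dpsi t - trunc r (D i).1).
  have h1 := is_deriveB (Hpsi t) (is_deriveM (is_derive_cst (trunc r (D i).1) t 1)
     (is_derive_id t 1)).
  apply: (is_derive_eq h1); rewrite /GRing.scale/= mulr0 addr0 mulr1//.
exact: (@derive_val _ _ _ _ _ _ _ (is_derive_ridge (fun i => (D i).2) n%:R^-1 b v H)).
Qed.

Lemma grad_glm_loss (b : 'rV[R]_d) :
  grad (glm_loss psi r D) b =
  \row_j (n%:R^-1 * \sum_i (dpsi (dot (D i).2 b) - trunc r (D i).1) * (D i).2 0 j).
Proof.
apply/rowP => j; rewrite !mxE derive_glm_loss; congr (_ * _).
by apply: eq_bigr => i _; rewrite dot_delta.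
Qed.

Lemma hess_glm_loss (b : 'rV[R]_d) j k :
  hess (glm_loss psi r D) b j k =
  n%:R^-1 * \sum_i ddpsi (dot (D i).2 b) * (D i).2 0 j * (D i).2 0 k.
Proof.
rewrite mxE.
have -> : (fun v => 'D_(delta_mx 0 k) (glm_loss psi r D) v) =
   (fun v => n%:R^-1 * \sum_i ((dpsi (dot (D i).2 v) - trunc r (D i).1) * (D i).2 0 k)).
  apply/funext => v; rewrite derive_glm_loss; congr (_ * _).
  by apply: eq_bigr => i _; rewrite dot_delta.
have H i (t : R) : is_derive t 1
    (fun t => (dpsi t - trunc r (D i).1) * (D i).2 0 k) (ddpsi t * (D i).2 0 k).
  have h1 := is_deriveM (is_deriveB (Hdpsi t) (is_derive_cst (trunc r (D i).1) t 1))
     (is_derive_cst ((D i).2 0 k) t 1).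
  apply: (is_derive_eq h1); rewrite /GRing.scale/= mulr0 add0r subr0 mulrC//.
have := @derive_val _ _ _ _ _ _ _ (is_derive_ridge (fun i => (D i).2) n%:R^-1 b (delta_mx 0 j) H).
move=> ->; congr (_ * _).
by apply: eq_bigr => i _; rewrite dot_delta mulrAC.
Qed.

(** The Hessian as a bilinear form on the whole space. Restricting it to vectors supported in [I]
    replaces the principal submatrices, whose size depends on [I]. *)
Definition curvature_form (b u v : 'rV[R]_d) : R :=
  n%:R^-1 * \sum_i ddpsi (dot (D i).2 b) * dot (D i).2 u * dot (D i).2 v.

Lemma principal_form (I : {set 'I_d}) (b u : 'rV[R]_d) :
  (forall j, j \notin I -> u 0 j = 0) ->
  let w := \row_(k < #|I|) u 0 (enum_val k) in
  (w *m principal_submx I (hess (glm_loss psi r D) b) *m w^T) 0 0 =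
    curvature_form b u u /\ (forall a : R, (w *m a%:M *m w^T) 0 0 = a * dot u u).
Proof.
move=> uI w.
have sumI (F : 'I_d -> R) : (forall j, j \notin I -> F j = 0) ->
    \sum_(k < #|I|) F (enum_val k) = \sum_j F j.
  move=> F0; transitivity (\sum_(j in I) F j); first by rewrite [RHS]big_enum_val.
  rewrite [RHS](bigID (mem I))/=.
  by rewrite [X in _ + X]big1 ?addr0.
have dotI (x : 'rV[R]_d) : \sum_(k < #|I|) w 0 k * x 0 (enum_val k) = dot x u.
  rewrite (eq_bigr (fun k => (fun j => u 0 j * x 0 j) (enum_val k))).
    rewrite (sumI (fun j => u 0 j * x 0 j)); first by rewrite dotC.
    by move=> j /uI ->; rewrite mul0r.
  by move=> k _; rewrite mxE.
have Hkl k l : principal_submx I (hess (glm_loss psi r D) b) k l =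
    n%:R^-1 * \sum_i ddpsi (dot (D i).2 b) * (D i).2 0 (enum_val k) * (D i).2 0 (enum_val l).
  by rewrite /principal_submx mxE hess_glm_loss.
split.
  rewrite mxE /curvature_form mulr_sumr.
  transitivity (\sum_l \sum_k \sum_i n%:R^-1 * (ddpsi (dot (D i).2 b) *
      ((w 0 k * (D i).2 0 (enum_val k)) * (w 0 l * (D i).2 0 (enum_val l))))).
    apply: eq_bigr => l _; rewrite mxE mulr_suml; apply: eq_bigr => k _.
    rewrite Hkl mulr_sumr mulr_sumr mulr_suml; apply: eq_bigr => i _.
    by rewrite !mxE; ring.
  under eq_bigr do rewrite exchange_big/=.
  rewrite exchange_big/=; apply: eq_bigr => i _.
  rewrite -(dotI (D i).2) -mulrA.
  rewrite [in RHS]mulr_sumr mulr_sumr mulr_sumr; apply: eq_bigr => l _.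
  by rewrite mulr_suml mulr_sumr mulr_sumr.
move=> a; rewrite mul_mx_scalar -scalemxAl mxE; congr (a * _).
rewrite mxE -(dotI u); apply: eq_bigr => k _.
by rewrite !mxE.
Qed.

Lemma curvature_form_bounds (I : {set 'I_d}) (alpha gamma : R) (b u : 'rV[R]_d) :
  loewner_le alpha%:M (principal_submx I (hess (glm_loss psi r D) b)) ->
  loewner_le (principal_submx I (hess (glm_loss psi r D) b)) gamma%:M ->
  (forall j, j \notin I -> u 0 j = 0) ->
  alpha * dot u u <= curvature_form b u u <= gamma * dot u u.
Proof.
move=> Ha Hg uI; have [E1 E2] := principal_form b uI.
set w := \row_k _ in E1 E2.
have entryB (A B : 'M[R]_#|I|) :
    (w *m (A - B) *m w^T) 0 0 = (w *m A *m w^T) 0 0 - (w *m B *m w^T) 0 0.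
  by rewrite mulmxBr mulmxBl mxE [X in _ + X]mxE.
have := Ha w; have := Hg w; rewrite !entryB !E1 !E2 !subr_ge0 => -> ->.
by [].
Qed.

End glm_derivatives.

(** * Projection onto the unit ball *)

Section ball_projection.
Context (R : realType) (d : nat).
Implicit Types u v z : 'rV[R]_d.

Lemma dot_sub_sqr u v : dot (u - v) (u - v) = dot u u - 2 * dot u v + dot v v.
Proof. by rewrite dotBl !dotBr (dotC v u); ring. Qed.

Definition ball_scale u : 'rV[R]_d := (Num.max 1 (l2norm u))^-1 *: u.

Let m u := Num.max 1 (l2norm u).
Let m1 u : 1 <= m u. Proof. by rewrite le_max lexx. Qed.
Let m0 u : 0 < m u. Proof. exact: lt_le_trans (m1 u). Qed.

Lemma ball_scale_le1 u : l2norm (ball_scale u) <= 1.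
Proof.
rewrite /ball_scale -/(m u) l2normZ ger0_norm ?invr_ge0 ?(ltW (m0 u))//.
by rewrite mulrC ler_pdivrMr ?m0// mul1r le_max lexx orbT.
Qed.

Lemma ball_scale_obtuse u z : l2norm z <= 1 ->
  dot (u - ball_scale u) (z - ball_scale u) <= 0.
Proof.
move=> z1; set p := ball_scale u.
have up : u = m u *: p by rewrite /p /ball_scale scalerA divff ?scale1r// gt_eqF ?m0.
have -> : u - p = (m u - 1) *: p by rewrite scalerBl scale1r -up.
rewrite dotZl; have [u1|u1] := leP (l2norm u) 1.
  by rewrite /m (max_idPl u1) subrr mul0r.
have mu : m u = l2norm u by rewrite /m; apply/max_idPr; exact: ltW.
have p1 : l2norm p = 1.
  rewrite /p /ball_scale -/(m u) mu l2normZ ger0_norm ?invr_ge0 ?l2norm_ge0//.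
  by rewrite mulVf// gt_eqF//; apply: lt_trans u1.
rewrite mulr_ge0_le0 ?subr_ge0 ?m1// dotBr -l2norm_sqr p1 expr1n subr_le0.
apply: (le_trans (ler_norm _)); apply: (le_trans (cauchy_schwarz _ _)).
by rewrite p1 mul1r.
Qed.

(** [proj_unit_ball] is a chosen nearest point. The obtuse angle at [ball_scale u] gives a
    Pythagorean inequality, which makes [ball_scale u] the only nearest point; the explicit formula
    also provides measurability. *)
Lemma proj_unit_ballE u : proj_unit_ball u = ball_scale u.
Proof.
have key z : l2norm z <= 1 ->
    l2norm (u - z) ^+ 2 >= l2norm (u - ball_scale u) ^+ 2 + l2norm (z - ball_scale u) ^+ 2.
  move=> z1; have := ball_scale_obtuse u z1; set p := ball_scale u => h.
  have -> : u - z = (u - p) - (z - p) by rewrite opprB addrA subrK.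
  rewrite !l2norm_sqr (dot_sub_sqr (u - p)); lra.
have np : nearest_points [set v | l2norm v <= 1] u (ball_scale u).
  split; first exact: ball_scale_le1.
  move=> z /= z1; rewrite -(@ler_pXn2r _ 2) ?nnegrE ?l2norm_ge0//.
  apply: le_trans (key z z1); rewrite lerDl; exact: sqr_ge0.
have [/= v1 vmin] := getPex (ex_intro _ _ np).
rewrite -/(proj_unit_ball u) in v1 vmin; set v := proj_unit_ball u in v1 vmin *.
have := key v v1; have := vmin _ (ball_scale_le1 u).
rewrite -(@ler_pXn2r _ 2) ?nnegrE ?l2norm_ge0// => h1 h2.
have h3 : l2norm (v - ball_scale u) ^+ 2 <= 0 by lra.
have : l2norm (v - ball_scale u) = 0.
  by apply/eqP; rewrite -sqrf_eq0; apply/eqP; apply: le_anti; rewrite h3 sqr_ge0.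
by move/l2norm_eq0/eqP; rewrite subr_eq0 => /eqP.
Qed.

Lemma proj_unit_ball_le1 u : l2norm (proj_unit_ball u) <= 1.
Proof. by rewrite proj_unit_ballE; exact: ball_scale_le1. Qed.

Lemma proj_unit_ball_dist u z : l2norm z <= 1 ->
  l2norm (proj_unit_ball u - z) <= l2norm (u - z).
Proof.
move=> z1; rewrite proj_unit_ballE -(@ler_pXn2r _ 2) ?nnegrE ?l2norm_ge0//.
have := ball_scale_obtuse u z1; set p := ball_scale u => h.
have -> : u - z = (u - p) - (z - p) by rewrite opprB addrA subrK.
have -> : l2norm (p - z) = l2norm (z - p) by rewrite -l2normN opprB.
have h2 := dot_ge0 (u - p).
rewrite !l2norm_sqr (dot_sub_sqr (u - p)); lra.
Qed.

End ball_projection.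

(** * Deterministic analysis of the iterations *)

Section selection.
Context (R : realType) (d s : nat) (tie : {set 'I_d} -> 'I_d) (tb : tie_breaking tie).
Context (v : 'rV[R]_d) (w : 'I_s -> 'I_d -> R) (W : R).
Hypothesis wW : forall r j, `|w r j| <= W.

(** As long as an index remains, every round adds a fresh one, so the cardinality is exact. The
    index chosen beats an unselected one up to two noise values, whence [2 * W]. *)
Lemma pick_fold_spec (S : {set 'I_d}) (l : seq 'I_s) :
  (#|S| + size l <= d)%N ->
  let S' := pick_fold tie v w S l in
  [/\ #|S'| = (#|S| + size l)%N, S \subset S' &
      forall j k, j \in S' -> j \notin S -> k \notin S' ->
        `|v 0 k| <= `|v 0 j| + 2 * W].
Proof.
elim: l S => [|r l IH] S /=.
  by move=> _; split=> [||j k ->]//; rewrite addn0.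
move=> Sd.
have ST : S != [set: 'I_d]%SET.
  apply/negP => /eqP ST; move: Sd.
  by rewrite ST cardsT card_ord addnS ltnNge leq_addr.
have [iS imax] := noisy_pick_max v (w r) tb ST.
set i := noisy_pick tie v S (w r) in iS imax *.
have ciS : #|(i |: S)%SET| = #|S|.+1 by rewrite cardsU1 iS.
have := IH (i |: S)%SET; rewrite ciS addSn -addnS => /(_ Sd).
set S' := pick_fold _ _ _ (i |: S)%SET l => -[c1 c2 c3]; split=> //.
  by apply: fintype.subset_trans c2; exact: finset.subsetUr.
move=> j k jS' jS kS'.
have [ji|ji] := eqVneq j i; last by apply: c3 => //; rewrite !inE negb_or ji jS.
have kS : k \notin S.
  apply: contra kS' => kS; apply: (fintype.subsetP c2).
  by rewrite !inE kS orbT.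
have := imax k kS; rewrite ji.
have /ler_normlP[a1 a2] := wW r i; have /ler_normlP[b1 b2] := wW r k; lra.
Qed.

Lemma noisyHT_select_spec : (s <= d)%N ->
  let S := noisyHT_select tie v w in
  #|S| = s /\ forall j k, j \in S -> k \notin S -> `|v 0 k| <= `|v 0 j| + 2 * W.
Proof.
move=> sd; have [] := @pick_fold_spec finset.set0 (enum 'I_s).
  by rewrite finset.cards0 add0n size_enum_ord.
rewrite finset.cards0 add0n size_enum_ord => c1 _ c3; split=> // j k jS kS.
by apply: c3 => //; rewrite inE.
Qed.

End selection.

Section restriction.
Context (R : realType) (d : nat).
Implicit Types (u v : 'rV[R]_d) (S : {set 'I_d}).

Lemma dot_keep S u : dot (keep S u) (keep S u) = \sum_(j in S) (u 0 j) ^+ 2.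
Proof.
rewrite [RHS]big_mkcond/=; apply: eq_bigr => j _; rewrite mxE.
by case: ifP => _; rewrite ?mul0r// expr2.
Qed.

Lemma l2norm_keep_sub S S' u : S \subset S' ->
  l2norm (keep S u) <= l2norm (keep S' u).
Proof.
move=> SS'; rewrite /l2norm ler_sqrt ?dot_ge0// !dot_keep.
rewrite [X in _ <= X](big_setID S)/= (finset.setIidPr SS') lerDl.
by apply: sumr_ge0 => j _; exact: sqr_ge0.
Qed.

Lemma l2norm_keep_bound S u (M : R) : 0 <= M -> (forall j, `|u 0 j| <= M) ->
  l2norm (keep S u) <= Num.sqrt #|S|%:R * M.
Proof.
move=> M0 uM; rewrite -(ger0_norm M0) -sqrtr_sqr -sqrtrM ?ler0n// /l2norm.
rewrite ler_sqrt ?mulr_ge0 ?ler0n ?sqr_ge0// dot_keep.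
rewrite mulr_natl -sumr_const; apply: ler_sum => j _.
by rewrite -(real_normK (num_real (u 0 j))) lerXn2r ?nnegrE.
Qed.

Lemma keepB S u v : keep S (u - v) = keep S u - keep S v.
Proof. by apply/rowP => j; rewrite !mxE; case: ifP => _; rewrite ?subr0. Qed.

Lemma keepD S u v : keep S (u + v) = keep S u + keep S v.
Proof. by apply/rowP => j; rewrite !mxE; case: ifP => _; rewrite ?addr0. Qed.

Lemma keepZ S (a : R) u : keep S (a *: u) = a *: keep S u.
Proof. by apply/rowP => j; rewrite !mxE; case: ifP => _; rewrite ?mulr0. Qed.

Lemma dot_keepl S u v : dot (keep S u) (keep S v) = dot (keep S u) v.
Proof. by apply: eq_bigr => j _; rewrite !mxE; case: ifP => _; rewrite ?mul0r. Qed.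

Definition suppset u : {set 'I_d} := finset (fun j => u 0 j != 0).

Lemma card_suppset u : #|suppset u| = l0norm u.
Proof. by rewrite cardsE. Qed.

Lemma keep_id S u : suppset u \subset S -> keep S u = u.
Proof.
move=> /fintype.subsetP uS; apply/rowP => j; rewrite mxE; case: ifP => // /negbT jS.
apply/esym/eqP; apply: contraNT jS => uj; apply: uS; by rewrite inE.
Qed.

Lemma l0norm_keep S u : (l0norm (keep S u) <= #|S|)%N.
Proof.
rewrite -card_suppset; apply: subset_leq_card; apply/fintype.subsetP => j.
by rewrite inE mxE; case: ifP => // _; rewrite eqxx.
Qed.

(** Both sides become sums over all pairs in [A] times [B], compared term by term. *)
Lemma sqr_sum_le_card (A B : {set 'I_d}) (x y : 'I_d -> R) :
  (forall k j, k \in A -> j \in B -> `|x k| <= y j) ->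
  #|B|%:R * (\sum_(k in A) x k ^+ 2) <= #|A|%:R * (\sum_(j in B) y j ^+ 2).
Proof.
move=> H; rewrite !mulr_natl -!sumr_const.
have -> : \sum_(i in B) \sum_(k in A) x k ^+ 2 = \sum_(k in A) \sum_(j in B) x k ^+ 2.
  by rewrite exchange_big.
apply: ler_sum => k kA; apply: ler_sum => j jB.
have := H k j kA jB => h; rewrite -(real_normK (num_real (x k))) lerXn2r ?nnegrE//.
exact: le_trans (normr_ge0 _) h.
Qed.

End restriction.

(* The coordinates of [bstar] missed by [S] are matched with at least
   [s - sstar] selected coordinates outside its support, on which [v] is as
   large up to the noise: this is where the factor [rho] comes from. *)
Lemma hard_threshold_expansion (R : realType) (d s sstar : nat)
    (v bstar : 'rV[R]_d) (S I : {set 'I_d}) (W rho : R) (z : 'rV[R]_d) :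
  #|S| = s -> (l0norm bstar <= sstar)%N -> (sstar < s)%N -> 0 <= W ->
  (forall j k, j \in S -> k \notin S -> `|v 0 k| <= `|v 0 j| + 2 * W) ->
  (forall j, `|z 0 j| <= W) ->
  0 <= rho <= 1 -> sstar%:R <= rho ^+ 2 * (s - sstar)%:R ->
  (S :|: suppset bstar)%SET \subset I ->
  l2norm (keep S (v + z) - bstar) <=
  (1 + rho) * l2norm (keep I (v - bstar)) + 3 * (W * Num.sqrt s%:R).
Proof.
move=> cS cb ss W0 vW zW /andP[rho0 rho1] Hrho SI.
set Ss := suppset bstar in SI *.
pose A := (Ss :\: S)%SET; pose B := (S :\: Ss)%SET.
have cA : (#|A| <= sstar)%N.
  apply: leq_trans cb; rewrite -card_suppset; apply: subset_leq_card; exact: finset.subsetDl.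
have cB : (s - sstar <= #|B|)%N.
  rewrite cardsD cS leq_sub2l// (leq_trans _ cb)// -card_suppset.
  by apply: subset_leq_card; exact: finset.subsetIr.
have bS j : j \notin Ss -> bstar 0 j = 0 by rewrite inE negbK => /eqP.
pose y : 'rV[R]_d := \row_j (`|v 0 j| + 2 * W).
have Ay : l2norm (keep A v) <= rho * l2norm (keep B y).
  rewrite -(ger0_norm rho0) -sqrtr_sqr -sqrtrM ?sqr_ge0// /l2norm.
  rewrite ler_sqrt ?mulr_ge0 ?sqr_ge0 ?dot_ge0// !dot_keep.
  have ss0 : 0 < (s - sstar)%:R :> R by rewrite ltr0n subn_gt0.
  rewrite -(ler_pM2l ss0) mulrA (mulrC _ (rho ^+ 2)).
  have h : #|B|%:R * (\sum_(k in A) v 0 k ^+ 2) <= #|A|%:R * (\sum_(j in B) y 0 j ^+ 2).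
    apply: (sqr_sum_le_card (x := fun k => v 0 k) (y := fun j => y 0 j)) => k j.
    rewrite !inE => /andP[kS _] /andP[_ jS]; rewrite mxE; exact: vW.
  have s1 : 0 <= \sum_(k in A) v 0 k ^+ 2 by apply: sumr_ge0 => k _; exact: sqr_ge0.
  have s2 : 0 <= \sum_(k in B) y 0 k ^+ 2 by apply: sumr_ge0 => k _; exact: sqr_ge0.
  apply: (@le_trans _ _ (#|B|%:R * (\sum_(k in A) v 0 k ^+ 2))).
    by apply: ler_wpM2r => //; rewrite ler_nat.
  apply: (le_trans h); apply: ler_wpM2r => //; apply: le_trans Hrho.
  by rewrite ler_nat.
have sS : Num.sqrt #|S|%:R = Num.sqrt s%:R :> R by rewrite cS.
have By : l2norm (keep B y) <= l2norm (keep B (v - bstar)) + Num.sqrt s%:R * (2 * W).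
  have -> : y = (\row_j `|v 0 j|) + (\row_j (2 * W)).
    by apply/rowP => j; rewrite !mxE.
  rewrite [X in l2norm X <= _]keepD; apply: (le_trans (l2normD _ _)); apply: lerD.
    rewrite /l2norm ler_sqrt ?dot_ge0// !dot_keep; apply: ler_sum => j.
    by rewrite !inE => /andP[jSs _]; rewrite !mxE bS ?inE// subr0 real_normK// num_real.
  apply: le_trans (l2norm_keep_sub _ (finset.subsetDl S Ss)) _.
  rewrite -sS; apply: l2norm_keep_bound => [|j]; first by rewrite mulr_ge0.
  by rewrite mxE ger0_norm// mulr_ge0.
have Bz : l2norm (keep S z) <= Num.sqrt s%:R * W.
  by rewrite -sS; exact: l2norm_keep_bound.
(* On a missed support coordinate the error is [- bstar], that is [(v - bstar) - v]; this is why
   [keep A v] is subtracted. *)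
have -> : keep S (v + z) - bstar = (keep (S :|: Ss) (v - bstar) - keep A v) + keep S z.
  apply/rowP => j; rewrite !mxE !inE.
  have [jS|jS] := boolP (j \in S); rewrite ?orTb ?andFb ?orFb ?andTb/=.
    by ring.
  have [jSs|jSs] := boolP (bstar 0 j != 0); first by ring.
  by move: jSs; rewrite negbK => /eqP ->; ring.
apply: (le_trans (l2normD _ _)).
have h1 := l2normD (keep (S :|: Ss) (v - bstar)) (- keep A v).
rewrite l2normN in h1.
have h2 := l2norm_keep_sub (v - bstar) SI.
have BI : B \subset I.
  apply: fintype.subset_trans SI; apply: fintype.subset_trans (finset.subsetDl _ _) _; exact: finset.subsetUl.
have h3 := l2norm_keep_sub (v - bstar) BI.
set a := l2norm (keep I _) in h2 h3 *; set q := Num.sqrt s%:R in By Bz *.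
have q0 : 0 <= q by exact: sqrtr_ge0.
have qW : 0 <= q * W by exact: mulr_ge0.
(* With [rho <= 1] the selection noise contributes [2 * W * sqrt s]; the released noise adds one
   more, for a total of 3. *)
have h4 : rho * l2norm (keep B y) <= rho * a + q * (2 * W).
  apply: (@le_trans _ _ (rho * (a + q * (2 * W)))).
    by rewrite ler_wpM2l//; lra.
  rewrite mulrDr lerD2l -[X in _ <= X]mul1r ler_wpM2r//; lra.
lra.
Qed.

Lemma dot_row_sum (R : realType) (n d : nat) (y : 'rV[R]_d) (c : R)
    (a : 'I_n -> R) (X : 'I_n -> 'rV[R]_d) :
  dot y (\row_j (c * \sum_i a i * X i 0 j)) = c * \sum_i a i * dot (X i) y.
Proof.
rewrite /dot; under eq_bigr => j _ do rewrite mxE mulrCA mulr_sumr.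
rewrite -mulr_sumr exchange_big/=; congr (_ * _); apply: eq_bigr => i _.
by rewrite mulr_sumr; apply: eq_bigr => j _; ring.
Qed.

Lemma polarization (R : realType) (d : nat) (B : 'rV[R]_d -> 'rV[R]_d -> R)
    (x y : 'rV[R]_d) (a e : R) :
  (forall u v u', B (u + u') v = B u v + B u' v) ->
  (forall u v t, B (t *: u) v = t * B u v) ->
  (forall u v, B u v = B v u) ->
  B (a *: y + e *: x) (a *: y + e *: x) - B (a *: y - e *: x) (a *: y - e *: x) =
  4 * (a * e) * B x y.
Proof.
move=> BD BZ BC; rewrite -scaleNr !BD !(BC _ (_ + _)) !BD !BZ !(BC _ (_ *: _)) !BZ (BC y x).
ring.
Qed.

Lemma parallelogram (R : realType) (d : nat) (x y : 'rV[R]_d) :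
  dot (y + x) (y + x) + dot (y - x) (y - x) = 2 * (dot x x + dot y y).
Proof. rewrite !dotDl !dotDr !dotNl !dotNr; ring. Qed.

(** * Contraction of a gradient step on a small support *)

Section gradient_contraction.
Context (R : realType) (n d s sstar : nat) (psi dpsi ddpsi : R -> R) (r : R).
Context (D : 'I_n -> record R d) (bstar : 'rV[R]_d) (alpha gamma : R).
Hypothesis Hpsi : forall t : R, is_derive t 1 psi (dpsi t).
Hypothesis Hdpsi : forall t : R, is_derive t 1 dpsi (ddpsi t).
Hypothesis ag : 0 < alpha <= gamma.
Local Notation L := (glm_loss psi r D).
Let eta := 2 / (alpha + gamma).
Let kappa := (gamma - alpha) / (gamma + alpha).

Let ag0 : 0 < gamma + alpha. Proof. by case/andP: ag => ? ?; lra. Qed.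
Let eta0 : 0 < eta. Proof. by rewrite divr_gt0// addrC. Qed.
Let kappa0 : 0 <= kappa.
Proof. by rewrite divr_ge0 ?(ltW ag0)// subr_ge0; case/andP: ag. Qed.

(** The mean value theorem is scalar, so the step is paired with its own restriction [y] to [I] and
    followed along the segment. At some point of it, [l2norm y ^+ 2 = B (b - bstar) y], with [B] the
    identity minus [eta] times the Hessian form. On vectors supported in [I] the quadratic form of
    [B] is at most [kappa] in absolute value, and polarization carries this over to
    [B (b - bstar) y]. *)
Lemma grad_contraction (I : {set 'I_d}) (b : 'rV[R]_d) :
  (forall t : R, 0 <= t <= 1 ->
     let H := principal_submx I (hess L ((1 - t) *: bstar + t *: b)) in
     loewner_le alpha%:M H /\ loewner_le H gamma%:M) ->
  suppset b \subset I -> suppset bstar \subset I ->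
  l2norm (keep I ((b - eta *: grad L b) - (bstar - eta *: grad L bstar))) <=
  kappa * l2norm (b - bstar).
Proof.
move=> HH bI bsI; set x := (X in keep I X); set y := keep I x; set De := b - bstar.
have DeI : keep I De = De by rewrite /De keepB !keep_id.
have [->|y0] := eqVneq y 0; first by rewrite l2norm0 mulr_ge0// l2norm_ge0.
have [De0|De0] := eqVneq De 0.
  have bb : b = bstar by apply/eqP; rewrite -subr_eq0 -/De De0.
  by move: y0; rewrite /y /x bb subrr /keep (_ : \row_j _ = 0) ?eqxx//;
    apply/rowP => j; rewrite !mxE; case: ifP.
have ny := l2norm_gt0 y0; have nD := l2norm_gt0 De0.
pose line (t : R) := t *: De + bstar.
have lineE t : line t = (1 - t) *: bstar + t *: b.
  by rewrite /line /De scalerBr scalerBl scale1r addrC addrAC addrA.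
pose phi (t : R) := t * dot y De - eta * (n%:R^-1 * \sum_i dpsi (dot (D i).2 (line t)) * dot (D i).2 y).
pose dphi (t : R) := dot y De - eta * curvature_form ddpsi D (line t) De y.
have dP (t : R) : is_derive t 1 phi (dphi t).
  have Hi i (t0 : R) : is_derive t0 1 (fun t => dpsi t * dot (D i).2 y) (ddpsi t0 * dot (D i).2 y).
    have h1 := is_deriveM (Hdpsi t0) (is_derive_cst (dot (D i).2 y) t0 1).
    by apply: (is_derive_eq h1); rewrite /GRing.scale/= mulr0 add0r mulrC.
  have h1 := is_derive_ridge_line (fun i => (D i).2) n%:R^-1 bstar De t Hi.
  have h2 := is_deriveB (is_deriveM (is_derive_id t 1) (is_derive_cst (dot y De) t 1))
    (is_deriveM (is_derive_cst eta t 1) h1).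
  apply: (is_derive_eq h2); rewrite /GRing.scale/= /dphi /curvature_form -/(line t).
  rewrite mulr0 add0r mulr1 mulr0 addr0; congr (_ - _ * (_ * _)).
  by apply: eq_bigr => i _; rewrite mulrAC.
have [c c01] := MVT_all dP (ler01 : (0 : R) <= 1).
rewrite subr0 mulr1 => E.
have lhs : phi 1 - phi 0 = l2norm y ^+ 2.
  rewrite l2norm_sqr {2}/y dot_keepl -/y /x /phi.
  have -> : line 1 = b by rewrite /line scale1r /De subrK.
  have -> : line 0 = bstar by rewrite /line scale0r add0r.
  have -> : b - eta *: grad L b - (bstar - eta *: grad L bstar) =
      De - eta *: (grad L b - grad L bstar).
    by apply/rowP => j; rewrite !mxE; ring.
  have gE : dot y (grad L b - grad L bstar) =
      n%:R^-1 * (\sum_i dpsi (dot (D i).2 b) * dot (D i).2 y) -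
      n%:R^-1 * (\sum_i dpsi (dot (D i).2 bstar) * dot (D i).2 y).
    rewrite dotBr !(grad_glm_loss _ _ Hpsi) !dot_row_sum -!mulrBr -!sumrB.
    by congr (_ * _); apply: eq_bigr => i _; ring.
  rewrite (dotBr y De) dotZr gE; ring.
rewrite lhs /dphi in E.
have [Ha Hg] := HH c c01; rewrite -lineE in Ha Hg.
(* The step size [2 / (alpha + gamma)] balances the two ends of the spectrum:
   [1 - eta * alpha = kappa] and [1 - eta * gamma = - kappa]. *)
have Q (u : 'rV[R]_d) : (forall j, j \notin I -> u 0 j = 0) ->
    `|dot u u - eta * curvature_form ddpsi D (line c) u u| <= kappa * dot u u.
  move=> uI; have /andP[q1 q2] := curvature_form_bounds Hpsi Hdpsi Ha Hg uI.
  have k1 : 1 - eta * gamma = - kappa by rewrite /eta /kappa; field; rewrite ?gt_eqF//; case/andP: ag; lra.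
  have k2 : 1 - eta * alpha = kappa by rewrite /eta /kappa; field; rewrite ?gt_eqF//; case/andP: ag; lra.
  have q3 : eta * (alpha * dot u u) <= eta * curvature_form ddpsi D (line c) u u by rewrite ler_pM2l.
  have q4 : eta * curvature_form ddpsi D (line c) u u <= eta * (gamma * dot u u) by rewrite ler_pM2l.
  rewrite ler_norml; apply/andP; split.
    rewrite -mulNr -k1; lra.
  by rewrite -k2; lra.
have yI j : j \notin I -> y 0 j = 0 by move=> jI; rewrite mxE (negbTE jI).
have DI j : j \notin I -> De 0 j = 0 by move=> jI; rewrite -DeI mxE (negbTE jI).
set a := l2norm De in nD *; set e := l2norm y in E ny *.
pose B (u v : 'rV[R]_d) := dot u v - eta * curvature_form ddpsi D (line c) u v.
have cfD (u v u' : 'rV[R]_d) : curvature_form ddpsi D (line c) (u + u') v =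
    curvature_form ddpsi D (line c) u v + curvature_form ddpsi D (line c) u' v.
  rewrite /curvature_form -mulrDr -big_split/=; congr (_ * _).
  by apply: eq_bigr => i _; rewrite dotDr; ring.
have cfZ (u v : 'rV[R]_d) (t : R) : curvature_form ddpsi D (line c) (t *: u) v =
    t * curvature_form ddpsi D (line c) u v.
  rewrite /curvature_form [RHS]mulrCA [in RHS]mulr_sumr; congr (_ * _).
  by apply: eq_bigr => i _; rewrite dotZr; ring.
have cfC (u v : 'rV[R]_d) : curvature_form ddpsi D (line c) u v = curvature_form ddpsi D (line c) v u.
  by rewrite /curvature_form; congr (_ * _); apply: eq_bigr => i _; rewrite mulrAC.
have BD (u v u' : 'rV[R]_d) : B (u + u') v = B u v + B u' v by rewrite /B cfD dotDl; ring.
have BZ (u v : 'rV[R]_d) (t : R) : B (t *: u) v = t * B u v by rewrite /B cfZ dotZl; ring.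
have BC (u v : 'rV[R]_d) : B u v = B v u by rewrite /B cfC dotC.
(* The weights give [a *: y] and [e *: De] the same length [a * e], which makes polarization
   lossless. *)
have Qp := Q (a *: y + e *: De); have Qq := Q (a *: y - e *: De).
have Ip j : j \notin I -> (a *: y + e *: De) 0 j = 0.
  move=> jI; have -> : (a *: y + e *: De) 0 j = a * y 0 j + e * De 0 j by rewrite !mxE.
  by rewrite (yI j jI) (DI j jI) !mulr0 addr0.
have Iq j : j \notin I -> (a *: y - e *: De) 0 j = 0.
  move=> jI; have -> : (a *: y - e *: De) 0 j = a * y 0 j - e * De 0 j by rewrite !mxE.
  by rewrite (yI j jI) (DI j jI) !mulr0 subr0.
have {Ip}/ler_normlP[_ Qp'] := Qp Ip; have {Iq}/ler_normlP[Qq' _] := Qq Iq.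
rewrite -/(B (a *: y + e *: De) (a *: y + e *: De)) in Qp'.
rewrite -/(B (a *: y - e *: De) (a *: y - e *: De)) in Qq'.
have EQ : B (a *: y + e *: De) (a *: y + e *: De) - B (a *: y - e *: De) (a *: y - e *: De) =
    4 * (a * e) * B De y.
  exact: polarization.
have ED : dot (a *: y + e *: De) (a *: y + e *: De) + dot (a *: y - e *: De) (a *: y - e *: De) =
    4 * (a * e) ^+ 2.
  rewrite parallelogram (dotZl (e *: De)) (dotZr De) (dotZl (a *: y)) (dotZr y).
  rewrite -(l2norm_sqr De) -(l2norm_sqr y) -/a -/e; ring.
have h : 4 * (a * e) * B De y <= kappa * (4 * (a * e) ^+ 2) by rewrite -EQ -ED; lra.
have ae : 0 < a * e by exact: mulr_gt0.
have h2 : B De y <= kappa * (a * e).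
  by rewrite -(ler_pM2l (_ : 0 < 4 * (a * e))) ?mulr_gt0//; lra.
have h3 : e ^+ 2 <= kappa * (a * e) by rewrite E /B in h2 *; rewrite (dotC De y) in h2.
by rewrite -(ler_pM2r ny) -expr2; lra.
Qed.

End gradient_contraction.

Section iht.
Context (R : realType) (n d s sstar T : nat) (psi chi : R -> R) (Lpsi r : R).
Context (dpsi ddpsi : R -> R).
Context (D : 'I_n -> record R d) (bstar : 'rV[R]_d) (alpha gamma : R).
Context (tie : {set 'I_d} -> 'I_d) (w : 'I_T -> 'I_s -> 'I_d -> R) (w' : 'I_T -> 'I_d -> R).
Context (W rho G0 q0 : R).
Hypothesis Hpsi : forall t : R, is_derive t 1 (psi_sat psi chi Lpsi) (dpsi t).
Hypothesis Hdpsi : forall t : R, is_derive t 1 dpsi (ddpsi t).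
Hypothesis ag : 0 < alpha <= gamma.
Hypothesis tb : tie_breaking tie.
Hypothesis curv : curvature_ok s sstar bstar psi chi Lpsi r alpha gamma D.
Hypothesis wW : forall t k j, `|w t k j| <= W.
Hypothesis w'W : forall t j, `|w' t j| <= W.
Hypothesis sd : (s <= d)%N.
Hypothesis ss : (sstar < s)%N.
Hypothesis cb : (l0norm bstar <= sstar)%N.
Hypothesis rho01 : 0 <= rho <= 1.
Hypothesis Hrho : sstar%:R <= rho ^+ 2 * (s - sstar)%:R.
Local Notation L := (glm_loss (psi_sat psi chi Lpsi) r D).
Hypothesis gradG : forall j, `|grad L bstar 0 j| <= G0.
Hypothesis W0 : 0 <= W.
Hypothesis G00 : 0 <= G0.

Let eta := 2 / (alpha + gamma).
Let kappa := (gamma - alpha) / (gamma + alpha).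
(** Additive error of one iteration: the gradient at [bstar] on at most [3 * s] coordinates, then
    the noises. *)
Let Err := (1 + rho) * (eta * (Num.sqrt (3 * s%:R) * G0)) + 3 * (W * Num.sqrt s%:R).

Let step (b : 'rV[R]_d) := b - eta *: grad L b.

Lemma iht_step (b : 'rV[R]_d) (t : 'I_T) :
  (l0norm b <= s)%N -> l2norm (b - bstar) <= 2 ->
  let b' := noisyHT tie (step b) (w t) (w' t) in
  (l0norm b' <= s)%N /\
  l2norm (b' - bstar) <= (1 + rho) * kappa * l2norm (b - bstar) + Err.
Proof.
move=> b0 b2; set S := noisyHT_select tie (step b) (w t).
have [cS vS] := noisyHT_select_spec tb (step b) (wW t) sd.
rewrite noisyHTE -/S; split.
  by rewrite -[X in (_ <= X)%N]cS; exact: l0norm_keep.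
(* All coordinates that matter in this iteration; its size is within the limit [2 * s + sstar] of
   the curvature hypothesis, itself at most [3 * s]. *)
pose I := (S :|: suppset bstar :|: suppset b)%SET.
have eta0 : 0 <= eta by rewrite divr_ge0//; case/andP: ag => ? ?; lra.
have cI : (#|I| <= 2 * s + sstar)%N.
  apply: (leq_trans (leq_card_setU _ _)); rewrite mul2n -addnn -addnA (addnC s sstar) addnA.
  apply: leq_add; last by rewrite card_suppset.
  apply: (leq_trans (leq_card_setU _ _)); apply: leq_add; first by rewrite -cS.
  by rewrite card_suppset.
have z' j : `|(\row_k w' t k : 'rV[R]_d) 0 j| <= W by rewrite mxE.
have SI : (S :|: suppset bstar)%SET \subset I by exact: finset.subsetUl.
have := hard_threshold_expansion cS cb ss W0 vS z' rho01 Hrho SI.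
move/le_trans; apply.
have bI : suppset b \subset I by exact: finset.subsetUr.
have bsI : suppset bstar \subset I.
  by apply: fintype.subset_trans SI; exact: finset.subsetUr.
have cc : forall u : R, 0 <= u <= 1 ->
     let H := principal_submx I (hess L ((1 - u) *: bstar + u *: b)) in
     loewner_le alpha%:M H /\ loewner_le H gamma%:M.
  by move=> u u01; apply: curv => //; exists b, u; split.
have := grad_contraction Hpsi Hdpsi ag cc bI bsI.
rewrite -/eta -/kappa => h1.
have h2 : l2norm (keep I (step b - bstar)) <=
    kappa * l2norm (b - bstar) + eta * (Num.sqrt (3 * s%:R) * G0).
  have -> : step b - bstar = (step b - (bstar - eta *: grad L bstar)) - eta *: grad L bstar.
    by apply/rowP => j; rewrite !mxE; ring.
  rewrite keepB; apply: (le_trans (l2normD _ _)); apply: lerD => //.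
  rewrite l2normN keepZ l2normZ (ger0_norm eta0) ler_wpM2l//.
  apply: (le_trans (l2norm_keep_bound I G00 gradG)); apply: ler_wpM2r => //.
  rewrite ler_sqrt ?mulr_ge0// -natrM ler_nat (leq_trans cI)//.
  by rewrite mulSn addnC leq_add2r ltnW.
have r1 : 0 <= 1 + rho by case/andP: rho01 => ? ?; lra.
have := ler_wpM2l r1 h2; rewrite /Err; lra.
Qed.

Hypothesis q01 : 0 <= q0 < 1.
Hypothesis Hq0 : (1 + rho) * kappa <= q0.
Hypothesis Err2 : Err <= 2 * (1 - q0).

(** [Err2] makes radius 2 invariant, since [q0 * 2 + 2 * (1 - q0) = 2]; this keeps the curvature
    bounds available at every iterate. The additive errors sum as a geometric series. *)
Lemma iht_run (b : 'rV[R]_d) (l : seq 'I_T) :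
  (l0norm b <= s)%N -> l2norm (b - bstar) <= 2 ->
  l2norm (noisy_run tie step w w' b l - bstar) <=
  q0 ^+ size l * l2norm (b - bstar) + Err * ((1 - q0 ^+ size l) / (1 - q0)).
Proof.
case/andP: q01 => q00 q1.
have Err0 : 0 <= Err.
  case/andP: rho01 => ? ?; case/andP: ag => ? ?.
  rewrite /Err addr_ge0//; last by rewrite mulr_ge0// mulr_ge0// sqrtr_ge0.
  rewrite mulr_ge0//; first by lra.
  have eta0 : 0 <= eta by rewrite /eta divr_ge0//; lra.
  by rewrite mulr_ge0// mulr_ge0// sqrtr_ge0.
have f0 : 0 < 1 - q0 by lra.
elim: l b => [|t l IH] b b0 b2.
  by rewrite /= expr0 mul1r subrr mul0r mulr0 addr0.
have [b0' h] := iht_step t b0 b2.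
set b' := noisyHT _ _ _ _ in b0' h.
have e0 := l2norm_ge0 (b - bstar).
have h' : l2norm (b' - bstar) <= q0 * l2norm (b - bstar) + Err.
  by apply: (le_trans h); rewrite lerD2r ler_wpM2r.
have b2' : l2norm (b' - bstar) <= 2.
  apply: (le_trans h'); apply: (@le_trans _ _ (q0 * 2 + 2 * (1 - q0))); last by lra.
  by apply: lerD => //; rewrite ler_wpM2l.
apply: (le_trans (IH b' b0' b2')).
have qk0 : 0 <= q0 ^+ size l by exact: exprn_ge0.
have := ler_wpM2l qk0 h'.
have -> : (1 - q0 ^+ (size l).+1) / (1 - q0) = q0 ^+ size l + (1 - q0 ^+ size l) / (1 - q0).
  by rewrite exprSr; field; rewrite gt_eqF.
rewrite /= exprSr; lra.
Qed.

Lemma iht_error : l2norm bstar <= 1 ->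
  l2norm (noisy_run tie step w w' 0 (enum 'I_T) - bstar) <= q0 ^+ T + Err / (1 - q0).
Proof.
move=> b1; case/andP: q01 => q00 q1.
have f0 : 0 < 1 - q0 by lra.
have nb : l2norm (0 - bstar) = l2norm bstar by rewrite sub0r l2normN.
have := @iht_run 0 (enum 'I_T); rewrite size_enum_ord nb.
have z : (l0norm (0 : 'rV[R]_d) <= s)%N.
  by rewrite /l0norm (eq_card0 (A := [pred j | (0 : 'rV[R]_d) 0 j != 0]))// => j; rewrite !inE mxE eqxx.
have b2 : l2norm bstar <= 2 by lra.
move=> /(_ z b2) /le_trans; apply; apply: lerD.
  by rewrite -[X in _ <= X]mulr1 ler_wpM2l// exprn_ge0.
have Err0 : 0 <= Err.
  case/andP: rho01 => ? ?; case/andP: ag => ? ?.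
  rewrite /Err addr_ge0//; last by rewrite mulr_ge0// mulr_ge0// sqrtr_ge0.
  rewrite mulr_ge0//; first by lra.
  have eta0 : 0 <= eta by rewrite /eta divr_ge0//; lra.
  by rewrite mulr_ge0// mulr_ge0// sqrtr_ge0.
apply: ler_wpM2l => //; rewrite -[X in _ <= X]mul1r ler_wpM2r ?invr_ge0 ?(ltW f0)//.
by rewrite lerBlDr lerDl exprn_ge0.
Qed.

End iht.

(** * Moments and tails in the generalized linear model *)

Section density_measure.
Context d (T : measurableType d) (R : realType) (mu : {measure set T -> \bar R}).
Context (p : T -> R) (mp : measurable_fun setT p) (p0 : forall x, 0 <= p x).

Definition density_measure (A : set T) : \bar R := (\int[mu]_(x in A) (p x)%:E)%E.

Let density0 : density_measure set0 = 0%E.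
Proof. exact: integral_set0. Qed.

Let density_ge0 A : (0 <= density_measure A)%E.
Proof. by apply: integral_ge0 => x _; rewrite lee_fin. Qed.

Let density_sigma_additive : semi_sigma_additive density_measure.
Proof.
apply: semi_sigma_additive_nng_induced; first exact/measurable_EFinP.
by move=> x; rewrite lee_fin.
Qed.

Lemma density_measureP : exists m : {measure set T -> \bar R},
  forall A, m A = (\int[mu]_(x in A) (p x)%:E)%E.
Proof.
pose m : {measure set T -> \bar R} := HB.pack density_measure
  (isMeasure.Build _ _ _ density_measure density0 density_ge0 density_sigma_additive).
by exists m.
Qed.

Lemma density_probabilityP : (\int[mu]_x (p x)%:E = 1)%E ->
  exists m : probability T R, forall A, m A = (\int[mu]_(x in A) (p x)%:E)%E.
Proof.
move=> p1.
pose m0 : {measure set T -> \bar R} := HB.pack density_measure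
  (isMeasure.Build _ _ _ density_measure density0 density_ge0 density_sigma_additive).
pose m : probability T R := HB.pack (m0 : set T -> \bar R)
  (Measure.class m0) (Measure_isProbability.Build _ _ _ m0 p1).
by exists m.
Qed.

End density_measure.

Section glm_law.
Context (R : realType) (d : nat) (fx : probability (borelType 'rV[R]_d) R).
Context (mu : {measure set (measurableTypeR R) -> \bar R}).
Context (h : R -> R) (c : R) (psi : R -> R) (bstar : 'rV[R]_d).
Context dO (O : measurableType dO) (P : probability O R).
Context (Z : {RV P >-> borelType (record R d)}).
Hypothesis glm : glm_family mu h c psi.
Hypothesis cpsi : continuous psi.
Hypothesis law : forall (B : set R) (A : set 'rV[R]_d),
    measurable B -> <<s open >> A ->
    P (Z @^-1` (B `*` A)) =
    (\int[fx]_(x in A)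
       \int[mu]_(y in B) (glm_density h c psi (dot x bstar) y)%:E)%E.

Let c0 : 0 < c. Proof. by case: glm. Qed.

Lemma measurable_record_fst :
  measurable_fun setT (fun z : borelType (record R d) => z.1).
Proof.
move=> _ B mB; rewrite setTI; apply: (continuous_preimage_borel (f := fst)) => // z.
exact: cvg_fst.
Qed.

Lemma measurable_record_snd :
  measurable_fun setT (fun z : borelType (record R d) => z.2 : borelType 'rV[R]_d).
Proof.
apply: measurable_rV => j.
move=> _ B mB; rewrite setTI.
apply: (continuous_preimage_borel (f := fun z : record R d => z.2 0 j)) => // z.
apply: (@continuous_comp _ _ _ (fun z : record R d => z.2) (fun x : 'rV[R]_d => x 0 j)).
  exact: cvg_snd.
exact: coord_continuous.
Qed.

Lemma measurable_dot (b : 'rV[R]_d) :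
  measurable_fun setT (fun x : borelType 'rV[R]_d => dot x b).
Proof.
rewrite /dot; apply: measurable_sum => j; apply: measurable_funM => //.
exact: measurable_coord.
Qed.

(** Density of the response relative to the one at linear predictor 0. Since [mu] may fail to be
    sigma-finite, integrals are rewritten under the probability with density [p] with respect to
    [mu], for which product measures and Tonelli are available. *)
Let tilt (z : borelType 'rV[R]_d * measurableTypeR R) : R :=
  expR ((z.2 * dot z.1 bstar - psi (dot z.1 bstar) + psi 0) / c).

Let mtilt : measurable_fun setT tilt.
Proof.
have m1 : measurable_fun setT (fun z : borelType 'rV[R]_d * measurableTypeR R => dot z.1 bstar).
  exact: (measurableT_comp (measurable_dot bstar) measurable_fst).
apply: measurableT_comp => //; apply: measurable_funM => //.
apply: measurable_funD => //; apply: measurable_funB.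
  by apply: measurable_funM => //; exact: measurable_snd.
by apply: (measurableT_comp (f := psi)) => //; exact: continuous_measurable_fun.
Qed.

Let p (y : measurableTypeR R) := glm_density h c psi 0 y.

Let tiltE x y : glm_density h c psi (dot x bstar) y = tilt (x, y) * p y.
Proof.
rewrite /tilt /p /glm_density/= [RHS]mulrCA -expRD; congr (_ * expR _).
by field; rewrite gt_eqF.
Qed.

(** The model prescribes the law of a record on rectangles only. There it coincides with the measure
    of density [tilt] under the product of [fx] and the response law at 0, and rectangles determine
    a finite measure. *)
Lemma glm_integral (G : borelType 'rV[R]_d * measurableTypeR R -> \bar R) :
  measurable_fun setT G -> (forall z, (0 <= G z)%E) ->
  (\int[P]_o G ((Z o).2, (Z o).1) =
   \int[fx]_x \int[mu]_y (G (x, y) * (glm_density h c psi (dot x bstar) y)%:E))%E.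
Proof.
move=> mG G0.
have [_ /(_ 0)[mp p0 p1]] := glm.
have [nu nuE] := density_probabilityP (mp : measurable_fun setT p) p0 p1.
have mtE : measurable_fun setT (EFin \o tilt) by exact/measurable_EFinP.
have t0 z : 0 <= tilt z by exact: expR_ge0.
have [kQ kQE] := density_measureP (fx \x nu)%E mtilt t0.
have inner (f : measurableTypeR R -> \bar R) : measurable_fun setT f -> (forall y, (0 <= f y)%E) ->
    (\int[nu]_y f y = \int[mu]_y (f y * (p y)%:E))%E.
  by move=> mf f0; apply: integral_density => // A _; exact: nuE.
have mX : measurable_fun setT (fun o => (Z o).2 : borelType 'rV[R]_d).
  by apply: (measurableT_comp measurable_record_snd); exact: measurable_funPT.
have mY : measurable_fun setT (fun o => (Z o).1 : measurableTypeR R).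
  by apply: (measurableT_comp measurable_record_fst); exact: measurable_funPT.
have mXY : measurable_fun setT (fun o => ((Z o).2 : borelType 'rV[R]_d, (Z o).1 : measurableTypeR R)).
  exact: measurable_fun_pair.
pose XY : {mfun O >-> (borelType 'rV[R]_d * measurableTypeR R)%type} :=
  HB.pack (fun o => ((Z o).2 : borelType 'rV[R]_d, (Z o).1 : measurableTypeR R))
  (isMeasurableFun.Build _ _ _ _ _ mXY).
have rect (A : set (borelType 'rV[R]_d)) (B : set (measurableTypeR R)) : measurable A -> measurable B ->
    distribution P XY (A `*` B) = kQ (A `*` B).
  move=> mA mB; rewrite kQE.
  rewrite (_ : distribution P XY (A `*` B) = P (Z @^-1` (B `*` A))); last first.
    by congr (P _); rewrite eqEsubset; split => u [? ?]; split.
  have F0 z : (0 <= ((EFin \o tilt) \_ (A `*` B)) z)%E.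
    by apply: erestrict_ge0 => w _; rewrite lee_fin.
  rewrite law// [RHS]integral_mkcond fubini_tonelli1/=; last 2 first.
  - apply/(measurable_restrictT _ _).1 => //; first exact: measurableX.
    exact: measurable_funTS.
  - by move=> z; apply: erestrict_ge0 => w _; rewrite lee_fin.
  rewrite integral_mkcond; apply: eq_integral => x _.
  rewrite /patch; have [xA|xA] := boolP (x \in A); last first.
    rewrite /fubini_F integral0_eq// => y _.
    by rewrite /patch ifF//; apply/negbTE; apply: contra xA; rewrite !inE => -[].
  rewrite /fubini_F inner; last 2 first.
  - apply: (measurable_fun_pair2 (f := (EFin \o tilt) \_ (A `*` B))).
    apply/(measurable_restrictT _ _).1 => //; first exact: measurableX.
    exact: measurable_funTS.
  - by move=> y; exact: (F0 (x, y)).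
  rewrite integral_mkcond; apply: eq_integral => y _.
  rewrite /patch; have [yB|yB] := boolP (y \in B); last first.
    by rewrite ifF ?mul0e//; apply/negbTE; apply: contra yB; rewrite !inE => -[].
  rewrite ifT; last by rewrite inE; split; [move: xA|move: yB]; rewrite inE.
  by rewrite -EFinM tiltE.
have meq : forall E, measurable E -> distribution P XY E = kQ E.
  move=> E mE.
  pose C : set (set (borelType 'rV[R]_d * measurableTypeR R)) :=
    [set C | exists A, measurable A /\ exists B, measurable B /\ C = A `*` B].
  apply: (measure_unique C (fun=> setT)) mE => //.
  - rewrite measurable_prod_measurableType //; congr (<<s _ >>).
    rewrite predeqE; split => [[A mA [B mB <-]]|[A [mA [B [mB ->]]]]].
      by exists A; split => //; exists B.
    by exists A => //; exists B.
  - move=> _ _ [X1 [mX1 [X2 [mX2 ->]]]] [Y1 [mY1 [Y2 [mY2 ->]]]].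
    rewrite -setXI; exists (X1 `&` Y1); split; first exact: measurableI.
    by exists (X2 `&` Y2); split => //; exact: measurableI.
  - by move=> _; exists setT; split => //; exists setT; split => //; rewrite setXTT.
  - by rewrite bigcup_const//; exists 0%N.
  - by move=> _ [A [mA [B [mB ->]]]]; exact: rect.
  - by move=> _; rewrite (le_lt_trans (probability_le1 _ _))// ltry.
transitivity (\int[distribution P XY]_z G z)%E.
  by rewrite ge0_integral_pushforward.
transitivity (\int[fx \x nu]_z (G z * (tilt z)%:E))%E.
  by apply: integral_density => // A mA; exact: (etrans (meq A mA) (kQE A)).
rewrite fubini_tonelli1; last 2 first.
- exact: emeasurable_funM.
- by move=> z; rewrite mule_ge0// lee_fin.
apply: eq_integral => x _; rewrite /fubini_F inner; last 2 first.
- by apply: (measurable_fun_pair2 (f := fun z => (G z * (tilt z)%:E)%E)); exact: emeasurable_funM.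
- by move=> y; rewrite mule_ge0// lee_fin.
by apply: eq_integral => y _; rewrite -muleA -EFinM -tiltE.
Qed.

Lemma glm_marginal (A : set 'rV[R]_d) : <<s open >> A ->
  P (Z @^-1` (setT `*` A)) = fx A.
Proof.
move=> mA; rewrite law//; have [_ dens] := glm.
under eq_integral => x _ do rewrite (let: And3 _ _ e := dens (dot x bstar) in e).
by rewrite integral_cst// mul1e.
Qed.

End glm_law.

(** The function [g], which is [f] minus a linear term and a parabola, has a derivative of sign
    opposite to [s - th], hence is maximal at [th]. *)
Lemma taylor2_le (R : realType) (f df ddf : R -> R) (M th t : R) :
  (forall x : R, is_derive x 1 f (df x)) ->
  (forall x : R, is_derive x 1 df (ddf x)) ->
  (forall x, ddf x <= M) ->
  f (th + t) - f th - t * df th <= M * t ^+ 2 / 2.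
Proof.
move=> Hf Hdf HM.
have mono x y : x <= y -> df y - df x <= M * (y - x).
  move=> xy; have [z _ ->] := MVT_all Hdf xy.
  by rewrite ler_wpM2r ?subr_ge0.
pose g (s : R) := f s - s * df th - M / 2 * ((s - th) * (s - th)).
have dg (s : R) : is_derive s 1 g (df s - df th - M * (s - th)).
  have h1 := is_deriveB (is_deriveB (Hf s) (is_deriveM (is_derive_id s 1) (is_derive_cst (df th) s 1)))
    (is_deriveM (is_derive_cst (M / 2) s 1)
      (is_deriveM (is_deriveB (is_derive_id s 1) (is_derive_cst th s 1))
        (is_deriveB (is_derive_id s 1) (is_derive_cst th s 1)))).
  apply: (is_derive_eq h1).
  by rewrite !fctE /cst /GRing.scale/=; field.
suff : g (th + t) <= g th.
  rewrite /g; have -> : th + t - th = t by ring.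
  rewrite subrr !mulr0; lra.
have [t0|/ltW t0] := leP 0 t.
  have tt : th <= th + t by lra.
  have [z /andP[z0 z1] E] := MVT_all dg tt.
  have := mono _ _ z0; rewrite -subr_le0 => h.
  have : (df z - df th - M * (z - th)) * (th + t - th) <= 0.
    by rewrite mulr_le0_ge0//; lra.
  lra.
have tt : th + t <= th by lra.
have [z /andP[z0 z1] E] := MVT_all dg tt.
have := mono _ _ z1 => h.
have : 0 <= (df z - df th - M * (z - th)) * (th - (th + t)).
  by rewrite mulr_ge0//; lra.
lra.
Qed.

(** * Exponential moments of the residuals *)

Section glm_mgf.
Context (R : realType) (d : nat) (fx : probability (borelType 'rV[R]_d) R).
Context (mu : {measure set (measurableTypeR R) -> \bar R}).
Context (h : R -> R) (c c2 c3 : R) (psi : R -> R) (bstar : 'rV[R]_d).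
Context dO (O : measurableType dO) (P : probability O R).
Context (Z : {RV P >-> borelType (record R d)}).
Hypothesis glm : glm_family mu h c psi.
Hypothesis gpsi : condG c2 c3 psi.
Hypothesis law : forall (B : set R) (A : set 'rV[R]_d),
    measurable B -> <<s open >> A ->
    P (Z @^-1` (B `*` A)) =
    (\int[fx]_(x in A)
       \int[mu]_(y in B) (glm_density h c psi (dot x bstar) y)%:E)%E.

Let c0 : 0 < c. Proof. by case: glm. Qed.
Let cpsi : continuous psi.
Proof. exact: is_derive_continuous (psi_is_derive gpsi). Qed.

(** Multiplying the density by [expR (u * y)] moves the natural parameter from [th] to [th + c * u],
    where the density again has total mass 1. *)
Lemma glm_conditional_mgf (th u : R) :
  (\int[mu]_y ((expR (u * (y - derive1 psi th)))%:E * (glm_density h c psi th y)%:E) =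
   (expR (- (u * derive1 psi th) + (psi (th + c * u) - psi th) / c))%:E)%E.
Proof.
have [_ dens] := glm; have [md d0 d1] := dens (th + c * u).
have E y : expR (u * (y - derive1 psi th)) * glm_density h c psi th y =
    expR (- (u * derive1 psi th) + (psi (th + c * u) - psi th) / c) *
    glm_density h c psi (th + c * u) y.
  rewrite /glm_density mulrCA [RHS]mulrCA; congr (_ * _); rewrite -!expRD; congr expR.
  by field; rewrite gt_eqF.
under eq_integral => y _ do rewrite -EFinM E EFinM.
rewrite ge0_integralZl//.
- by rewrite d1 mule1.
- exact/measurable_EFinP.
- by move=> y _; rewrite lee_fin.
Qed.

(** Given [x], Taylor's formula with [psi'' <= c2] makes the residual sub-Gaussian with variance
    proxy [c * c2]. The weight [phi] is 1 for the tail of a residual and a coordinate of [x] for the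
    score. *)
Lemma glm_residual_mgf (phi : 'rV[R]_d -> R) (l : R) :
  measurable_fun setT (phi : borelType 'rV[R]_d -> R) ->
  (\int[P]_o (expR (l * (((Z o).1 - derive1 psi (dot (Z o).2 bstar)) * phi (Z o).2)))%:E <=
   \int[fx]_x (expR (c * c2 * l ^+ 2 * phi x ^+ 2 / 2))%:E)%E.
Proof.
move=> mphi.
pose G (z : borelType 'rV[R]_d * measurableTypeR R) : \bar R :=
  (expR (l * ((z.2 - derive1 psi (dot z.1 bstar)) * phi z.1)))%:E.
have mdpsi : measurable_fun setT (derive1 psi).
  apply: continuous_measurable_fun; exact: is_derive_continuous (dpsi_is_derive gpsi).
have mG : measurable_fun setT G.
  have m1 : measurable_fun setT (fun z : borelType 'rV[R]_d * measurableTypeR R => dot z.1 bstar).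
    exact: (measurableT_comp (measurable_dot bstar) measurable_fst).
  apply/measurable_EFinP; apply: measurableT_comp => //; apply: measurable_funM => //.
  apply: measurable_funM; last exact: (measurableT_comp mphi measurable_fst).
  apply: measurable_funB; first exact: measurable_snd.
  exact: (measurableT_comp mdpsi m1).
have G0 z : (0 <= G z)%E by rewrite lee_fin expR_ge0.
rewrite (glm_integral glm cpsi law mG G0).
have E x : (\int[mu]_y (G (x, y) * (glm_density h c psi (dot x bstar) y)%:E) =
    (expR (- (l * phi x * derive1 psi (dot x bstar)) +
      (psi (dot x bstar + c * (l * phi x)) - psi (dot x bstar)) / c))%:E)%E.
  rewrite -glm_conditional_mgf; apply: eq_integral => y _; congr (_ * _)%E.
  by rewrite /G/=; congr (expR _)%:E; ring.
under eq_integral => x _ do rewrite E.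
have mdot := measurable_dot bstar.
have mpsi : measurable_fun setT psi by exact: continuous_measurable_fun.
apply: ge0_le_integral => //.
- apply/measurable_EFinP; apply: measurableT_comp => //; apply: measurable_funD.
    apply: measurableT_comp => //; apply: measurable_funM; first exact: measurable_funM.
    exact: (measurableT_comp mdpsi mdot).
  apply: measurable_funM => //; apply: measurable_funB; last exact: (measurableT_comp mpsi mdot).
  apply: (measurableT_comp mpsi); apply: measurable_funD => //.
  by apply: measurable_funM => //; exact: measurable_funM.
- apply/measurable_EFinP; apply: measurableT_comp => //; apply: measurable_funM => //.
  by apply: measurable_funM => //; exact: measurable_funX.
move=> x _; set th := dot x bstar.
rewrite lee_fin ler_expR.
have d2 : forall t, derive1n 2 psi t <= c2 by move=> t; case/andP: (d2psi_bounds gpsi t).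
have := taylor2_le th (c * (l * phi x)) (psi_is_derive gpsi) (dpsi_is_derive gpsi) d2.
set A := psi (th + _); set B := psi th; set C := derive1 psi th => H.
have : (A - B - c * (l * phi x) * C) / c <= c2 * (c * (l * phi x)) ^+ 2 / 2 / c.
  by rewrite ler_pM2r ?invr_gt0.
have -> : (A - B - c * (l * phi x) * C) / c = - (l * phi x * C) + (A - B) / c.
  by field; rewrite gt_eqF.
have -> : c2 * (c * (l * phi x)) ^+ 2 / 2 / c = c * c2 * l ^+ 2 * phi x ^+ 2 / 2.
  by field; rewrite gt_eqF.
by [].
Qed.

End glm_mgf.

Lemma chernoff d (O : measurableType d) (R : realType) (P : probability O R)
    (X : O -> R) (s : R) (B : \bar R) :
  measurable_fun setT X ->
  (\int[P]_o (expR (X o))%:E <= B)%E ->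
  (P [set o | (s <= X o)%R] <= (expR (- s))%:E * B)%E.
Proof.
move=> mX XB.
have mA : measurable [set o | s <= X o].
  rewrite (_ : [set o | _] = setT `&` X @^-1` `[s, +oo[); first exact: mX.
  by rewrite setTI; rewrite eqEsubset; split => o /=; rewrite in_itv/= andbT.
have mE : measurable_fun setT (fun o => (expR (X o))%:E).
  by apply/measurable_EFinP; exact: measurableT_comp.
have h : ((expR s)%:E * P [set o | (s <= X o)%R] <= \int[P]_o (expR (X o))%:E)%E.
  have -> : ((expR s)%:E * P [set o | (s <= X o)%R] =
      \int[P]_o ((expR s)%:E * (\1_[set o | (s <= X o)%R] o)%:E))%E.
    rewrite ge0_integralZl//; first by rewrite integral_indic// setIT.
    exact/measurable_EFinP.
  apply: ge0_le_integral => //.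
  - by apply: emeasurable_funM => //; exact/measurable_EFinP.
  move=> o _; rewrite indicE -EFinM lee_fin.
  case: (boolP (o \in _)); last by rewrite mulr0 expR_ge0.
  by rewrite inE mulr1 ler_expR.
have e : (1 = (expR (- s))%:E * (expR s)%:E)%E.
  by rewrite -EFinM -expRD addNr expR0.
rewrite -[P _]mul1e e -muleA; apply: lee_wpmul2l; first by rewrite lee_fin expR_ge0.
exact: le_trans XB.
Qed.

Lemma expR_convex_le (R : realType) (th z : R) : 0 <= th <= 1 ->
  expR (th * z) <= 1 + th * (expR z - 1).
Proof.
move=> /andP[h0 h1].
have a := expR_ge1Dx (z - th * z); have b := expR_ge1Dx (- (th * z)).
have e1 : expR z = expR (th * z) * expR (z - th * z) by rewrite -expRD; congr expR; ring.
have e2 : 1 = expR (th * z) * expR (- (th * z)) by rewrite -expRD subrr expR0.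
have e0 := expR_gt0 (th * z).
have k : 1 <= th * expR (z - th * z) + (1 - th) * expR (- (th * z)).
  have : th * (1 + (z - th * z)) <= th * expR (z - th * z) by rewrite ler_wpM2l.
  have : (1 - th) * (1 + - (th * z)) <= (1 - th) * expR (- (th * z)) by rewrite ler_wpM2l// subr_ge0.
  lra.
have := ler_wpM2l (ltW e0) k; rewrite mulr1 mulrDr.
rewrite mulrCA -e1 (mulrCA _ (1 - th)) -e2; lra.
Qed.

Section subgaussian.
Context d (T : measurableType d) (R : realType) (P : probability T R).
Context (X : T -> R) (K t : R).
Hypothesis mX : measurable_fun setT X.
Hypothesis XK : (psi2_norm P X <= K%:E)%E.
Hypothesis Kt : K < t.
Hypothesis t0 : 0 < t.

(** The Orlicz norm is an infimum, so the moment bound is extracted at a scale below [t], for any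
    [t > K]. *)
Lemma psi2_exp_moment : (\int[P]_w (expR ((X w / t) ^+ 2))%:E <= 2%:E)%E.
Proof.
have [_ [s [s0 Es] <-]] : exists2 y, [set t%:E | t in [set t : R | 0 < t /\
    ('E_P[fun w => (expR ((X w / t) ^+ 2))%R] <= 2%:E)%E]] y & (y < t%:E)%E.
  by apply: ereal_inf_lt; apply: le_lt_trans XK _; rewrite lte_fin.
rewrite lte_fin => st; apply: le_trans Es; rewrite unlock.
have m u : measurable_fun setT (fun w => (expR ((X w / u) ^+ 2))%:E).
  apply/measurable_EFinP; apply: measurableT_comp => //; apply: measurable_funX.
  exact: measurable_funM.
apply: ge0_le_integral => //.
move=> w _; rewrite lee_fin ler_expR !exprMn ler_wpM2l ?sqr_ge0//.
by rewrite lerXn2r ?nnegrE ?invr_ge0 ?(ltW t0) ?(ltW s0)// lef_pV2 ?posrE// ltW.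
Qed.

Lemma subgaussian_tail (s : R) : 0 <= s ->
  (P [set w | (s * t <= `|X w|)%R] <= (2 * expR (- s ^+ 2))%:E)%E.
Proof.
move=> s0.
have m : measurable_fun setT (fun w => (X w / t) ^+ 2).
  by apply: measurable_funX; exact: measurable_funM.
rewrite (mulrC 2) EFinM.
apply: le_trans (chernoff (s ^+ 2) m psi2_exp_moment).
rewrite le_eqVlt; apply/orP; left; apply/eqP; congr (P _).
rewrite eqEsubset; split => w /=.
  move=> h; rewrite -(real_normK (num_real (X w / t))) lerXn2r ?nnegrE//.
  by rewrite normrM normfV (gtr0_norm t0) ler_pdivlMr.
move=> h; rewrite -ler_pdivlMr// -[X in _ <= _ / X](gtr0_norm t0) -normfV -normrM.
by rewrite -(@ler_pXn2r _ 2) ?nnegrE// real_normK ?num_real.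
Qed.

(** Convexity interpolates between the exponents 0 and [1 / t ^+ 2] and gives the mean at most
    [1 + th]. A bound that tends to 1 with [a], rather than the constant 2, is essential: for the
    score it is raised to the power [n]. *)
Lemma subgaussian_sqr_mgf (a : R) : 0 <= a -> a * t ^+ 2 <= 1 ->
  (\int[P]_w (expR (a * X w ^+ 2))%:E <= (expR (a * t ^+ 2))%:E)%E.
Proof.
move=> a0 at1; set th := a * t ^+ 2.
have th0 : 0 <= th by rewrite mulr_ge0// sqr_ge0.
have m : measurable_fun setT (fun w => (expR ((X w / t) ^+ 2))%:E).
  apply/measurable_EFinP; apply: measurableT_comp => //; apply: measurable_funX.
  exact: measurable_funM.
apply: (@le_trans _ _ (\int[P]_w ((1 - th)%:E + th%:E * (expR ((X w / t) ^+ 2))%:E))%E).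
  apply: ge0_le_integral => //.
  - apply/measurable_EFinP; apply: measurableT_comp => //; apply: measurable_funM => //.
    exact: measurable_funX.
  - by apply: emeasurable_funD => //; exact: emeasurable_funM.
  move=> w _; rewrite -EFinM -EFinD lee_fin.
  have -> : a * X w ^+ 2 = th * (X w / t) ^+ 2 by rewrite /th; field; rewrite gt_eqF.
  have := @expR_convex_le R th ((X w / t) ^+ 2); rewrite th0 at1 => /(_ isT); lra.
rewrite ge0_integralD//; last 3 first.
- by move=> w ?; rewrite lee_fin subr_ge0.
- by move=> w ?; rewrite mule_ge0// lee_fin// expR_ge0.
- exact: emeasurable_funM.
rewrite integral_cst//= probability_setT mule1 ge0_integralZl//.
apply: (@le_trans _ _ ((1 - th)%:E + th%:E * 2%:E)%E).
  by rewrite leeD2l// lee_wpmul2l// ?lee_fin//; exact: psi2_exp_moment.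
rewrite -EFinM -EFinD lee_fin; have := expR_ge1Dx th; lra.
Qed.

End subgaussian.

Lemma integral_prod_indep d (O : measurableType d) (R : realType)
    (P : probability O R) (I : finType) (F : I -> set (set O))
    (f : I -> O -> R) (B : R) (l : seq I) :
  indep_family P F -> uniq l ->
  (forall i, measurable_fun setT (f i : groupType O F [set i] -> R)) ->
  (forall i o, 0 <= f i o) -> 0 <= B ->
  (forall i, (\int[P]_o (f i o)%:E <= B%:E)%E) ->
  (\int[P]_o (\prod_(i <- l) f i o)%:E <= (B ^+ size l)%:E)%E.
Proof.
move=> indF + mf f0 B0 fB; case: (indF) => iF Fm FI FT.
have mf' i : measurable_fun setT (f i) by exact: groupType_measurable (mf i).
have mprod (s : seq I) : measurable_fun setT (fun o => \prod_(i <- s) f i o).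
  by apply: measurable_prod => i _.
have p0 (s : seq I) o : 0 <= \prod_(i <- s) f i o by apply: prodr_ge0.
elim: l => [|i l IH] /=.
  move=> _; under eq_integral => o _ do rewrite big_nil.
  by rewrite integral_cst//= probability_setT mule1 expr0.
move=> /andP[il ul].
(* Absolute values make the integrand nonnegative on the whole plane; the factors themselves are
   nonnegative. *)
pose H (z : R * R) := (`|z.1| * `|z.2|)%:E.
have mH : measurable_fun setT H.
  apply/measurable_EFinP; apply: measurable_funM.
    exact: (measurableT_comp (@normr_measurable R setT) measurable_fst).
  exact: (measurableT_comp (@normr_measurable R setT) measurable_snd).
have KL : [set i] `&` [set j | j \in l] = set0.
  by rewrite -subset0 => j [/= -> h]; rewrite h in il.
have mg : measurable_fun setT ((fun o => \prod_(j <- l) f j o) : groupType O F [set j | j \in l] -> R).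
  rewrite (_ : (fun o => _) = (fun o => \prod_(j <- l) (if j \in l then f j o else 1))).
    apply: measurable_prod => j _; case: (boolP (j \in l)) => [jl|_]; last exact: measurable_cst.
    move=> _ A mA; have := mf j measurableT A mA; apply: smallest_sub.
      exact: smallest_sigma_algebra.
    by move=> E [k /= -> FE]; apply: sub_sigma_algebra; exists j.
  by apply/funext => o; rewrite big_seq [RHS]big_seq; apply: eq_bigr => j ->.
have E1 := integral_indep (mf' i) (mprod l) (group_indep indF KL (mf i) mg) mH (fun z => ltac:(by rewrite lee_fin mulr_ge0)).
have -> : (\int[P]_o (\prod_(j <- i :: l) f j o)%:E =
   \int[P]_o H (f i o, (\prod_(j <- l) f j o)%R))%E.
  by apply: eq_integral => o _; rewrite /H/= big_cons !ger0_norm.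
rewrite E1.
have E2 o : (\int[P]_o' H (f i o, (\prod_(j <- l) f j o')%R) =
    (f i o)%:E * \int[P]_o' (\prod_(j <- l) f j o')%:E)%E.
  rewrite -ge0_integralZl//; [|exact/measurable_EFinP|by move=> o' _; rewrite lee_fin|by rewrite lee_fin].
  by apply: eq_integral => o' _; rewrite /H/= !ger0_norm// EFinM.
under eq_integral => o _ do rewrite E2.
rewrite ge0_integralZr//; [|exact/measurable_EFinP|by move=> o _; rewrite lee_fin|by apply: integral_ge0 => o _; rewrite lee_fin].
rewrite exprS EFinM; apply: lee_pmul => //.
- by apply: integral_ge0 => o _; rewrite lee_fin.
- by apply: integral_ge0 => o _; rewrite lee_fin.
- exact: IH.
Qed.

Lemma union_bound d (O : measurableType d) (R : realType) (P : probability O R)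
    (I : eqType) (l : seq I) (A : I -> set O) (q : R) :
  (forall i, measurable (A i)) -> (forall i, (P (A i) <= q%:E)%E) ->
  measurable [set o | exists2 i, i \in l & A i o] /\
  (P [set o | exists2 i, i \in l & A i o] <= ((size l)%:R * q)%:E)%E.
Proof.
move=> mA Aq; elim: l => [|i l [m IH]].
  rewrite (_ : [set o | _] = set0); last by rewrite -subset0 => o [].
  by rewrite measure0 mul0r.
have -> : [set o | exists2 j, j \in i :: l & A j o] =
    A i `|` [set o | exists2 j, j \in l & A j o].
  rewrite eqEsubset; split => o.
    move=> [j]; rewrite in_cons => /orP[/eqP ->|jl] h; [by left|by right; exists j].
  by move=> [h|[j jl h]]; [exists i; rewrite ?mem_head|exists j; rewrite // in_cons jl orbT].
split; first exact: measurableU.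
apply: (le_trans (measureU2 _ _ _)) => //=.
by rewrite -natr1 mulrDl mul1r addrC EFinD; apply: leeD.
Qed.

Section trace_on_measurable_sets.
Context d (O : measurableType d) (R : realType) (P : probability O R).

(* Library measures are functions of all sets, constrained on measurable sets
   only. Vanishing on the other sets makes "[A] has positive mass" imply that
   [A] is measurable. *)
Definition measurable_trace (A : set O) : \bar R :=
  if pselect (measurable A) then P A else 0%E.

Let trace0 : measurable_trace set0 = 0%E.
Proof. by rewrite /measurable_trace; case: pselect => [?|//]; rewrite measure0. Qed.

Let trace_ge0 A : (0 <= measurable_trace A)%E.
Proof. by rewrite /measurable_trace; case: pselect => // mA; exact: measure_ge0. Qed.

Lemma measurable_traceE A : measurable A -> measurable_trace A = P A.
Proof. by move=> mA; rewrite /measurable_trace; case: pselect. Qed.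

Let trace_sigma_additive : semi_sigma_additive measurable_trace.
Proof.
move=> F mF tF mUF; rewrite measurable_traceE//.
rewrite (_ : (fun n => _) = (fun n => \sum_(0 <= i < n) P (F i))%E).
  exact: measure_semi_sigma_additive.
by apply/funext => n; apply: eq_bigr => i _; exact: measurable_traceE.
Qed.

Lemma measurable_traceP : exists P' : probability O R,
  (forall A, measurable A -> P' A = P A) /\
  (forall A, (0 < P' A)%E -> measurable A).
Proof.
pose m : {measure set O -> \bar R} := HB.pack measurable_trace
  (isMeasure.Build _ _ _ measurable_trace trace0 trace_ge0 trace_sigma_additive).
have m1 : m setT = 1%E by rewrite /m/= measurable_traceE// probability_setT.
pose P' : probability O R := HB.pack (m : set O -> \bar R)
  (Measure.class m) (Measure_isProbability.Build _ _ _ m m1).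
exists P'; split; first by move=> A mA; rewrite /P'/= measurable_traceE.
move=> A PA; apply: contrapT => nA; move: PA.
by rewrite /P'/= /measurable_trace; case: pselect => [//|?]; rewrite ltxx.
Qed.

End trace_on_measurable_sets.

(** The hypothesis bounds the mass of a set not known to be measurable. Its assumptions on [P]
    involve measurable events only, so it also applies to the trace of [P]. There the set has
    positive mass, hence is measurable, and [N] is its complement. *)
Lemma curvature_event (R : realType) (C Kx : R) (psi chi : R -> R)
    (alpha gamma Ct Lsp : R) :
  curvature_constants C Kx psi chi alpha gamma Ct Lsp ->
  forall (n d s sstar : nat) (bstar : 'rV[R]_d)
    (fx : probability (borelType 'rV[R]_d) R)
    (mu : {measure set (measurableTypeR R) -> \bar R})
    (h : R -> R) (c : R) (Lpsi r : R)
    dO (O : measurableType dO) (P : probability O R)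
    (D : 'I_n -> {RV P >-> borelType (record R d)}),
    (2 <= n <= d)%N -> (1 <= sstar)%N -> (sstar <= s <= d)%N ->
    (l0norm bstar <= sstar)%N -> l2norm bstar <= 1 ->
    condD C Kx fx -> glm_family mu h c psi ->
    glm_sample fx mu h c psi bstar D ->
    Lsp <= Lpsi -> 0 <= r ->
    Ct * (s + sstar)%:R * ln (expR 1 * d%:R) <= n%:R ->
  exists N : set O, [/\ measurable N, (P N <= (n%:R ^- 3)%:E)%E &
    forall w, ~ N w -> curvature_ok s sstar bstar psi chi Lpsi r alpha gamma (fun i => D i w)].
Proof.
move=> [_ _ H] n d s sstar bstar fx mu h c Lpsi r dO O P D nd s1 ssd cb b1 cD glm [iD lD] LL r0 nn.
have [P' [P'E P'm]] := measurable_traceP P.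
have mD i (B : set (borelType (record R d))) : measurable B -> measurable (D i @^-1` B).
  by move=> mB; rewrite -[X in measurable X]setTI; exact: measurable_funPT.
have sample' : glm_sample (P := P') fx mu h c psi bstar D.
  split.
    move=> A FA; have mA i : measurable (A i).
      by apply: (sigma_of_measurable _ (FA i)); exact: measurable_funPT.
    rewrite P'E; last by apply: fin_bigcap_measurable => [|i _]; [exact: finType_finite_set|exact: mA].
    by rewrite iD//; congr (_%:E); apply: eq_bigr => i _; rewrite P'E.
  move=> i B A mB mA; rewrite -(lD i)// P'E//; apply: mD.
  have := measurable_funPT (D i).
  have m1 : measurable ((fun z : borelType (record R d) => z.1) @^-1` B).
    by rewrite -[X in measurable X]setTI; exact: measurable_record_fst.
  have m2 : measurable ((fun z : borelType (record R d) => z.2 : borelType 'rV[R]_d) @^-1` A).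
    by rewrite -[X in measurable X]setTI; exact: measurable_record_snd.
  by move=> _; exact: measurableI.
have := H n d s sstar bstar fx mu h c Lpsi r dO O P' D nd s1 ssd cb b1 cD glm sample' LL r0 nn.
set A := [set w | _] => PA.
have n2 : 2 <= n%:R :> R by rewrite ler_nat; case/andP: nd.
have n0 : 0 < n%:R :> R by lra.
have n3 : n%:R ^- 3 < 1 :> R.
  rewrite invf_lt1 ?exprn_gt0// exprn_egt1//; lra.
have mA : measurable A.
  apply: P'm; apply: lt_le_trans PA; rewrite lte_fin; lra.
exists (~` A); split; first exact: measurableC.
- rewrite P'E// in PA; rewrite probability_setC//.
  have fA : P A = (fine (P A))%:E by rewrite fineK// fin_num_measure.
  rewrite fA -EFinB lee_fin; rewrite fA lee_fin in PA; lra.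
- by move=> w /contrapT.
Qed.

Lemma measurable_tail d (O : measurableType d) (R : realType) (X : O -> R) (u : R) :
  measurable_fun setT X -> measurable [set o | u <= `|X o|].
Proof.
move=> mX; rewrite (_ : [set o | _] = (fun o => `|X o|) @^-1` [set` `[u, +oo[]).
  rewrite -[X in measurable X]setTI.
  exact: (measurableT_comp (@normr_measurable R setT) mX).
by apply/seteqP; split => o /=; rewrite in_itv/= andbT.
Qed.

Lemma measurable_strict_tail d (O : measurableType d) (R : realType) (X : O -> R) (u : R) :
  measurable_fun setT X -> measurable [set o | u < `|X o|].
Proof.
move=> mX; rewrite (_ : [set o | _] = (fun o => `|X o|) @^-1` [set` `]u, +oo[]).
  rewrite -[X in measurable X]setTI.
  exact: (measurableT_comp (@normr_measurable R setT) mX).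
by apply/seteqP; split => o /=; rewrite in_itv/= andbT.
Qed.

Lemma measurable_fun_coord (R : realType) (d : nat) (j : 'I_d) :
  measurable_fun setT (fun x : borelType 'rV[R]_d => x 0 j).
Proof.
exact: (measurable_coord (f := fun x : borelType 'rV[R]_d => x) j (@measurable_id _ _ setT)).
Qed.

Lemma chernoff_abs d (O : measurableType d) (R : realType) (P : probability O R)
    (X : O -> R) (l u B : R) :
  measurable_fun setT X -> 0 < l ->
  (\int[P]_o (expR (l * X o))%:E <= B%:E)%E ->
  (\int[P]_o (expR (- l * X o))%:E <= B%:E)%E ->
  (P [set o | (u <= `|X o|)%R] <= (2 * (expR (- (l * u)) * B))%:E)%E.
Proof.
move=> mX l0 h1 h2.
have mlX a : measurable_fun setT (fun o => a * X o) by exact: measurable_funM.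
have c1 := chernoff (l * u) (mlX l) h1.
have c2 := chernoff (l * u) (mlX (- l)) h2.
have E : [set o | u <= `|X o|] = [set o | l * u <= l * X o] `|` [set o | l * u <= - l * X o].
  apply/seteqP; split => o /=.
    by rewrite ler_normr mulNr -mulrN !(ler_pM2l l0) => /orP.
  by rewrite mulNr -mulrN !(ler_pM2l l0) ler_normr => h; apply/orP.
have mset a : measurable [set o | l * u <= a * X o].
  rewrite (_ : [set o | _] = (fun o => a * X o) @^-1` [set` `[l * u, +oo[]).
    by rewrite -[X in measurable X]setTI; exact: mlX.
  by apply/seteqP; split => o /=; rewrite in_itv/= andbT.
rewrite E; apply: (le_trans (measureU2 _ _ _)) => //.
rewrite mulrDl mul1r EFinD EFinM; exact: leeD.
Qed.

(** * Consequences of the covariate condition *)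

Section covariate.
Context (R : realType) (d : nat) (fx : probability (borelType 'rV[R]_d) R) (C Kx : R).
Hypothesis cD : condD C Kx fx.

Let mdot (u : 'rV[R]_d) : measurable_fun setT (fun x : borelType 'rV[R]_d => dot u x).
Proof.
rewrite (_ : (fun x : borelType 'rV[R]_d => dot u x) = (fun x : borelType 'rV[R]_d => dot x u)).
  exact: measurable_dot.
by apply/funext => x; rewrite dotC.
Qed.

Lemma l2norm_delta (j : 'I_d) : l2norm (delta_mx 0 j : 'rV[R]_d) = 1.
Proof. by rewrite /l2norm dot_delta mxE !eqxx sqrtr1. Qed.

Let psi2_coord j : (psi2_norm fx (fun x : borelType 'rV[R]_d => dot (delta_mx 0 j)%R x) <= Kx%:E)%E.
Proof. by case: cD => _ /(_ (delta_mx 0 j)) + _ _ _; rewrite l2norm_delta mulr1. Qed.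

(* A nonpositive [Kx] would force [E x_j^2 <= expR (t ^+ 2) - 1] for all small
   [t], against the lower bound on the second moments. *)
Lemma subgaussian_constant_gt0 : (0 < d)%N -> 0 < Kx.
Proof.
case: d fx cD mdot psi2_coord => // d' f cDf md pc _.
case: (cDf) => _ _ _ C0 low.
rewrite ltNge; apply/negP => Kx0.
pose j : 'I_d'.+1 := ord0.
pose m := fine ('E_f[fun x : 'rV[R]_d'.+1 => (x 0 j * x 0 j)%R])%E.
have Cm : C^-1 <= m.
  have := low (delta_mx 0 j).
  rewrite -rowE trmx_delta -colE !mxE eqxx mulr1n => h.
  by rewrite /m -subr_ge0.
(* Chosen so that [q <= 1] and [expR q < 1 + C^-1]; the exponential moment at scale [sqrt q] gives
   [1 + m <= expR q], against [C^-1 <= m]. *)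
pose q := Num.min 1 (ln (1 + C^-1) / 2).
have ic : 0 < C^-1 by rewrite invr_gt0.
have l1 : 0 < ln (1 + C^-1) by rewrite ln_gt0//; lra.
have q0 : 0 < q by rewrite /q lt_min ltr01 divr_gt0.
have t0 : 0 < Num.sqrt q by rewrite sqrtr_gt0.
have tt : Num.sqrt q ^+ 2 = q by rewrite sqr_sqrtr// ltW.
have q1 : q <= 1 by rewrite /q ge_min lexx.
have a1 : 1 * Num.sqrt q ^+ 2 <= 1 by rewrite tt mul1r.
have := subgaussian_sqr_mgf (md (delta_mx 0 j)) (pc j) (le_lt_trans Kx0 t0) t0 ler01 a1.
rewrite tt mul1r.
under eq_integral => x _ do rewrite dotC dot_delta mul1r.
move=> h.
have mc : measurable_fun setT (fun x : borelType 'rV[R]_d'.+1 => x 0 j) by exact: measurable_fun_coord.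
have mc2 : measurable_fun setT (fun x : borelType 'rV[R]_d'.+1 => x 0 j ^+ 2).
  exact: measurable_funX.
have h2 : (1 + \int[f]_x (x 0 j ^+ 2)%:E <= (expR q)%:E)%E.
  apply: le_trans h.
  have -> : (1 + \int[f]_x (x 0 j ^+ 2)%:E = \int[f]_x (1 + x 0 j ^+ 2)%:E)%E.
    under [RHS]eq_integral => x _ do rewrite EFinD.
    rewrite ge0_integralD//; last 2 first.
    - by move=> x _; rewrite lee_fin sqr_ge0.
    - exact/measurable_EFinP.
    by rewrite integral_cst//= probability_setT mule1.
  apply: ge0_le_integral => //.
  - by move=> x _; rewrite lee_fin; have := sqr_ge0 (x 0 j); lra.
  - by apply/measurable_EFinP; apply: measurable_funD.
  - by apply/measurable_EFinP; exact: measurableT_comp (@measurable_expR R) mc2.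
  by move=> x _; rewrite lee_fin expR_ge1Dx.
have i0 : (0 <= \int[f]_x (x 0 j ^+ 2)%:E)%E by apply: integral_ge0 => x _; rewrite lee_fin sqr_ge0.
have fi : (\int[f]_x (x 0 j ^+ 2)%:E)%E \is a fin_num.
  rewrite ge0_fin_numE//; apply: (@le_lt_trans _ _ (1 + \int[f]_x (x 0 j ^+ 2)%:E)%E).
    by rewrite leeDr.
  exact: le_lt_trans h2 (ltry _).
have mE : (m%:E = \int[f]_x (x 0 j ^+ 2)%:E)%E.
  rewrite /m unlock; under eq_integral => x _ do rewrite -expr2.
  by rewrite fineK.
rewrite -mE -EFinD lee_fin in h2.
have : expR q < 1 + C^-1.
  rewrite -[ltRHS]lnK ?posrE; last lra.
  rewrite ltr_expR; apply: (@le_lt_trans _ _ (ln (1 + C^-1) / 2)); last lra.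
  by rewrite /q ge_min lexx orbT.
lra.
Qed.

(** The scale [2 * Kx] lies strictly above [Kx], as the infimum in the Orlicz norm requires; it is
    kept throughout. *)
Lemma coord_tail (j : 'I_d) (s : R) : 0 < Kx -> 0 <= s ->
  (fx [set x : 'rV[R]_d | (s * (2 * Kx) <= `|x 0 j|)%R] <= (2 * expR (- s ^+ 2))%:E)%E.
Proof.
move=> K0 s0; have Kt : Kx < 2 * Kx by lra.
have t0 : 0 < 2 * Kx by lra.
have := subgaussian_tail (mdot (delta_mx 0 j)) (psi2_coord j) Kt t0 s0.
rewrite (_ : [set x : 'rV[R]_d | _] = [set w : borelType 'rV[R]_d | s * (2 * Kx) <= `|dot (delta_mx 0 j) w|])//.
by apply/seteqP; split => x /=; rewrite dotC dot_delta.
Qed.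

Lemma linear_tail (b : 'rV[R]_d) (s : R) : 0 < Kx -> 0 <= s -> l2norm b <= 1 ->
  (fx [set x : 'rV[R]_d | (s * (2 * Kx) <= `|dot x b|)%R] <= (2 * expR (- s ^+ 2))%:E)%E.
Proof.
move=> K0 s0 b1; have Kt : Kx < 2 * Kx by lra.
have t0 : 0 < 2 * Kx by lra.
have pb : (psi2_norm fx (fun x : borelType 'rV[R]_d => dot b x) <= Kx%:E)%E.
  case: cD => _ /(_ b) h _ _ _; apply: (le_trans h).
  by rewrite lee_fin ler_piMr// ltW.
have := subgaussian_tail (mdot b) pb Kt t0 s0.
rewrite (_ : [set x : 'rV[R]_d | _] = [set w : borelType 'rV[R]_d | s * (2 * Kx) <= `|dot b w|])//.
by apply/seteqP; split => x /=; rewrite dotC.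
Qed.

Lemma coord_sqr_mgf (j : 'I_d) (a : R) : 0 < Kx -> 0 <= a -> a * (2 * Kx) ^+ 2 <= 1 ->
  (\int[fx]_x (expR (a * x 0 j ^+ 2))%:E <= (expR (a * (2 * Kx) ^+ 2))%:E)%E.
Proof.
move=> K0 a0 a1; have Kt : Kx < 2 * Kx by lra.
have t0 : 0 < 2 * Kx by lra.
have := subgaussian_sqr_mgf (mdot (delta_mx 0 j)) (psi2_coord j) Kt t0 a0 a1.
by under eq_integral => x _ do rewrite dotC dot_delta.
Qed.
End covariate.

Section residual.
Context (R : realType) (d : nat) (fx : probability (borelType 'rV[R]_d) R).
Context (mu : {measure set (measurableTypeR R) -> \bar R}).
Context (h : R -> R) (c c2 c3 C Kx : R) (psi : R -> R) (bstar : 'rV[R]_d).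
Context dO (O : measurableType dO) (P : probability O R).
Context (Z : {RV P >-> borelType (record R d)}).
Hypothesis glm : glm_family mu h c psi.
Hypothesis gpsi : condG c2 c3 psi.
Hypothesis law : forall (B : set R) (A : set 'rV[R]_d),
    measurable B -> <<s open >> A ->
    P (Z @^-1` (B `*` A)) =
    (\int[fx]_(x in A)
       \int[mu]_(y in B) (glm_density h c psi (dot x bstar) y)%:E)%E.

Definition residual (z : record R d) : R := z.1 - derive1 psi (dot z.2 bstar).

Let dpsi_measurable : measurable_fun setT (derive1 psi).
Proof.
apply: continuous_measurable_fun; apply: is_derive_continuous => t.
exact: dpsi_is_derive gpsi t.
Qed.

Lemma measurable_residual : measurable_fun setT (residual : borelType (record R d) -> R).
Proof.
apply: measurable_funB; first exact: measurable_record_fst.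
apply: (measurableT_comp dpsi_measurable).
exact: (measurableT_comp (measurable_dot bstar) (@measurable_record_snd R d)).
Qed.

Let c0 : 0 < c. Proof. by case: glm. Qed.
Let c20 : 0 < c2. Proof. exact: c2_gt0 gpsi. Qed.

Lemma residual_tail (u : R) : 0 < u ->
  (P [set o | (u <= `|residual (Z o)|)%R] <= (2 * expR (- (u ^+ 2 / (2 * c * c2))))%:E)%E.
Proof.
move=> u0; pose l := u / (c * c2).
have cc : 0 < c * c2 by rewrite mulr_gt0.
have l0 : 0 < l by rewrite divr_gt0.
have B0 (a : R) : a ^+ 2 = l ^+ 2 ->
    (\int[P]_o (expR (a * residual (Z o)))%:E <= (expR (u ^+ 2 / (2 * c * c2)))%:E)%E.
  move=> al; have := glm_residual_mgf glm gpsi law a (@measurable_cst _ _ _ _ setT (1 : R)).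
  under eq_integral => o _ do rewrite mulr1.
  move=> hh; apply: (le_trans hh).
  under eq_integral => x _ do rewrite /cst expr1n mulr1 al.
  rewrite integral_cst//= probability_setT mule1 lee_fin ler_expR /l.
  rewrite le_eqVlt; apply/orP; left; apply/eqP; field.
  by rewrite !gt_eqF.
have mX : measurable_fun setT (fun o => residual (Z o)).
  exact: (measurableT_comp measurable_residual (measurable_funPT Z)).
apply: (le_trans (chernoff_abs u mX l0 (B0 l erefl) (B0 (- l) (sqrrN l)))).
rewrite -expRD lee_fin ler_pM2l// ler_expR le_eqVlt; apply/orP; left; apply/eqP.
by rewrite /l; field; rewrite !gt_eqF.
Qed.

Lemma residual_coord_mgf (j : 'I_d) (l : R) : condD C Kx fx -> 0 < Kx ->
  c * c2 * (2 * Kx) ^+ 2 * l ^+ 2 / 2 <= 1 ->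
  (\int[P]_o (expR (l * (residual (Z o) * (Z o).2 0 j)))%:E <=
   (expR (c * c2 * (2 * Kx) ^+ 2 * l ^+ 2 / 2))%:E)%E.
Proof.
move=> cD K0 l1.
apply: (le_trans (glm_residual_mgf glm gpsi law l (measurable_fun_coord j))).
have a0 : 0 <= c * c2 * l ^+ 2 / 2 by apply: divr_ge0 => //; apply: mulr_ge0 (sqr_ge0 _); rewrite ltW// mulr_gt0.
have a1 : c * c2 * l ^+ 2 / 2 * (2 * Kx) ^+ 2 <= 1 by lra.
have := coord_sqr_mgf cD j K0 a0 a1.
rewrite (_ : c * c2 * l ^+ 2 / 2 * (2 * Kx) ^+ 2 = c * c2 * (2 * Kx) ^+ 2 * l ^+ 2 / 2); last by lra.
apply: le_trans; rewrite le_eqVlt; apply/orP; left; apply/eqP.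
by apply: eq_integral => x _; congr (expR _)%:E; lra.
Qed.

Lemma marginal_event (A : set 'rV[R]_d) (q : R) :
  <<s open >> A -> (fx A <= q%:E)%E -> (P [set o | A (Z o).2] <= q%:E)%E.
Proof.
move=> mA; rewrite -(glm_marginal glm law mA).
by rewrite (_ : [set o | _] = Z @^-1` (setT `*` A))//; apply/seteqP; split => o //= [].
Qed.

End residual.

Lemma expR_negln (R : realType) (k : nat) (x : R) : 0 < x ->
  expR (- (k%:R * ln x)) = x ^- k.
Proof. by move=> x0; rewrite expRN expRM_natl lnK. Qed.

Lemma union_bound_finType d (O : measurableType d) (R : realType)
    (P : probability O R) (I : finType) (A : I -> set O) (q : R) :
  (forall i, measurable (A i)) -> (forall i, (P (A i) <= q%:E)%E) ->
  measurable (\bigcup_(i in setT) A i) /\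
  (P (\bigcup_(i in setT) A i) <= (#|I|%:R * q)%:E)%E.
Proof.
move=> mA Aq; have := union_bound (enum I) mA Aq.
rewrite (_ : [set o | _] = \bigcup_(i in setT) A i) -?cardE//.
by apply/seteqP; split => o /= [i]; exists i => //; rewrite mem_enum.
Qed.

Lemma indep_family_sigma d (O : measurableType d) (R : realType)
    (P : probability O R) (I : finType) d' (T : measurableType d')
    (X : I -> {RV P >-> T}) :
  independent_sigma P (fun i => sigma_of (X i)) ->
  indep_family P (fun i => sigma_of (X i)).
Proof.
move=> iX; split => // i.
- by apply: sigma_of_measurable; exact: measurable_funPT.
- exact: sigma_ofI.
- exact: sigma_ofT.
Qed.

(** * Concentration over the sample *)

Section sample.
Context (R : realType) (n d : nat) (fx : probability (borelType 'rV[R]_d) R).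
Context (mu : {measure set (measurableTypeR R) -> \bar R}).
Context (h : R -> R) (c c2 c3 C Kx : R) (psi : R -> R) (bstar : 'rV[R]_d).
Context dO (O : measurableType dO) (P : probability O R).
Context (D : 'I_n -> {RV P >-> borelType (record R d)}).
Hypothesis glm : glm_family mu h c psi.
Hypothesis gpsi : condG c2 c3 psi.
Hypothesis sample : glm_sample fx mu h c psi bstar D.
Hypothesis cD : condD C Kx fx.
Hypothesis K0 : 0 < Kx.
Hypothesis n0 : (0 < n)%N.

Let law i := sample.2 i.
Let c0 : 0 < c. Proof. by case: glm. Qed.
Let c20 : 0 < c2. Proof. exact: c2_gt0 gpsi. Qed.
Local Notation resid := (residual psi bstar).
Let V := c * c2 * (2 * Kx) ^+ 2.
Let V0 : 0 < V. Proof. by rewrite mulr_gt0 ?exprn_gt0 ?mulr_gt0. Qed.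
Let nR0 : 0 < n%:R :> R. Proof. by rewrite ltr0n. Qed.

Let mterm (j : 'I_d) : measurable_fun setT
  (fun z : borelType (record R d) => resid z * z.2 0 j).
Proof.
apply: measurable_funM; first exact: (measurable_residual _ gpsi).
exact: (measurableT_comp (measurable_fun_coord j) (@measurable_record_snd R d)).
Qed.

(** [l = u / (n * V)] minimizes the Chernoff exponent. The summands, products of a residual and a
    coordinate, are only sub-exponential: the bound on [u] keeps [l] in the range where their moment
    generating function is controlled. *)
Lemma score_tail (j : 'I_d) (u : R) : 0 < u -> u ^+ 2 <= 2 * n%:R ^+ 2 * V ->
  (P [set o | (u <= `|\sum_i resid (D i o) * (D i o).2 0 j|)%R] <=
   (2 * expR (- (u ^+ 2 / (2 * n%:R * V))))%:E)%E.
Proof.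
move=> u0 uV; pose l := u / (n%:R * V).
have l0 : 0 < l by rewrite divr_gt0// mulr_gt0.
have lV : V * l ^+ 2 / 2 = u ^+ 2 / (2 * n%:R ^+ 2 * V).
  by rewrite /l; field; rewrite !gt_eqF.
have l1 : V * l ^+ 2 / 2 <= 1.
  by rewrite lV ler_pdivrMr ?mul1r// mulr_gt0// mulr_gt0// exprn_gt0.
have mX i : measurable_fun setT (fun o => resid (D i o) * (D i o).2 0 j).
  exact: (measurableT_comp (mterm j) (measurable_funPT (D i))).
have B0 (a : R) : a ^+ 2 = l ^+ 2 ->
   (\int[P]_o (expR (a * \sum_i resid (D i o) * (D i o).2 0 j))%:E <=
    (expR (V * l ^+ 2 / 2) ^+ n)%:E)%E.
  move=> al.
  rewrite -[X in _ ^+ X](size_enum_ord n).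
  under eq_integral => o _ do rewrite mulr_sumr -big_enum expR_sum.
  apply: (integral_prod_indep (F := fun i => sigma_of (D i))
    (f := fun i o => expR (a * (resid (D i o) * (D i o).2 0 j)))).
  - exact: indep_family_sigma sample.1.
  - exact: enum_uniq.
  - move=> i.
    have mg : measurable_fun setT (fun z : borelType (record R d) => expR (a * (resid z * z.2 0 j))).
      apply: (measurableT_comp (@measurable_expR R)).
      by apply: measurable_funM => //; exact: mterm.
    apply: (measurableT_comp mg).
    by apply: (groupType_measurable_coord (i := i)).
  - by move=> i o; exact: expR_ge0.
  - exact: expR_ge0.
  - move=> i; have a1 : c * c2 * (2 * Kx) ^+ 2 * a ^+ 2 / 2 <= 1 by rewrite al.
    have := residual_coord_mgf glm gpsi (law i) j cD K0 a1.
    by rewrite al.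
have mS : measurable_fun setT (fun o => \sum_i resid (D i o) * (D i o).2 0 j).
  by apply: measurable_sum.
apply: (le_trans (chernoff_abs u mS l0 (B0 l erefl) (B0 (- l) (sqrrN l)))).
rewrite -expRM_natl -expRD lee_fin ler_pM2l// ler_expR le_eqVlt.
by apply/orP; left; apply/eqP; rewrite /l; field; rewrite !gt_eqF.
Qed.

Hypothesis nd : (2 <= n <= d)%N.
Context (Cx Cpsi CR : R).
Hypothesis hCx : 6 <= Cx.
Hypothesis hCpsi : 4 <= Cpsi.
Hypothesis hCR : 0 < CR.
Hypothesis hCR2 : 8 * c2 <= CR ^+ 2.
Hypothesis b1 : l2norm bstar <= 1.
Hypothesis n4 : 4 * ln d%:R <= n%:R :> R.

Let dn : (n%:R : R) <= d%:R. Proof. by rewrite ler_nat; case/andP: nd. Qed.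
Let n2 : 2 <= n%:R :> R. Proof. by rewrite ler_nat; case/andP: nd. Qed.
Let d0 : 0 < d%:R :> R. Proof. by have := dn; have := n2; lra. Qed.
Let lnn0 : 0 < ln n%:R :> R. Proof. by rewrite ln_gt0//; have := n2; lra. Qed.
Let lnd0 : 0 < ln d%:R :> R. Proof. by rewrite ln_gt0//; have := n2; have := dn; lra. Qed.
Let lned : ln (expR 1 * d%:R) = 1 + ln d%:R :> R.
Proof. by rewrite lnM ?posrE ?expR_gt0// expRK. Qed.
Let dVn k : d%:R ^- k <= n%:R ^- k :> R.
Proof.
rewrite lef_pV2 ?posrE ?exprn_gt0//; apply: lerXn2r => //; rewrite nnegrE ltW//.
Qed.

Let Lx := Cx * Kx * Num.sqrt (ln (expR 1 * d%:R)).
Let Lb := Cpsi * Kx * Num.sqrt (ln n%:R).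
Let Lr := CR * Num.sqrt (c * ln n%:R).
Let G0 := Num.sqrt (8 * V * ln d%:R / n%:R).

(* [V] is the variance proxy of the summands of the score; the level [G0] makes
   the tail of each of its [d] coordinates at most [2 d^-4]. *)
Lemma sample_event : exists N : set O, [/\ measurable N,
   (P N <= (8 * n%:R ^- 3)%:E)%E &
   forall o, ~ N o -> [/\ forall i j, `|(D i o).2 0 j| <= Lx,
     forall i, `|dot (D i o).2 bstar| <= Lb,
     forall i, `|resid (D i o)| <= Lr &
     forall j, `|\sum_i resid (D i o) * (D i o).2 0 j| <= n%:R * G0]].
Proof.
have mx i (j : 'I_d) : measurable_fun setT (fun o => (D i o).2 0 j).
  exact: (measurableT_comp (measurableT_comp (measurable_fun_coord j) (@measurable_record_snd R d)) (measurable_funPT (D i))).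
have mb i : measurable_fun setT (fun o => dot (D i o).2 bstar).
  exact: (measurableT_comp (measurableT_comp (measurable_dot bstar) (@measurable_record_snd R d)) (measurable_funPT (D i))).
have mr i : measurable_fun setT (fun o => resid (D i o)).
  exact: (measurableT_comp (measurable_residual _ gpsi) (measurable_funPT (D i))).
have borel_tail (f : borelType 'rV[R]_d -> R) (u : R) : measurable_fun setT f ->
    <<s open >> [set x : 'rV[R]_d | u <= `|f x|].
  by move=> mf; exact: (measurable_tail u mf).
have K20 : 0 < 2 * Kx by rewrite mulr_gt0.
(* [Cx >= 6] gives the exponent at least [9 * (1 + ln d)], ample for [d ^- 5], which pays for the
   [n * d] entries. *)
have [m1 p1] := union_bound_finType (I := ('I_n * 'I_d)%type)
  (A := fun k => [set o | Lx <= `|(D k.1 o).2 0 k.2|]) (q := 2 * d%:R ^- 5)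
  (fun k => measurable_tail Lx (mx k.1 k.2)) ltac:(
  move=> [i j] /=;
  apply: (marginal_event glm (law i) (A := [set x : 'rV[R]_d | Lx <= `|x 0 j|]));
  [exact: borel_tail (measurable_fun_coord j)|];
  have s0 : 0 <= Cx / 2 * Num.sqrt (ln (expR 1 * d%:R)) by
    [apply: mulr_ge0; [have := hCx; lra|exact: sqrtr_ge0]];
  have := coord_tail cD j K0 s0;
  rewrite (_ : Cx / 2 * Num.sqrt (ln (expR 1 * d%:R)) * (2 * Kx) = Lx); [|by rewrite /Lx; field];
  move=> hh; apply: (le_trans hh); rewrite lee_fin ler_pM2l//;
  rewrite exprMn sqr_sqrtr ?lned; [|have := lnd0; lra];
  rewrite -expR_negln// ler_expR lerN2;
  have : 9 <= (Cx / 2) ^+ 2 by [have : 3 <= Cx / 2; [have := hCx; lra|nra]];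
  have := lnd0; nra).
(* [Cpsi >= 4] gives the exponent at least [4 * ln n], which pays for [n] records. *)
have [m2 p2] := union_bound_finType (A := fun i => [set o | Lb <= `|dot (D i o).2 bstar|])
  (q := 2 * n%:R ^- 4) (fun i => measurable_tail Lb (mb i)) ltac:(
  move=> i /=;
  apply: (marginal_event glm (law i) (A := [set x : 'rV[R]_d | Lb <= `|dot x bstar|]));
  [exact: borel_tail (measurable_dot bstar)|];
  have s0 : 0 <= Cpsi / 2 * Num.sqrt (ln n%:R) by
    [apply: mulr_ge0; [have := hCpsi; lra|exact: sqrtr_ge0]];
  have := linear_tail cD K0 s0 b1;
  rewrite (_ : Cpsi / 2 * Num.sqrt (ln n%:R) * (2 * Kx) = Lb); [|by rewrite /Lb; field];
  move=> hh; apply: (le_trans hh); rewrite lee_fin ler_pM2l//;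
  rewrite exprMn sqr_sqrtr; [|have := lnn0; lra];
  rewrite -expR_negln// ler_expR lerN2;
  have : 4 <= (Cpsi / 2) ^+ 2 by [have : 2 <= Cpsi / 2; [have := hCpsi; lra|nra]];
  have := lnn0; nra).
have Lr0 : 0 < Lr by rewrite mulr_gt0// sqrtr_gt0 mulr_gt0.
(* [CR ^+ 2 >= 8 * c2] makes [Lr ^+ 2 / (2 * c * c2)] at least [4 * ln n]. *)
have [m3 p3] := union_bound_finType (A := fun i => [set o | Lr <= `|resid (D i o)|])
  (q := 2 * n%:R ^- 4) (fun i => measurable_tail Lr (mr i)) ltac:(
  move=> i /=; apply: (le_trans (residual_tail glm gpsi (law i) Lr0));
  rewrite lee_fin ler_pM2l//;
  rewrite -expR_negln// ler_expR lerN2;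
  rewrite /Lr exprMn sqr_sqrtr ?mulr_ge0 ?(ltW c0) ?(ltW lnn0)//;
  rewrite ler_pdivlMr ?mulr_gt0//;
  have : 0 < c * ln n%:R by [rewrite mulr_gt0];
  have := hCR2; nra).
have G00 : 0 < n%:R * G0 by rewrite mulr_gt0// sqrtr_gt0 divr_gt0// !mulr_gt0.
have G2 : (n%:R * G0) ^+ 2 = 8 * V * ln d%:R * n%:R.
  rewrite exprMn sqr_sqrtr; last by rewrite ltW// divr_gt0// !mulr_gt0.
  by field; rewrite gt_eqF.
(* The condition [4 * ln d <= n] says exactly that the level [n * G0] is within the range of
   [score_tail]. *)
have [m4 p4] := union_bound_finType
  (A := fun j => [set o | n%:R * G0 <= `|\sum_i resid (D i o) * (D i o).2 0 j|])
  (q := 2 * d%:R ^- 4) (fun j => measurable_tail (n%:R * G0)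
     (measurable_sum _ (fun i => measurable_funM (mr i) (mx i j)))) ltac:(
  move=> j /=; apply: (le_trans (score_tail j G00 _));
  [rewrite G2; have : 0 < n%:R * V by [rewrite mulr_gt0]; have := n4; nra|];
  rewrite lee_fin ler_pM2l// G2 -expR_negln// ler_expR lerN2;
  rewrite ler_pdivlMr ?mulr_gt0//; have := V0; nra).
set N1 := \bigcup_(i in setT) _ in m1 p1.
set N2 := \bigcup_(i in setT) _ in m2 p2.
set N3 := \bigcup_(i in setT) _ in m3 p3.
set N4 := \bigcup_(i in setT) _ in m4 p4.
exists (N1 `|` N2 `|` N3 `|` N4); split.
- by do 3 apply: measurableU => //.
- apply: (@le_trans _ _ (P N1 + P N2 + P N3 + P N4)%E).
    apply: (le_trans (measureU2 _ _ _)) => //; first by do 2 apply: measurableU => //.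
    apply: leeD => //; apply: (le_trans (measureU2 _ _ _)) => //; first by apply: measurableU.
    by apply: leeD => //; apply: (le_trans (measureU2 _ _ _)).
  apply: (le_trans (leeD (leeD (leeD p1 p2) p3) p4)).
  rewrite -!EFinD lee_fin card_prod !card_ord natrM.
  have E4 (x : R) : 0 < x -> x * x ^- 4 = x ^- 3.
    by move=> x0; field; rewrite gt_eqF.
  have E5 : d%:R * d%:R * (d%:R ^- 5) = d%:R ^- 3 :> R.
    by field; rewrite gt_eqF.
  have i5 : 0 < d%:R ^- 5 :> R by rewrite invr_gt0 exprn_gt0.
  have q1 : n%:R * d%:R * (2 * d%:R ^- 5) <= 2 * n%:R ^- 3 :> R.
    apply: (@le_trans _ _ (2 * (d%:R * d%:R * d%:R ^- 5))); last by rewrite E5 ler_pM2l.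
    have : n%:R * d%:R <= d%:R * d%:R :> R by rewrite ler_pM2r.
    nra.
  have q2 := E4 _ nR0; have q4 := E4 _ d0; have q5 := dVn 3.
  lra.
- move=> o No; split => [i j|i|i|j]; rewrite leNgt; apply/negP => /ltW hh; apply: No.
  + by left; left; left; exists (i, j).
  + by left; left; right; exists i.
  + by left; right; exists i.
  + by right; exists j.
Qed.

End sample.

(** * The algorithm as a measurable and private map *)

Lemma noise_event dO (O : measurableType dO) (R : realType) (P : probability O R)
    (T s d : nat) (w : 'I_T -> 'I_s -> 'I_d -> {RV P >-> R})
    (w' : 'I_T -> 'I_d -> {RV P >-> R}) (b t : R) :
  0 < b -> 0 <= t ->
  (forall i k j, has_laplace_law b (w i k j)) ->
  (forall i j, has_laplace_law b (w' i j)) ->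
  exists N : set O, [/\ measurable N,
    (P N <= ((T * s.+1 * d)%:R * (2 * expR (- t)))%:E)%E &
    forall o, ~ N o -> (forall i k j, `|w i k j o| <= t * b) /\
      (forall i j, `|w' i j o| <= t * b)].
Proof.
move=> b0 t0 lw lw'.
have [m1 p1] := union_bound_finType (I := ('I_T * 'I_s * 'I_d)%type)
  (A := fun k => [set o | t * b < `|w k.1.1 k.1.2 k.2 o|])
  (fun k => measurable_strict_tail (t * b) (measurable_funPT (w k.1.1 k.1.2 k.2)))
  (fun k => laplace_tail b0 t0 (lw k.1.1 k.1.2 k.2)).
have [m2 p2] := union_bound_finType (I := ('I_T * 'I_d)%type)
  (A := fun k => [set o | t * b < `|w' k.1 k.2 o|])
  (fun k => measurable_strict_tail (t * b) (measurable_funPT (w' k.1 k.2)))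
  (fun k => laplace_tail b0 t0 (lw' k.1 k.2)).
set N1 := \bigcup_(i in setT) _ in m1 p1.
set N2 := \bigcup_(i in setT) _ in m2 p2.
exists (N1 `|` N2); split; first exact: measurableU.
- apply: (le_trans (measureU2 _ _ _)) => //; apply: (le_trans (leeD p1 p2)).
  rewrite -EFinD lee_fin -mulrDl !card_prod !card_ord -natrD.
  rewrite (_ : (T * s * d + T * d)%N = (T * s.+1 * d)%N)//.
  by rewrite mulnS mulnDl addnC.
- move=> o No; split => [i k j|i j]; rewrite leNgt; apply/negP => hh; apply: No.
  + by left; exists (i, k, j).
  + by right; exists (i, j).
Qed.

Lemma trunc_bound (R : realType) (L x : R) : 0 <= L -> `|trunc L x| <= L.
Proof.
move=> L0; rewrite /trunc ler_norml le_max lexx/= ge_max ge_min lexx/= andbT.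
by lra.
Qed.

Lemma trunc_id (R : realType) (L x : R) : `|x| <= L -> trunc L x = x.
Proof.
rewrite ler_norml => /andP[h1 h2].
by rewrite /trunc (min_idPr h2) (max_idPr h1).
Qed.

Lemma clipE (R : realType) (d : nat) (L : R) (x : 'rV[R]_d) j : 0 <= L ->
  clip L x 0 j = trunc L (x 0 j).
Proof.
move=> L0; rewrite /clip mxE; set z := x 0 j.
have [zL|Lz] := leP `|z| L; first by rewrite -numEsg trunc_id.
case: (ltgtP z 0) => z0.
- rewrite ltr0_norm// in Lz; rewrite ltr0_sg// mulN1r /trunc.
  by rewrite (@min_idPr _ _ L z _) ?(@max_idPl _ _ (- L) z _)//; lra.
- rewrite gtr0_norm// in Lz; rewrite gtr0_sg// mul1r /trunc.
  by rewrite (@min_idPl _ _ L z _) ?(@max_idPr _ _ (- L) L _)//; lra.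
- by rewrite z0 normr0 in Lz; lra.
Qed.

Lemma clip_id (R : realType) (d : nat) (L : R) (x : 'rV[R]_d) :
  (forall j, `|x 0 j| <= L) -> clip L x = x.
Proof.
move=> h; apply/rowP => j; have L0 := le_trans (normr_ge0 _) (h j).
by rewrite clipE// trunc_id.
Qed.

Lemma measurable_trunc (R : realType) (L : R) : measurable_fun setT (trunc L).
Proof.
by apply: measurable_maxr => //; apply: measurable_minr => //.
Qed.

Section step.
Context (R : realType) (n d : nat) (psiL dpsiL : R -> R) (Lx r eta : R).
Hypothesis Hpsi : forall t : R, is_derive t 1 psiL (dpsiL t).
Hypothesis mdpsi : measurable_fun setT dpsiL.
Hypothesis Lx0 : 0 <= Lx.

Definition private_step (Z : 'I_n -> record R d) (b : 'rV[R]_d) : 'rV[R]_d :=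
  b - eta *: grad (glm_loss psiL r (clip_data Lx Z)) b.

Lemma private_stepE Z b k : private_step Z b 0 k = b 0 k - eta * (n%:R^-1 *
  \sum_i (dpsiL (dot (clip Lx (Z i).2) b) - trunc r (Z i).1) * clip Lx (Z i).2 0 k).
Proof. by rewrite /private_step (grad_glm_loss _ _ Hpsi) 4!mxE. Qed.

Lemma measurable_private_step dO (O : measurableType dO)
    (Z : O -> 'I_n -> record R d) (v : O -> 'rV[R]_d) :
  (forall i, measurable_fun setT (fun o => Z o i : borelType (record R d))) ->
  measurable_fun setT (v : O -> borelType 'rV[R]_d) ->
  forall k, measurable_fun setT (fun o => private_step (Z o) (v o) 0 k).
Proof.
move=> mZ mv k.
have mvk j : measurable_fun setT (fun o => v o 0 j) by exact: measurable_coord.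
have mx i j : measurable_fun setT (fun o => clip Lx (Z o i).2 0 j).
  under eq_fun => o do rewrite clipE//.
  apply: (measurableT_comp (measurable_trunc Lx)).
  exact: (measurableT_comp (measurableT_comp (measurable_fun_coord j) (@measurable_record_snd R d)) (mZ i)).
have my i : measurable_fun setT (fun o => trunc r (Z o i).1).
  apply: (measurableT_comp (measurable_trunc r)).
  exact: (measurableT_comp (@measurable_record_fst R d) (mZ i)).
under eq_fun => o do rewrite private_stepE.
apply: measurable_funB => //; apply: measurable_funM => //; apply: measurable_funM => //.
apply: measurable_sum => i; apply: measurable_funM => //; apply: measurable_funB => //.
apply: (measurableT_comp mdpsi); apply: measurable_sum => j.
exact: measurable_funM.
Qed.

(** Only the replaced record contributes, and clipping, truncation and saturation bound its two
    summands by [(r + S) * Lx] whatever [b] is, so no control of the iterates is involved. *)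
Lemma private_step_sensitivity (S : R) (Z Z' : 'I_n -> record R d) b k :
  (forall t, `|dpsiL t| <= S) -> 0 <= r -> 0 <= eta -> adjacent Z Z' ->
  `|private_step Z b 0 k - private_step Z' b 0 k| <=
    eta * (2 * (r + S) * Lx / n%:R).
Proof.
move=> dS r0 eta0 [i0 Hi].
pose g (z : record R d) := (dpsiL (dot (clip Lx z.2) b) - trunc r z.1) * clip Lx z.2 0 k.
have gB z : `|g z| <= (r + S) * Lx.
  rewrite /g normrM; apply: ler_pM => //.
    apply: (le_trans (ler_normB _ _)); rewrite addrC; apply: lerD => //.
    exact: trunc_bound.
  by rewrite clipE//; exact: trunc_bound.
rewrite !private_stepE.
rewrite (_ : _ - _ = eta * (n%:R^-1 * (\sum_i g (Z' i) - \sum_i g (Z i)))); last by rewrite /g; ring.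
rewrite -sumrB (bigD1 i0)//= big1; last by move=> i ii; rewrite Hi// subrr.
rewrite addr0 !normrM (ger0_norm eta0) ger0_norm ?invr_ge0//.
apply: ler_wpM2l => //; rewrite [leRHS]mulrC; apply: ler_wpM2l; first by rewrite invr_ge0.
apply: (le_trans (ler_normB _ _)); have := gB (Z' i0); have := gB (Z i0); lra.
Qed.
End step.

Lemma measurable_l2norm dO (O : measurableType dO) (R : realType) (d : nat)
    (u : O -> 'rV[R]_d) :
  measurable_fun setT (u : O -> borelType 'rV[R]_d) ->
  measurable_fun setT (fun o => l2norm (u o)).
Proof.
move=> mu; have muk j : measurable_fun setT (fun o => u o 0 j) by exact: measurable_coord.
have md : measurable_fun setT (fun o => dot (u o) (u o)).
  by apply: measurable_sum => j; exact: measurable_funM.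
rewrite (_ : (fun o => _) = (fun o => dot (u o) (u o) `^ (2^-1))).
  exact: (measurableT_comp (@measurable_powR R 2^-1) md).
by apply/funext => o; rewrite powR12_sqrt ?dot_ge0.
Qed.

Lemma measurable_proj_unit_ball dO (O : measurableType dO) (R : realType) (d : nat)
    (u : O -> 'rV[R]_d) :
  measurable_fun setT (u : O -> borelType 'rV[R]_d) ->
  measurable_fun setT (fun o => proj_unit_ball (u o) : borelType 'rV[R]_d).
Proof.
move=> mu; have muk j : measurable_fun setT (fun o => u o 0 j) by exact: measurable_coord.
have mn := measurable_l2norm mu.
have mmax : measurable_fun setT (fun o => Num.max 1 (l2norm (u o))).
  by apply: measurable_maxr.
apply: measurable_rV => j; under eq_fun => o do rewrite proj_unit_ballE /ball_scale mxE.
apply: measurable_funM => //.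
rewrite (_ : (fun o => _) = (fun o => (Num.max 1 (l2norm (u o))) `^ (- 1))).
  exact: (measurableT_comp (@measurable_powR R (- 1)) mmax).
by apply/funext => o; rewrite powR_inv1// le_max ler01.
Qed.

(* The order [a = 2 ln(1/delta) / eps] of the Renyi divergence. *)
Lemma renyi_order_budget (R : realType) (s T : nat) (eps delta lam : R) :
  (0 < s)%N -> (4 <= T)%N -> 0 < eps <= 1 -> 0 < delta -> 4 <= ln delta^-1 -> 0 < lam ->
  let b := noisyHT_scale s (eps / T%:R) (delta / T%:R) lam in
  let a := 2 * ln delta^-1 / eps in
  [/\ 0 < b, 1 < a &
   2 * a ^+ 2 * ((2 * lam / b) ^+ 2 + (lam / 2 / b) ^+ 2) * (s * T)%:R -
    (a - 1) * eps <= ln delta].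
Proof.
move=> s0 T4 /andP[e0 e1] d0 l4 lam0 b a.
set l := ln delta^-1 in l4 a *.
have T40 : 4 <= T%:R :> R by rewrite ler_nat.
have T0 : 0 < T%:R :> R by lra.
have sR0 : 0 < s%:R :> R by rewrite ltr0n.
have ls : ln (delta / T%:R)^-1 = ln T%:R + l.
  by rewrite invfM invrK mulrC lnM ?posrE ?invr_gt0.
have lT : 0 <= ln T%:R :> R by rewrite ln_ge0; lra.
set L := ln (delta / T%:R)^-1 in b ls *.
have Ll : l <= L by lra.
have L0 : 0 < L by lra.
pose x := Num.sqrt (3 * s%:R * L).
have x0 : 0 < x by rewrite sqrtr_gt0 !mulr_gt0.
have x2 : x ^+ 2 = 3 * s%:R * L by rewrite sqr_sqrtr// ltW// !mulr_gt0.
have b0 : 0 < b by rewrite /b /noisyHT_scale -/L -/x !mulr_gt0// ?invr_gt0 ?divr_gt0.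
have a1 : 1 < a by rewrite /a ltr_pdivlMr//; lra.
split=> //.
have lb : lam / b = eps / (2 * T%:R * x).
  rewrite /b /noisyHT_scale -/L -/x; field.
  by rewrite !gt_eqF.
(* The coefficient is 4 for a selection round plus 1/4 for a released coordinate. *)
have -> : (2 * lam / b) ^+ 2 + (lam / 2 / b) ^+ 2 = 17 / 4 * (lam / b) ^+ 2.
  by field; rewrite gt_eqF.
have lb2 : (lam / b) ^+ 2 = eps ^+ 2 / (4 * T%:R ^+ 2 * (3 * s%:R * L)).
  by rewrite lb -x2; field; rewrite !gt_eqF.
rewrite lb2.
(* As [T >= 4] and [l <= L], this is at most [17 / 24 * l]; together with [eps <= 1] and [l >= 4] it
   leaves room below [l]. *)
have -> : 2 * a ^+ 2 * (17 / 4 * (eps ^+ 2 / (4 * T%:R ^+ 2 * (3 * s%:R * L)))) * (s * T)%:R =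
    17 / 6 * (l / L) * (l / T%:R).
  rewrite natrM /a; field.
  by rewrite !gt_eqF.
have -> : (a - 1) * eps = 2 * l - eps by rewrite /a; field; rewrite gt_eqF.
have -> : ln delta = - l by rewrite /l lnV ?posrE// opprK.
have h1 : l / L <= 1 by rewrite ler_pdivrMr// mul1r.
have h10 : 0 <= l / L by rewrite divr_ge0//; lra.
have h2 : l / T%:R <= l / 4.
  by apply: ler_wpM2l; [lra|rewrite lef_pV2 ?posrE].
have h20 : 0 <= l / T%:R by rewrite divr_ge0//; lra.
have : l / L * (l / T%:R) <= l / 4.
  by apply: (le_trans _ h2); rewrite ler_piMl.
lra.
Qed.

Lemma noise_and_data_indep_family dO (O : measurableType dO) (R : realType)
    (P : probability O R) (n d T s : nat)
    (D : 'I_n -> {RV P >-> borelType (record R d)})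
    (w : 'I_T -> 'I_s -> 'I_d -> {RV P >-> R})
    (w' : 'I_T -> 'I_d -> {RV P >-> R}) :
  noise_and_data_independent D w w' ->
  indep_family P (fun k : 'I_n + ('I_T * 'I_s * 'I_d) + ('I_T * 'I_d) =>
       match k with
       | inl (inl i) => sigma_of (D i)
       | inl (inr (t, r, j)) => sigma_of (w t r j)
       | inr (t, j) => sigma_of (w' t j)
       end).
Proof.
move=> ind; split => //.
- by move=> [[i|[[t r] j]]|[t j]]; apply: sigma_of_measurable; exact: measurable_funPT.
- by move=> [[i|[[t r] j]]|[t j]]; exact: sigma_ofI.
- by move=> [[i|[[t r] j]]|[t j]]; exact: sigma_ofT.
Qed.

Section privacy.
Context (R : realType) (n d T s : nat) (tie : {set 'I_d} -> 'I_d).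
Context (psiL dpsiL : R -> R) (Lx r eta S eps delta : R).
Context dO (O : measurableType dO) (P : probability O R).
Context (D : 'I_n -> {RV P >-> borelType (record R d)}).
Context (w : 'I_T -> 'I_s -> 'I_d -> {RV P >-> R}) (w' : 'I_T -> 'I_d -> {RV P >-> R}).
Hypothesis tb : tie_breaking tie.
Hypothesis ind : noise_and_data_independent D w w'.
Hypothesis Hpsi : forall t : R, is_derive t 1 psiL (dpsiL t).
Hypothesis mdpsi : measurable_fun setT dpsiL.
Hypothesis dS : forall t, `|dpsiL t| <= S.
Hypothesis Lx0 : 0 < Lx.
Hypothesis r0 : 0 < r.
Hypothesis eta0 : 0 < eta.
Hypothesis n0 : (0 < n)%N.
Hypothesis s0 : (0 < s)%N.
Hypothesis T4 : (4 <= T)%N.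
Hypothesis eps01 : 0 < eps <= 1.
Hypothesis delta0 : 0 < delta.
Hypothesis delta4 : 4 <= ln delta^-1.
Let lam := eta * (4 * (r + S) * Lx) / n%:R.
Let b := noisyHT_scale s (eps / T%:R) (delta / T%:R) lam.
Hypothesis lapw : forall t k j, has_laplace_law b (w t k j).
Hypothesis lapw' : forall t j, has_laplace_law b (w' t j).

Let M (Z : 'I_n -> record R d) (o : O) : 'rV[R]_d :=
  private_glm tie psiL Lx r eta Z (fun t k j => w t k j o) (fun t j => w' t j o).

Lemma noise_scale_gt0 : 0 < lam /\ 0 < b.
Proof.
have S0 : 0 <= S by exact: le_trans (normr_ge0 _) (dS 0).
have l0 : 0 < lam.
  have n0' : 0 < n%:R :> R by rewrite ltr0n.
  by rewrite /lam divr_gt0// !mulr_gt0// ltr_wpDr.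
by have [] := renyi_order_budget s0 T4 eps01 delta0 delta4 l0.
Qed.

Lemma measurable_private_glm (Z : O -> 'I_n -> record R d) :
  (forall i, measurable_fun setT (fun o => Z o i : borelType (record R d))) ->
  measurable_fun setT (fun o => M (Z o) o : borelType 'rV[R]_d).
Proof.
move=> mZ; apply: measurable_proj_unit_ball.
have := @measurable_noisy_run _ O R d s T tie (fun o => private_step psiL Lx r eta (Z o))
  (fun t k j => w t k j) (fun t j => w' t j) (fun=> 0) (enum 'I_T).
apply.
- by move=> v mv k; exact: (measurable_private_step r eta Hpsi mdpsi (ltW Lx0)).
- by move=> t k j _; exact: measurable_funPT.
- by move=> t j _; exact: measurable_funPT.
- exact: measurable_cst.
Qed.

Lemma private_glm_dp : differentially_private P M eps delta.
Proof.
move=> Z Z' adj B mB; have [lam0 b0] := noise_scale_gt0.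
have [_ a1 budget] := renyi_order_budget s0 T4 eps01 delta0 delta4 lam0.
(* Places the noises, grouped by stage, inside the joint family of data and noise. *)
pose ix (k : 'I_T * ('I_s * 'I_d + 'I_d)) : 'I_n + ('I_T * 'I_s * 'I_d) + ('I_T * 'I_d) :=
  match k with
  | (t, inl (i, j)) => inl (inr (t, i, j))
  | (t, inr j) => inr (t, j)
  end.
have ix_inj : injective ix.
  by move=> [t [[i j]|j]] [t' [[i' j']|j']] //= [] -> -> // ->.
have bm (X : 'I_n -> record R d) : borel_map (private_step psiL Lx r eta X).
  move=> k.
  apply: (measurable_private_step r eta Hpsi mdpsi (ltW Lx0) (Z := fun=> X) (v := fun u : borelType 'rV[R]_d => u)).
    by move=> i; exact: measurable_cst.
  exact: measurable_id.
have sens v k : `|private_step psiL Lx r eta Z v 0 k - private_step psiL Lx r eta Z' v 0 k| <= lam / 2.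
  apply: (le_trans (private_step_sensitivity Hpsi (ltW Lx0) v k dS (ltW r0) (ltW eta0) adj)).
  by rewrite le_eqVlt; apply/orP; left; apply/eqP; rewrite /lam; field; rewrite gt_eqF// ltr0n.
(* Post-processing: the event for the projected output is an event for the last iterate. *)
have mproj : <<s open >> ((fun u : 'rV[R]_d => proj_unit_ball u) @^-1` B).
  have := measurable_proj_unit_ball (@measurable_id _ (borelType 'rV[R]_d) setT).
  by move=> /(_ measurableT B mB); rewrite setTI.
exact: (noisy_run_dp (noise_and_data_indep_family ind) tb ix_inj (w := w) (w' := w')
  (fun _ _ _ => erefl) (fun _ _ => erefl) b0 lam0 a1 lapw lapw' 0 (bm Z) (bm Z') sens
  mproj delta0 budget).
Qed.

End privacy.

(** * Numerical constants *)

Lemma nceil_bounds (R : realType) (x : R) : 0 <= x -> x <= (nceil x)%:R < x + 1.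
Proof.
move=> x0; have c0 : 0 <= Num.ceil x by rewrite ceil_ge0//; lra.
have -> : (nceil x)%:R = (Num.ceil x)%:~R :> R.
  by rewrite /nceil natr_absz ger0_norm.
by rewrite ceil_ge/= -ltrBlDr; have := ceil_itv x; rewrite intrB => /andP[].
Qed.

Lemma sqrD_le (R : realType) (x y : R) : (x + y) ^+ 2 <= 2 * x ^+ 2 + 2 * y ^+ 2.
Proof. by have := sqr_ge0 (x - y); lra. Qed.

Lemma powR_3_2 (R : realType) (x : R) : 0 < x -> x `^ (3 / 2) = x * Num.sqrt x.
Proof.
move=> x0; rewrite (_ : 3 / 2 = 1 + 2^-1 :> R); last by field.
by rewrite powRD ?(gt_eqF x0) ?implybT// powRr1 ?powR12_sqrt ?ltW.
Qed.

Section rates.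
Context (R : realType) (alpha gamma : R).
Hypothesis ag : 0 < alpha <= gamma.
Let q0 := 1 - 3 * alpha / (4 * gamma).
Let rho := alpha / (10 * gamma).
Let a0 : 0 < alpha. Proof. by case/andP: ag. Qed.
Let le_ag : alpha <= gamma. Proof. by case/andP: ag. Qed.
Let g0 : 0 < gamma. Proof. exact: lt_le_trans a0 le_ag. Qed.
Let x := alpha / gamma.
Let x0 : 0 < x. Proof. exact: divr_gt0. Qed.
Let x1 : x <= 1. Proof. by rewrite ler_pdivrMr ?mul1r. Qed.
Let q0E : q0 = 1 - 3 / 4 * x. Proof. by rewrite /q0 /x; field; rewrite gt_eqF. Qed.
Let rhoE : rho = x / 10. Proof. by rewrite /rho /x; field; rewrite gt_eqF. Qed.

(** In terms of [x = alpha / gamma] the last bound reads [(1 + x / 10) * (1 - x) <= (1 - 3 / 4 * x)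
    * (1 + x)] on (0, 1]. The bound 2 on [- ln q0] comes from [q0 >= 1/4] and yields [T >= 4] once
    [ln n >= 8]. *)
Lemma rate_bounds : [/\ 4^-1 <= q0 < 1, 0 < - ln q0 <= 2, 0 <= rho <= 1 &
  (1 + rho) * ((gamma - alpha) / (gamma + alpha)) <= q0].
Proof.
have qb : 4^-1 <= q0 < 1 by rewrite q0E; apply/andP; split; have := x0; have := x1; lra.
case/andP: (qb) => q4 q1.
have q00 : 0 < q0 by lra.
split => //.
- apply/andP; split; first by rewrite oppr_gt0 ln_lt0// q00.
  rewrite -[leRHS]expRK -lnV ?posrE// ler_ln ?posrE ?invr_gt0 ?expR_gt0//.
  apply: (@le_trans _ _ 4).
    by rewrite -[leRHS]invrK lef_pV2 ?posrE ?invr_gt0.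
  have e1 : 2 <= expR 1 :> R by have := @expR_ge1Dx R 1; lra.
  have -> : expR 2 = expR 1 ^+ 2 :> R by rewrite -expRM_natl mulr1.
  nra.
- by rewrite rhoE; apply/andP; split; have := x0; have := x1; lra.
- have -> : (gamma - alpha) / (gamma + alpha) = (1 - x) / (1 + x).
    by rewrite /x; field; rewrite !gt_eqF//; have := a0; have := g0; lra.
  rewrite q0E rhoE mulrA ler_pdivrMr; last by have := x0; lra.
  by have := x0; have := x1; nra.
Qed.

(** [rho = alpha / (10 * gamma)] asks for [s - sstar >= 100 * (gamma / alpha) ^+ 2 * sstar]; the
    101st unit pays for subtracting [sstar], as [gamma / alpha >= 1]. *)
Lemma sparsity_bounds (C0 : R) (sstar : nat) :
  101 <= C0 -> (1 <= sstar)%N ->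
  let s := nceil (C0 * (gamma / alpha) ^+ 2 * sstar%:R) in
  [/\ (sstar < s)%N, s%:R <= (C0 * (gamma / alpha) ^+ 2 + 1) * sstar%:R &
      sstar%:R <= rho ^+ 2 * (s - sstar)%:R].
Proof.
move=> C01 s1 s; set g := gamma / alpha in s *.
have S1 : 1 <= sstar%:R :> R by rewrite ler1n.
have g1 : 1 <= g by rewrite ler_pdivlMr ?mul1r.
have gx : g * x = 1 by rewrite /g /x; field; rewrite !gt_eqF.
have g21 : 1 <= g ^+ 2 by rewrite expr2; nra.
have B0 : 101 <= C0 * g ^+ 2 by nra.
have BS : 101 * sstar%:R <= C0 * g ^+ 2 * sstar%:R by apply: ler_wpM2r => //; lra.
have /andP[h1 h2] : C0 * g ^+ 2 * sstar%:R <= s%:R < C0 * g ^+ 2 * sstar%:R + 1.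
  by apply: nceil_bounds; lra.
have ss : (sstar < s)%N by rewrite -(ltr_nat R); lra.
split => //; first lra.
rewrite natrB; last exact: ltnW.
have h3 : 101 * g ^+ 2 * sstar%:R <= C0 * g ^+ 2 * sstar%:R.
  by rewrite ler_wpM2r// ?ler_wpM2r ?sqr_ge0//; lra.
have h4 : sstar%:R <= g ^+ 2 * sstar%:R by rewrite ler_peMl//; lra.
have h5 : 100 * g ^+ 2 * sstar%:R <= s%:R - sstar%:R by lra.
have r2 : rho ^+ 2 * (100 * g ^+ 2) = 1.
  have -> : rho ^+ 2 * (100 * g ^+ 2) = (g * x) ^+ 2 by rewrite rhoE; field.
  by rewrite gx expr1n.
have := ler_wpM2l (sqr_ge0 rho) h5; rewrite mulrA r2 mul1r; exact.
Qed.

Lemma stopping_time_bounds (n : nat) : 8 <= ln n%:R :> R ->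
  let T := nceil (ln n%:R / - ln q0) in
  [/\ (4 <= T)%N, q0 ^+ T <= n%:R^-1 &
      T%:R <= ((- ln q0)^-1 + 1) * ln n%:R].
Proof.
move=> n8 T; have [/andP[q4 q1] /andP[lq0 lq2] _ _] := rate_bounds.
have q00 : 0 < q0 by lra.
have n0 : (0 < n)%N by rewrite lt0n; apply/eqP => n0; move: n8; rewrite n0 ln0//; lra.
have nR0 : 0 < n%:R :> R by rewrite ltr0n.
have z0 : 0 <= ln n%:R / - ln q0 by rewrite divr_ge0//; lra.
have /andP[T1 T2] : ln n%:R / - ln q0 <= T%:R < ln n%:R / - ln q0 + 1 by exact: nceil_bounds.
split.
- rewrite -(ler_nat R); apply: (le_trans _ T1); rewrite ler_pdivlMr//; lra.
- rewrite -[q0]lnK ?posrE// -expRM_natl -[n%:R^-1]lnK ?posrE ?invr_gt0// ler_expR.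
  rewrite lnV ?posrE//; rewrite ler_pdivrMr// in T1; lra.
- by rewrite mulrDl mul1r mulrC; lra.
Qed.

End rates.

Section sample_size.
Context (R : realType) (n d sstar : nat) (eps delta : R).
Hypothesis nd : (2 <= n <= d)%N.
Hypothesis S1 : (1 <= sstar)%N.
Hypothesis eps01 : 0 < eps <= 1.
Hypothesis dl : 0 < delta <= n%:R^-1.

(** The factor in the sample-size condition, with the power 3/2 of [ln n] split; [(Y / n) ^+ 2] is
    the privacy part of the rate. *)
Let Y := sstar%:R * ln d%:R * Num.sqrt (ln (expR 1 * d%:R)) *
  Num.sqrt (ln delta^-1) * (ln n%:R * Num.sqrt (ln n%:R)) / eps.

Lemma log_bounds : [/\ 2^-1 <= ln n%:R :> R, ln n%:R <= ln d%:R :> R,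
  ln (expR 1 * d%:R) = 1 + ln d%:R :> R & ln n%:R <= ln delta^-1].
Proof.
have n2 : 2 <= n%:R :> R by rewrite ler_nat; case/andP: nd.
have dn : n%:R <= d%:R :> R by rewrite ler_nat; case/andP: nd.
have n0 : 0 < n%:R :> R by lra.
have d0 : 0 < d%:R :> R by lra.
split.
- apply: (@le_trans _ _ (ln 2)); last by rewrite ler_ln ?posrE.
  have := @expR_ge1Dx R (- ln 2); rewrite expRN lnK ?posrE//; lra.
- by rewrite ler_ln ?posrE.
- by rewrite lnM ?posrE ?expR_gt0// expRK.
- case/andP: dl => dl0 dln.
  by rewrite ler_ln ?posrE ?invr_gt0// -[leLHS]invrK lef_pV2 ?posrE ?invr_gt0.
Qed.

(** A bootstrap: from [ln n >= 1/2] alone [Y >= 1/16], so [n >= m0 ^+ 2 / 16 >= expR 8]. Then all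
    logarithmic factors and [1 / eps] are at least 1, and [Y] dominates [sstar * ln d]. *)
Lemma sample_size_bounds (m0 : R) : 4 * expR 8 <= m0 -> m0 ^+ 2 * Y <= n%:R ->
  8 <= ln n%:R :> R /\ m0 ^+ 2 * (sstar%:R * ln d%:R) <= n%:R.
Proof.
move=> mM mY; have [l1 l2 l3 l4] := log_bounds; case/andP: eps01 => e0 e1.
have n2 : 2 <= n%:R :> R by rewrite ler_nat; case/andP: nd.
have S1R : 1 <= sstar%:R :> R by rewrite ler1n.
have ei : 1 <= eps^-1 by rewrite invf_ge1.
have sLe : 1 <= Num.sqrt (ln (expR 1 * d%:R)) :> R.
  by rewrite -[leLHS]sqrtr1 ler_sqrt l3; lra.
have E8 : 1 <= expR 8 :> R by have := @expR_ge1Dx R 8; lra.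
have half x : 2^-1 <= x -> 2^-1 <= Num.sqrt x :> R.
  move=> hx; rewrite -[leLHS]ger0_norm ?invr_ge0// -sqrtr_sqr ler_sqrt; [|lra].
  by rewrite exprVn; lra.
have prod_lb (a1 a2 : R) : 0 <= a1 -> 0 <= a2 -> a1 <= Num.sqrt (ln delta^-1) ->
    a2 <= ln n%:R * Num.sqrt (ln n%:R) ->
    sstar%:R * ln d%:R * (a1 * a2) <= Y.
  move=> a10 a20 h1 h2; rewrite /Y.
  have p0 : 0 <= sstar%:R * ln d%:R :> R by rewrite mulr_ge0//; lra.
  have q1 : sstar%:R * ln d%:R <= sstar%:R * ln d%:R * Num.sqrt (ln (expR 1 * d%:R)) :> R.
    by rewrite ler_peMr.
  rewrite -[leLHS]mulr1; apply: ler_pM => //; first by rewrite !mulr_ge0//; lra.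
  rewrite -[leRHS]mulrA; apply: ler_pM => //; first exact: mulr_ge0.
  exact: ler_pM.
have n8 : 8 <= ln n%:R :> R.
  have h4 : 4^-1 <= ln n%:R * Num.sqrt (ln n%:R) :> R by have := half _ l1; nra.
  have h2 : 2^-1 <= Num.sqrt (ln delta^-1) by apply: half; lra.
  have := prod_lb 2^-1 4^-1 ltac:(lra) ltac:(lra) h2 h4 => hY.
  have Y16 : 16^-1 <= Y.
    apply: (le_trans _ hY); have : 2^-1 <= sstar%:R * ln d%:R :> R by nra.
    lra.
  have m2 : 16 * expR 8 ^+ 2 <= m0 ^+ 2 by nra.
  have : expR 8 <= n%:R :> R.
    apply: (le_trans _ mY); apply: (@le_trans _ _ (16 * expR 8 ^+ 2 * 16^-1)); first by nra.
    by apply: ler_pM.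
  by rewrite -ler_ln ?posrE ?expR_gt0// ?expRK//; lra.
split => //; apply: (le_trans _ mY); apply: ler_wpM2l; first exact: sqr_ge0.
have one x : 1 <= x -> 1 <= Num.sqrt x :> R.
  by move=> hx; rewrite -[leLHS]sqrtr1 ler_sqrt//; lra.
have h2 : 1 <= Num.sqrt (ln delta^-1) by apply: one; lra.
have h4 : 1 <= ln n%:R * Num.sqrt (ln n%:R) :> R by have := one (ln n%:R); nra.
have := prod_lb 1 1 ler01 ler01 h2 h4; rewrite !mulr1; exact.
Qed.

End sample_size.

(** * Collecting the error terms *)

Section error_terms.
Context (R : realType).

(** The factor 96 is [3 * 8 * 2 ^+ 2], from the support size, the score level and the scale
    [2 * Kx]; the factor 2 bounds [1 + rho]. *)
Lemma statistical_term_bound (rho eta s S Ks c c2 Kx ld n : R) :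
  0 <= rho <= 1 -> 0 <= eta -> 0 <= s -> s <= Ks * S -> 0 <= S -> 0 <= Ks ->
  0 < c -> 0 < c2 -> 0 < Kx -> 0 <= ld -> 0 < n ->
  (1 + rho) * (eta * (Num.sqrt (3 * s) *
    Num.sqrt (8 * (c * c2 * (2 * Kx) ^+ 2) * ld / n))) <=
  2 * eta * (Num.sqrt (96 * Ks * c2) * Kx) * (Num.sqrt c * Num.sqrt (S * ld / n)).
Proof.
move=> /andP[rho0 rho1] eta0 s0 sK S0 Ks0 c0 c20 K0 ld0 n0.
have h1 : Num.sqrt (3 * s) * Num.sqrt (8 * (c * c2 * (2 * Kx) ^+ 2) * ld / n) <=
    Num.sqrt (96 * Ks * c2) * Kx * (Num.sqrt c * Num.sqrt (S * ld / n)).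
  have -> : Num.sqrt (96 * Ks * c2) * Kx * (Num.sqrt c * Num.sqrt (S * ld / n)) =
      Num.sqrt (96 * Ks * c2 * Kx ^+ 2 * (c * (S * ld / n))).
    rewrite [RHS]sqrtrM; last by rewrite !mulr_ge0 ?(ltW c20) ?(ltW K0).
    rewrite [in RHS]sqrtrM; last by rewrite !mulr_ge0 ?(ltW c20).
    by rewrite sqrtr_sqr (ger0_norm (ltW K0)) (sqrtrM _ (ltW c0)).
  rewrite -sqrtrM; last by rewrite mulr_ge0.
  apply: ler_wsqrtr.
  have -> : 3 * s * (8 * (c * c2 * (2 * Kx) ^+ 2) * ld / n) =
    s * (96 * c2 * Kx ^+ 2 * c * ld / n) by field; rewrite gt_eqF.
  have -> : 96 * Ks * c2 * Kx ^+ 2 * (c * (S * ld / n)) =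
    Ks * S * (96 * c2 * Kx ^+ 2 * c * ld / n) by field; rewrite gt_eqF.
  apply: ler_wpM2r => //.
  by rewrite divr_ge0 ?(ltW n0)// !mulr_ge0 ?(ltW c20) ?(ltW K0) ?(ltW c0).
rewrite -!mulrA; apply: ler_pM; [lra| |lra|].
  by rewrite !mulr_ge0 ?sqrtr_ge0.
by apply: ler_wpM2l => //; rewrite !mulrA in h1 *.
Qed.

Lemma saturation_level_bound (p0 c2 Lsp k CR c cup l Lpsi : R) :
  0 <= p0 -> 0 < c2 -> 1 <= Lsp -> 0 <= k -> 0 < CR -> 0 < c <= cup -> 1 <= l ->
  Lpsi = Lsp + k * Num.sqrt l ->
  0 <= p0 + c2 * Lpsi + CR * Num.sqrt (c * l) + (p0 + 2 * c2 * Lpsi) <=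
  (2 * p0 + 3 * c2 * (Lsp + k) + CR * Num.sqrt cup) * Num.sqrt l.
Proof.
move=> hp c20 L1 k0 CR0 /andP[c0 cc] l1 LE.
have sl : 1 <= Num.sqrt l by rewrite -[leLHS]sqrtr1; apply: ler_wsqrtr.
have Lp : 0 <= Lpsi by rewrite LE addr_ge0 ?mulr_ge0//; lra.
have LB : Lpsi <= (Lsp + k) * Num.sqrt l by rewrite LE; nra.
rewrite sqrtrM ?(ltW c0)//; apply/andP; split.
  by rewrite !addr_ge0 ?mulr_ge0 ?sqrtr_ge0 ?(ltW c20) ?(ltW CR0).
have h2 := ler_wpM2l (ltW c20) LB.
have h3 : 0 <= p0 * (Num.sqrt l - 1) by rewrite mulr_ge0//; lra.
have h4 : CR * (Num.sqrt c * Num.sqrt l) <= CR * (Num.sqrt cup * Num.sqrt l).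
  apply: ler_wpM2l; first exact: ltW.
  by apply: ler_wpM2r; [exact: sqrtr_ge0|exact: ler_wsqrtr].
lra.
Qed.

(** Origin of the logarithms: [u], which stands for [r + Spsi], gives the square root of [ln n] and
    [T] gives [ln n], together the power 3/2. The factor 168 is [3 * 7 * 2 * 4]. *)
Lemma noise_term_bound (eta Cx Kx Ks A2 A3 n s S ld Le ll l T L eps u : R) :
  0 <= eta -> 0 <= Cx -> 0 <= Kx -> 0 < n -> 0 <= s -> s <= Ks * S -> 0 <= ld ->
  0 <= l -> 0 < T -> T <= A3 * l -> 0 <= L -> L <= (A3 + 1) * ll -> 0 <= A3 ->
  0 < eps -> 0 <= u -> u <= A2 * Num.sqrt l ->
  3 * (7 * ld * (2 * (eta * (4 * u * (Cx * Kx * Num.sqrt Le)) / n) *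
    Num.sqrt (3 * s * L) / (eps / T)) * Num.sqrt s) <=
  168 * eta * Cx * Kx * (A2 * (Num.sqrt 3 * Ks * Num.sqrt (A3 + 1)) * A3) *
    (S * ld * Num.sqrt Le * Num.sqrt ll * (l * Num.sqrt l) / eps / n).
Proof.
move=> eta0 Cx0 K0 n0 s0 sK ld0 l0 T0 TA L0 LA A30 e0 u0 uA.
pose k := 168 * eta * Cx * Kx * (ld * Num.sqrt Le / (n * eps)).
have k0 : 0 <= k.
  by rewrite /k !mulr_ge0 ?sqrtr_ge0// invr_ge0 mulr_ge0 ?(ltW n0) ?(ltW e0).
have -> : 3 * (7 * ld * (2 * (eta * (4 * u * (Cx * Kx * Num.sqrt Le)) / n) *
    Num.sqrt (3 * s * L) / (eps / T)) * Num.sqrt s) =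
    k * (u * (Num.sqrt (3 * s * L) * Num.sqrt s) * T).
  by rewrite /k; field; rewrite !gt_eqF.
have -> : 168 * eta * Cx * Kx * (A2 * (Num.sqrt 3 * Ks * Num.sqrt (A3 + 1)) * A3) *
    (S * ld * Num.sqrt Le * Num.sqrt ll * (l * Num.sqrt l) / eps / n) =
    k * ((A2 * Num.sqrt l) * ((Num.sqrt 3 * (Ks * S)) * (Num.sqrt (A3 + 1) * Num.sqrt ll)) * (A3 * l)).
  by rewrite /k; field; rewrite !gt_eqF.
have f2 : Num.sqrt (3 * s * L) * Num.sqrt s <=
    Num.sqrt 3 * (Ks * S) * (Num.sqrt (A3 + 1) * Num.sqrt ll).
  have -> : Num.sqrt (3 * s * L) * Num.sqrt s = Num.sqrt 3 * s * Num.sqrt L.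
    rewrite !sqrtrM ?mulr_ge0//.
    by rewrite -[X in _ = _ * X * _](sqr_sqrtr s0); ring.
  apply: ler_pM; rewrite ?mulr_ge0 ?sqrtr_ge0//.
    by apply: ler_wpM2l => //; exact: sqrtr_ge0.
  by rewrite -sqrtrM ?ler_wsqrtr//; lra.
apply: ler_wpM2l => //; apply: ler_pM => //; last by apply: ler_pM => //; rewrite mulr_ge0 ?sqrtr_ge0.
  by rewrite !mulr_ge0 ?sqrtr_ge0.
exact: ltW.
Qed.

(** With [m0] large, both [sqrt (S * ld / n)] and [X] are at most [m0^-1], which makes [Err] small.
    The lower bound [clo] converts quantities without the factor [c] into multiples of the rate:
    [X ^+ 2], [Q ^+ 2] and [n^-1]. *)
Lemma error_combination (A1 A5 m0 q0 clo c cup S ld n Q Err X : R) :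
  0 <= A1 -> 0 <= A5 -> 4 <= m0 -> (A1 * Num.sqrt cup + A5) / (1 - q0) <= m0 ->
  q0 < 1 -> 0 < clo -> clo <= c <= cup -> 1 <= S -> 1 <= ld -> 0 < n ->
  m0 ^+ 2 * (S * ld) <= n -> 0 <= X -> m0 ^+ 2 * X <= 1 ->
  0 <= Q <= n^-1 -> 1 <= n -> 0 <= Err ->
  Err <= A1 * (Num.sqrt c * Num.sqrt (S * ld / n)) + A5 * X ->
  let Cb := 2 / clo + 2 * (2 * A1 ^+ 2 + 2 * A5 ^+ 2 / clo) / (1 - q0) ^+ 2 in
  let rate := c * (S * ld / n + X ^+ 2) in
  [/\ Err <= 2 * (1 - q0), (Q + Err / (1 - q0)) ^+ 2 <= Cb * rate &
      n^-1 <= Cb * rate].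
Proof.
move=> A10 A50 m04 hm q1' clo0 /andP[cl cu] S1 ld1 n0 mS X0 mX /andP[Q0 Qn] n1 Err0 ErrB Cb rate.
have q1 : 0 < 1 - q0 by lra.
have q1V : 0 < (1 - q0)^-1 by rewrite invr_gt0.
have ci : 0 < clo^-1 by rewrite invr_gt0.
have c0 : 0 < c by lra.
have m0p : 0 < m0 by lra.
have m0V : 0 < m0^-1 by rewrite invr_gt0.
have Sld : 1 <= S * ld by nra.
have y20 : 0 <= S * ld / n by rewrite divr_ge0 ?(ltW n0)//; lra.
have [y [y0 y2 yE]] : exists y, [/\ 0 <= y, y ^+ 2 = S * ld / n & y = Num.sqrt (S * ld / n)].
  by exists (Num.sqrt (S * ld / n)); rewrite sqrtr_ge0 sqr_sqrtr.
rewrite -yE in ErrB.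
have rateE : rate = c * (y ^+ 2 + X ^+ 2) by rewrite y2.
have Cb2 : 0 <= 2 * (2 * A1 ^+ 2 + 2 * A5 ^+ 2 / clo) / (1 - q0) ^+ 2.
  by rewrite divr_ge0 ?sqr_ge0// mulr_ge0// addr_ge0 ?divr_ge0 ?mulr_ge0 ?sqr_ge0 ?(ltW clo0).
have CbE : Cb = 2 / clo + 2 * (2 * A1 ^+ 2 + 2 * A5 ^+ 2 / clo) / (1 - q0) ^+ 2 by [].
clearbody rate Cb.
have yB : y <= m0^-1.
  rewrite -(ler_pXn2r (_ : 0 < 2)%N) ?nnegrE ?(ltW m0V)// y2 exprVn.
  by rewrite ler_pdivrMr// ler_pdivlMl ?exprn_gt0.
have XB : X <= m0^-1.
  have : m0 * X <= m0 ^+ 2 * X by apply: ler_wpM2r => //; rewrite expr2; nra.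
  by move=> h; rewrite -[leRHS]mulr1 ler_pdivlMl//; exact: le_trans mX.
have scu : Num.sqrt c <= Num.sqrt cup by exact: ler_wsqrtr.
have rate0 : 0 <= rate by rewrite rateE mulr_ge0 ?(ltW c0)// addr_ge0 ?sqr_ge0.
have nV : n^-1 <= 1 by rewrite invf_le1.
have nV0 : 0 < n^-1 by rewrite invr_gt0.
have n1R : n^-1 <= clo^-1 * rate.
  rewrite rateE ler_pdivlMl// y2.
  have h1 : n^-1 <= S * ld / n by rewrite ler_peMl ?invr_ge0 ?(ltW n0).
  have h2 : clo * n^-1 <= c * (S * ld / n).
    by apply: ler_pM => //; exact: ltW.
  have h3 := mulr_ge0 (ltW c0) (sqr_ge0 X); rewrite mulrDr; apply: (le_trans h2); rewrite lerDl; exact: h3.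
have p1 : Q ^+ 2 <= clo^-1 * rate.
  apply: le_trans n1R; rewrite expr2; apply: (@le_trans _ _ (n^-1 * 1)); last by rewrite mulr1.
  by apply: ler_pM => //; exact: le_trans nV.
split.
- apply: (le_trans ErrB).
  apply: (@le_trans _ _ ((A1 * Num.sqrt cup + A5) * m0^-1)).
    rewrite mulrDl -[A1 * _ * _]mulrA; apply: lerD; apply: ler_wpM2l => //.
    by apply: ler_pM => //; exact: sqrtr_ge0.
  rewrite ler_pdivrMr//; rewrite ler_pdivrMr// in hm.
  have : 0 <= m0 * (1 - q0) by rewrite mulr_ge0// ltW.
  lra.
- apply: (le_trans (sqrD_le _ _)).
  have p2 : Err ^+ 2 <= (2 * A1 ^+ 2 + 2 * A5 ^+ 2 / clo) * rate.
    apply: (@le_trans _ _ ((A1 * (Num.sqrt c * y) + A5 * X) ^+ 2)).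
      by apply: lerXn2r => //; rewrite nnegrE// (le_trans Err0).
    apply: (le_trans (sqrD_le _ _)).
    rewrite !exprMn sqr_sqrtr ?(ltW c0)// rateE [leRHS]mulrDl; apply: lerD.
      have : 0 <= A1 ^+ 2 * c * X ^+ 2 by rewrite !mulr_ge0 ?sqr_ge0 ?(ltW c0).
      lra.
    have h1 : X ^+ 2 <= clo^-1 * (c * (y ^+ 2 + X ^+ 2)).
      rewrite ler_pdivlMl//.
      have h2 : clo * X ^+ 2 <= c * X ^+ 2 by apply: ler_wpM2r => //; exact: sqr_ge0.
      have := mulr_ge0 (ltW c0) (sqr_ge0 y); lra.
    have := ler_wpM2l (sqr_ge0 A5) h1; lra.
  have p3 : (Err / (1 - q0)) ^+ 2 <= (2 * A1 ^+ 2 + 2 * A5 ^+ 2 / clo) / (1 - q0) ^+ 2 * rate.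
    rewrite exprMn exprVn [leRHS]mulrAC; apply: ler_wpM2r => //.
    by rewrite invr_ge0 sqr_ge0.
  rewrite CbE; lra.
- apply: (le_trans n1R); apply: ler_wpM2r => //; rewrite CbE; lra.
Qed.
End error_terms.

Lemma error_budget (R : realType)
    (alpha gamma C0 Cx Cpsi CR c2 Kx Ct Lsp p0 clo cup : R) :
  0 < alpha <= gamma -> 101 <= C0 -> 0 < Cx -> 0 < Cpsi -> 0 < CR -> 0 < c2 ->
  0 < Kx -> 1 <= Lsp -> 0 <= p0 -> 0 < clo -> clo <= cup ->
  exists C1 Cb : R, (0 < C1 /\ 0 < Cb) /\
  forall (n d sstar : nat) (c eps delta : R),
  (2 <= n <= d)%N -> (1 <= sstar)%N -> clo <= c <= cup ->
  0 < eps <= 1 -> 0 < delta <= n%:R^-1 ->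
    let rho := alpha / (10 * gamma) in
    let s := nceil (C0 * (gamma / alpha) ^+ 2 * sstar%:R) in
    let eta := 2 / (alpha + gamma) in
    let Lx := Cx * Kx * Num.sqrt (ln (expR 1 * d%:R)) in
    let Lpsi := Lsp + Cpsi * Kx * Num.sqrt (ln n%:R) in
    let Spsi := p0 + 2 * c2 * Lpsi in
    let r := p0 + c2 * Lpsi + CR * Num.sqrt (c * ln n%:R) in
    let B0 := 4 * (r + Spsi) * Lx in
    let q0 := 1 - 3 * alpha / (4 * gamma) in
    let T := nceil (ln n%:R / - ln q0) in
    let b := noisyHT_scale s (eps / T%:R) (delta / T%:R) (eta * B0 / n%:R) in
    let rate := c * (sstar%:R * ln d%:R / n%:R +
      (sstar%:R * ln d%:R) ^+ 2 * ln (expR 1 * d%:R) * ln delta^-1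
        * ln n%:R ^+ 3 / (n%:R ^+ 2 * eps ^+ 2)) in
    let G0 := Num.sqrt (8 * (c * c2 * (2 * Kx) ^+ 2) * ln d%:R / n%:R) in
    let Err := (1 + rho) * (eta * (Num.sqrt (3 * s%:R) * G0)) +
       3 * (7 * ln d%:R * b * Num.sqrt s%:R) in
    C1 * Num.sqrt c * (sstar%:R * ln d%:R * Num.sqrt (ln (expR 1 * d%:R))
      * Num.sqrt (ln delta^-1) * ln n%:R `^ (3 / 2) / eps) <= n%:R ->
  [/\ 8 <= ln n%:R :> R, 4 * ln d%:R <= n%:R :> R,
      Ct * (s + sstar)%:R * ln (expR 1 * d%:R) <= n%:R, Err <= 2 * (1 - q0) &
      (q0 ^+ T + Err / (1 - q0)) ^+ 2 <= Cb * rate /\ n%:R^-1 <= Cb * rate].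
Proof.
move=> ag hC0 hCx hCpsi hCR c20 K0 hLsp hp0 hclo hcup.
have [/andP[q04 q01] /andP[lq0 _] /andP[rho0 rho1] _] := rate_bounds ag.
have [q0 q0E] : exists q0, q0 = 1 - 3 * alpha / (4 * gamma) by eexists.
rewrite -q0E in q04 q01 lq0 *.
have [rho rhoE] : exists rho, rho = alpha / (10 * gamma) by eexists.
rewrite -rhoE in rho0 rho1 *.
have eta0 : 0 <= 2 / (alpha + gamma) by rewrite divr_ge0//; case/andP: ag => ? ?; lra.
have [eta etaE] : exists eta, eta = 2 / (alpha + gamma) by eexists.
rewrite -etaE in eta0 *.
have Ks1 : 1 <= C0 * (gamma / alpha) ^+ 2 + 1.
  by rewrite lerDr mulr_ge0 ?sqr_ge0//; lra.
have [Ks KsE] : exists Ks, Ks = C0 * (gamma / alpha) ^+ 2 + 1 by eexists.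
rewrite -KsE in Ks1.
have A31 : 1 <= (- ln q0)^-1 + 1 by rewrite lerDr invr_ge0 ltW.
have [A3 A3E] : exists A3, A3 = (- ln q0)^-1 + 1 by eexists.
rewrite -A3E in A31.
have A20 : 0 <= 2 * p0 + 3 * c2 * (Lsp + Cpsi * Kx) + CR * Num.sqrt cup.
  by rewrite !addr_ge0 ?mulr_ge0 ?addr_ge0 ?mulr_ge0 ?sqrtr_ge0 ?(ltW K0) ?(ltW hCpsi) ?(ltW hCR) ?(ltW c20)//; lra.
have [A2 A2E] : exists A2, A2 = 2 * p0 + 3 * c2 * (Lsp + Cpsi * Kx) + CR * Num.sqrt cup by eexists.
rewrite -A2E in A20.
have A10 : 0 <= 2 * eta * (Num.sqrt (96 * Ks * c2) * Kx).
  by rewrite !mulr_ge0 ?sqrtr_ge0 ?(ltW K0).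
have [A1 A1E] : exists A1, A1 = 2 * eta * (Num.sqrt (96 * Ks * c2) * Kx) by eexists.
rewrite -A1E in A10.
have A50 : 0 <= 168 * eta * Cx * Kx * (A2 * (Num.sqrt 3 * Ks * Num.sqrt (A3 + 1)) * A3).
  by rewrite !mulr_ge0 ?sqrtr_ge0 ?(ltW K0) ?(ltW hCx)//; lra.
have [A5 A5E] : exists A5, A5 = 168 * eta * Cx * Kx * (A2 * (Num.sqrt 3 * Ks * Num.sqrt (A3 + 1)) * A3) by eexists.
rewrite -A5E in A50.
(* The three requirements serve [ln n >= 8], the sample size in the curvature hypothesis, and the
   smallness of [Err]. The absolute value is there because the sign of [Ct] is unknown. *)
have [m0 [m0E m0C m0A]] : exists m0, [/\ 4 * expR 8 <= m0, `|Ct| * (Ks + 1) * 2 <= m0 &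
    (A1 * Num.sqrt cup + A5) / (1 - q0) <= m0].
  exists (Num.max (4 * expR 8) (Num.max (`|Ct| * (Ks + 1) * 2) ((A1 * Num.sqrt cup + A5) / (1 - q0)))).
  by rewrite !le_max !lexx !orbT.
have m04 : 4 <= m0 by have := @expR_ge1Dx R 8; lra.
have m0p : 0 < m0 by lra.
have slo : 0 < Num.sqrt clo by rewrite sqrtr_gt0.
have [Cb CbE] : exists Cb, Cb = 2 / clo + 2 * (2 * A1 ^+ 2 + 2 * A5 ^+ 2 / clo) / (1 - q0) ^+ 2 by eexists.
(* Dividing by [sqrt clo] offsets the factor [sqrt c] of the sample-size condition, which then gives
   [m0 ^+ 2 * Y <= n]. *)
exists (m0 ^+ 2 / Num.sqrt clo), Cb; split.
  split; first by rewrite divr_gt0// exprn_gt0.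
  rewrite CbE ltr_wpDr ?divr_gt0// divr_ge0 ?sqr_ge0// mulr_ge0// addr_ge0//.
    by rewrite mulr_ge0 ?sqr_ge0.
  by rewrite divr_ge0 ?(ltW hclo)// mulr_ge0 ?sqr_ge0.
move=> n d sstar c eps delta nd S1 /andP[cl cu] eps01 dl rho' s eta' Lx Lpsi Spsi r B0 q0'.
have [l1 l2 l3 l4] := log_bounds nd dl.
have [e0 e1] : 0 < eps /\ eps <= 1 by apply/andP.
have c0 : 0 < c by lra.
have sc0 : 0 < Num.sqrt c by rewrite sqrtr_gt0.
have scl : Num.sqrt clo <= Num.sqrt c by exact: ler_wsqrtr.
have n2 : 2 <= n%:R :> R by rewrite ler_nat; case/andP: nd.
have n0 : 0 < n%:R :> R by lra.
have dl0 : 0 < delta by case/andP: dl.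
move=> T b rate G0 Err size.
rewrite powR_3_2 in size; last by apply: lt_le_trans l1; rewrite invr_gt0.
pose Y := sstar%:R * ln d%:R * Num.sqrt (ln (expR 1 * d%:R)) * Num.sqrt (ln delta^-1)
  * (ln n%:R * Num.sqrt (ln n%:R)) / eps.
have lp : [/\ 0 <= ln n%:R :> R, 0 <= ln d%:R :> R & 0 <= ln delta^-1 :> R].
  by clear -l1 l2 l4; split; lra.
case: lp => ln0 ld0 ll0.
have Y0 : 0 <= Y by rewrite /Y divr_ge0 ?(ltW e0)// !mulr_ge0 ?sqrtr_ge0.
have mY : m0 ^+ 2 * Y <= n%:R.
  apply: (le_trans _ size); apply: ler_wpM2r; first exact: Y0.
  rewrite mulrAC ler_pdivlMr//; apply: ler_wpM2l => //; exact: sqr_ge0.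
clear size.
have [n8 mS] := sample_size_bounds nd S1 eps01 dl m0E mY.
have [ss sK _] := sparsity_bounds ag hC0 S1.
have := stopping_time_bounds ag n8; rewrite -q0E => -[T4 qT TA].
rewrite -/s in ss sK; rewrite -/T -?A3E in T4 qT TA; rewrite -KsE in sK.
have S1R : 1 <= sstar%:R :> R by rewrite ler1n.
have X0 : 0 <= Y / n%:R by rewrite divr_ge0// ltW.
have X2 : (Y / n%:R) ^+ 2 = (sstar%:R * ln d%:R) ^+ 2 * ln (expR 1 * d%:R) * ln delta^-1
        * ln n%:R ^+ 3 / (n%:R ^+ 2 * eps ^+ 2).
  have Le0 : 0 <= ln (expR 1 * d%:R) :> R by rewrite l3 addr_ge0.
  rewrite /Y -[in RHS](sqr_sqrtr Le0) -[X in _ = _ * X * _ / _](sqr_sqrtr ll0).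
  rewrite (_ : ln n%:R ^+ 3 = ln n%:R ^+ 2 * Num.sqrt (ln n%:R) ^+ 2); last first.
    by rewrite sqr_sqrtr// -exprSr.
  by field; rewrite !gt_eqF.
have T0 : 0 < T%:R :> R by rewrite ltr0n; apply: leq_trans T4.
have LE : ln (delta / T%:R)^-1 = ln T%:R + ln delta^-1.
  by rewrite invfM invrK mulrC lnM ?posrE ?invr_gt0.
have LT0 : 0 <= ln T%:R :> R by apply: ln_ge0; rewrite ler1n; apply: leq_trans T4.
have LTT : ln T%:R <= T%:R :> R.
  have := @expR_ge1Dx R (ln T%:R); rewrite lnK ?posrE//.
  by apply: le_trans; rewrite lerDr.
have L0 : 0 <= ln (delta / T%:R)^-1 by rewrite LE addr_ge0.
(* The crude chain [ln T <= T <= A3 * ln n] suffices, since [ln n <= ln delta^-1]. *)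
have LA : ln (delta / T%:R)^-1 <= (A3 + 1) * ln delta^-1.
  rewrite LE mulrDl mul1r lerD2r; apply: (le_trans LTT); apply: (le_trans TA).
  by apply: ler_wpM2l => //; lra.
have s0 : 0 <= s%:R :> R by [].
have Ks0 : 0 <= Ks by clear -Ks1; lra.
have A30 : 0 <= A3 by clear -A31; lra.
have S0 : 0 <= sstar%:R :> R by [].
have rho01 : 0 <= rho <= 1 by rewrite rho0.
have term1 := statistical_term_bound rho01 eta0 s0 sK S0 Ks0 c0 c20 K0 ld0 n0.
have CK0 : 0 <= Cpsi * Kx by rewrite mulr_ge0 ?(ltW hCpsi) ?(ltW K0).
have c0cup : 0 < c <= cup by rewrite c0.
have l1' : 1 <= ln n%:R :> R by clear -n8; lra.
have /andP[u0 uA] := saturation_level_bound hp0 c20 hLsp CK0 hCR c0cup l1' (erefl Lpsi).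
rewrite -A2E in uA.
have term2 := noise_term_bound (ln (expR 1 * d%:R)) eta0 (ltW hCx) (ltW K0) n0 s0 sK ld0 ln0 T0 TA L0 LA A30 e0 u0 uA.
have ErrB : Err <= A1 * (Num.sqrt c * Num.sqrt (sstar%:R * ln d%:R / n%:R)) + A5 * (Y / n%:R).
  by rewrite A1E A5E; exact: lerD term1 term2.
have b0 : 0 <= b.
  rewrite /b /noisyHT_scale divr_ge0 ?divr_ge0 ?(ltW e0)//.
  apply: mulr_ge0; last exact: sqrtr_ge0.
  apply: mulr_ge0 => //; apply: divr_ge0 => //; apply: mulr_ge0 => //.
  apply: mulr_ge0; first exact: mulr_ge0.
  by rewrite !mulr_ge0 ?sqrtr_ge0 ?(ltW hCx) ?(ltW K0).
have Err0 : 0 <= Err.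
  apply: addr_ge0; apply: mulr_ge0; rewrite ?addr_ge0//.
    by apply: mulr_ge0 => //; apply: mulr_ge0; exact: sqrtr_ge0.
  apply: mulr_ge0; last exact: sqrtr_ge0.
  by apply: mulr_ge0 => //; exact: mulr_ge0.
have QT : 0 <= q0 ^+ T <= n%:R^-1.
  by rewrite qT andbT exprn_ge0//; apply: le_trans q04; rewrite invr_ge0.
have ccu : clo <= c <= cup by rewrite cl.
have ld1 : 1 <= ln d%:R :> R by apply: le_trans l2.
have n1 : 1 <= n%:R :> R by clear -n2; lra.
have mX1 : m0 ^+ 2 * (Y / n%:R) <= 1 by rewrite mulrA ler_pdivrMr ?mul1r.
have [E1 E2 E3] := error_combination A10 A50 m04 m0A q01 hclo ccu S1R ld1 n0 mS X0 mX1 QT n1 Err0 ErrB.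
rewrite -CbE X2 in E2 E3.
have mm : m0 <= m0 ^+ 2 by rewrite expr2 ler_peMl ?(ltW m0p)//; clear -m04; lra.
split => //.
- apply: (le_trans _ mS); apply: ler_pM => //.
    by apply: (le_trans m04).
  by rewrite ler_peMl.
- apply: (le_trans _ mS); apply: (@le_trans _ _ ((`|Ct| * (Ks + 1) * 2) * (sstar%:R * ln d%:R))); last first.
    by apply: ler_wpM2r; [rewrite mulr_ge0|exact: le_trans mm].
  have Le0 : 0 <= ln (expR 1 * d%:R) :> R by rewrite l3 addr_ge0.
  apply: (@le_trans _ _ (`|Ct| * ((s + sstar)%:R * ln (expR 1 * d%:R)))).
    by rewrite -mulrA; apply: ler_wpM2r; [rewrite mulr_ge0|exact: ler_norm].
  rewrite -!mulrA; apply: ler_wpM2l => //.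
  have -> : (Ks + 1) * (2 * (sstar%:R * ln d%:R)) = ((Ks + 1) * sstar%:R) * (2 * ln d%:R) :> R by ring.
  apply: ler_pM => //; last by rewrite l3 mulrDl mul1r lerD2r.
  by rewrite natrD mulrDl mul1r lerD2r.
Qed.

(** * The theorem *)

Lemma bounded_off_event dO (O : measurableType dO) (R : realType)
    (P : probability O R) (f : O -> R) (N : set O) (B K p : R) :
  measurable_fun setT f -> measurable N -> (P N <= p%:E)%E -> 0 <= B -> 0 <= K ->
  (forall o, 0 <= f o <= K) -> (forall o, ~ N o -> f o <= B) ->
  ((1 - p)%:E <= P [set o | (f o <= B)%R])%E /\ ('E_P[f] <= (B + K * p)%:E)%E.
Proof.
move=> mf mN PN B0 K0 fK fB; split.
  apply: (@le_trans _ _ (P (~` N))).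
    rewrite probability_setC// EFinB; apply: leeB => //.
  have mB : measurable [set o | f o <= B].
    rewrite (_ : [set o | _] = f @^-1` [set` `]-oo, B]]).
      by rewrite -[X in measurable X]setTI; exact: mf.
    by apply/seteqP; split => o /=; rewrite in_itv.
  apply: le_measure; rewrite ?inE//; exact: measurableC.
have f0 o : 0 <= f o by case/andP: (fK o).
have fle o : f o <= B + K * \1_N o.
  rewrite indicE; case: (boolP (o \in N)) => oN.
    by rewrite mulr1; apply: (@le_trans _ _ K); [case/andP: (fK o)|rewrite lerDr].
  by rewrite mulr0 addr0; apply: fB => h; rewrite (mem_set h) in oN.
have m1 : measurable_fun setT (fun o => \1_N o : R) by exact: measurable_indic.
rewrite unlock; apply: (@le_trans _ _ (\int[P]_o (B + K * \1_N o)%:E)%E).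
  apply: ge0_le_integral => //.
  - by move=> o _; rewrite lee_fin.
  - exact/measurable_EFinP.
  - by apply/measurable_EFinP; apply: measurable_funD => //; exact: measurable_funM.
  - by move=> o _; rewrite lee_fin.
under eq_integral => o _ do rewrite EFinD EFinM.
rewrite ge0_integralD//; last 2 first.
- by move=> o _; rewrite mule_ge0// lee_fin.
- by apply: emeasurable_funM => //; exact/measurable_EFinP.
rewrite integral_cst//= probability_setT mule1 ge0_integralZl//; last first.
  exact/measurable_EFinP.
rewrite integral_indic// setIT EFinD EFinM; apply: leeD => //.
by apply: lee_pmul => //; rewrite lee_fin.
Qed.

(** At [bstar] neither saturation nor truncation acts: [r] is the bound on the conditional mean over
    [|t| <= Lpsi] plus the residual level. The gradient is then minus the average score. *)
Lemma grad_at_truth_bound (R : realType) (n d : nat) (c2 c3 Lpsi r Lr G : R)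
    (psi chi : R -> R) (Z : 'I_n -> record R d) (bstar : 'rV[R]_d) :
  condG c2 c3 psi -> is_cutoff chi -> 1 <= Lpsi -> (0 < n)%N ->
  (forall i, `|dot (Z i).2 bstar| <= Lpsi) ->
  (forall i, `|residual psi bstar (Z i)| <= Lr) ->
  `|derive1 psi 0| + c2 * Lpsi + Lr <= r ->
  (forall j, `|\sum_i residual psi bstar (Z i) * (Z i).2 0 j| <= n%:R * G) ->
  forall j, `|grad (glm_loss (psi_sat psi chi Lpsi) r Z) bstar 0 j| <= G.
Proof.
move=> gpsi gchi L1 n0 hb hr rr hG j.
have nR0 : 0 < n%:R :> R by rewrite ltr0n.
have c20 := c2_gt0 gpsi.
rewrite (grad_glm_loss _ _ (psi_sat_is_derive gpsi gchi Lpsi)) mxE.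
have -> : \sum_i (psi_sat' psi chi Lpsi (dot (Z i).2 bstar) - trunc r (Z i).1) * (Z i).2 0 j
    = - \sum_i residual psi bstar (Z i) * (Z i).2 0 j.
  rewrite -sumrN; apply: eq_bigr => i _.
  rewrite (psi_sat'_eq gpsi gchi _ (hb i)); last by apply: lt_le_trans L1.
  rewrite trunc_id; first by rewrite /residual; ring.
  have dpB : `|derive1 psi (dot (Z i).2 bstar)| <= `|derive1 psi 0| + c2 * Lpsi.
    have d2 t : `|derive1n 2 psi t| <= c2.
      by have /andP[? ?] := d2psi_bounds gpsi t; rewrite gtr0_norm.
    have := derivative_bound 0 (dot (Z i).2 bstar) (dpsi_is_derive gpsi) d2.
    rewrite subr0 => h.
    have h2 : c2 * `|dot (Z i).2 bstar| <= c2 * Lpsi by rewrite ler_pM2l.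
    have := ler_normD (derive1 psi (dot (Z i).2 bstar) - derive1 psi 0) (derive1 psi 0).
    rewrite subrK; lra.
  have -> : (Z i).1 = residual psi bstar (Z i) + derive1 psi (dot (Z i).2 bstar).
    by rewrite /residual subrK.
  apply: (le_trans (ler_normD _ _)); have := hr i; lra.
rewrite normrM normrN gtr0_norm ?invr_gt0// ler_pdivrMl//; exact: hG.
Qed.

Lemma clip_data_id (R : realType) (n d : nat) (L : R) (Z : 'I_n -> record R d) :
  (forall i j, `|(Z i).2 0 j| <= L) -> clip_data L Z = Z.
Proof.
move=> h; apply/funext => i; rewrite /clip_data clip_id; last exact: h.
by case: (Z i).
Qed.

(** [T], [s + 1] and [d] are each at most a constant times [d], so the tail level [7 * ln d] leaves
    [d ^- 4]. *)
Lemma union_size_bound (R : realType) (n d T s : nat) (A3 : R) :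
  (2 <= n <= d)%N -> (s <= d)%N -> 0 <= A3 -> T%:R <= A3 * ln n%:R :> R ->
  (T * s.+1 * d)%:R * (2 * expR (- (7 * ln d%:R))) <= 4 * A3 * n%:R ^- 3 :> R.
Proof.
move=> nd sd A30 TA.
have n2 : 2 <= n%:R :> R by rewrite ler_nat; case/andP: nd.
have dn : n%:R <= d%:R :> R by rewrite ler_nat; case/andP: nd.
have n0 : 0 < n%:R :> R by lra.
have d0 : 0 < d%:R :> R by lra.
have d1 : 1 <= d%:R :> R by lra.
rewrite expR_negln// !natrM.
have lnd : ln n%:R <= d%:R :> R.
  have := @expR_ge1Dx R (ln n%:R); rewrite lnK ?posrE//; lra.
have Td : T%:R <= A3 * d%:R :> R by apply: (le_trans TA); apply: ler_wpM2l.
have sd2 : s.+1%:R <= 2 * d%:R :> R.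
  have : s%:R <= d%:R :> R by rewrite ler_nat.
  by rewrite -natr1; lra.
have i7 : 0 < d%:R ^- 7 :> R by rewrite invr_gt0 exprn_gt0.
apply: (@le_trans _ _ ((A3 * d%:R * (2 * d%:R) * d%:R) * (2 * d%:R ^- 7))).
  apply: ler_pM; rewrite ?mulr_ge0 ?(ltW i7)//.
  by apply: ler_wpM2r; [exact: ltW|apply: ler_pM].
have -> : A3 * d%:R * (2 * d%:R) * d%:R * (2 * d%:R ^- 7) = 4 * A3 * d%:R ^- 4.
  by field; rewrite gt_eqF.
apply: ler_wpM2l; first by rewrite mulr_ge0.
apply: (@le_trans _ _ (d%:R ^- 3)).
  by rewrite lef_pV2 ?posrE ?exprn_gt0//; exact: ler_weXn2l.
rewrite lef_pV2 ?posrE ?exprn_gt0//; apply: lerXn2r => //; rewrite nnegrE ltW//.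
Qed.

Theorem theorem5p2 (R : realType) :
  exists C0min Cxmin Cpsimin : R, [/\ 0 < C0min, 0 < Cxmin & 0 < Cpsimin] /\
  forall c2 : R, exists CRmin : R, 0 < CRmin /\
  forall C0 Cx Cpsi CR : R,
    C0min <= C0 -> Cxmin <= Cx -> Cpsimin <= Cpsi -> CRmin <= CR ->
  forall (C Kx c3 : R) (psi chi : R -> R) (alpha gamma Ct Lsp : R),
    condG c2 c3 psi -> is_cutoff chi ->
    curvature_constants C Kx psi chi alpha gamma Ct Lsp ->
  forall clo cup : R, 0 < clo -> clo <= cup ->
  exists C1 C' C'' : R, [/\ 0 < C1, 0 < C' & 0 < C''] /\
  forall (n d sstar : nat) (bstar : 'rV[R]_d)
    (fx : probability (borelType 'rV[R]_d) R)
    (mu : {measure set (measurableTypeR R) -> \bar R})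
    (h : R -> R) (c : R) (eps delta : R) (tie : {set 'I_d} -> 'I_d),
    (2 <= n <= d)%N -> (1 <= sstar <= d)%N ->
    (l0norm bstar <= sstar)%N -> l2norm bstar <= 1 ->
    condD C Kx fx -> clo <= c <= cup -> glm_family mu h c psi ->
    tie_breaking tie ->
    0 < eps <= 1 -> 0 < delta <= n%:R^-1 ->
    let s := nceil (C0 * (gamma / alpha) ^+ 2 * sstar%:R) in
    let eta := 2 / (alpha + gamma) in
    let Lx := Cx * Kx * Num.sqrt (ln (expR 1 * d%:R)) in
    let Lpsi := Lsp + Cpsi * Kx * Num.sqrt (ln n%:R) in
    let Spsi := `|derive1 psi 0| + 2 * c2 * Lpsi in
    let r := `|derive1 psi 0| + c2 * Lpsi + CR * Num.sqrt (c * ln n%:R) in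
    let B0 := 4 * (r + Spsi) * Lx in
    let q0 := 1 - 3 * alpha / (4 * gamma) in
    let T := nceil (ln n%:R / - ln q0) in
    let b := noisyHT_scale s (eps / T%:R) (delta / T%:R) (eta * B0 / n%:R) in
    let rate := c * (sstar%:R * ln d%:R / n%:R +
      (sstar%:R * ln d%:R) ^+ 2 * ln (expR 1 * d%:R) * ln delta^-1
        * ln n%:R ^+ 3 / (n%:R ^+ 2 * eps ^+ 2)) in
    (s <= d)%N ->
    C1 * Num.sqrt c * (sstar%:R * ln d%:R * Num.sqrt (ln (expR 1 * d%:R))
      * Num.sqrt (ln delta^-1) * ln n%:R `^ (3 / 2) / eps) <= n%:R ->
  forall dO (O : measurableType dO) (P : probability O R)
    (D : 'I_n -> {RV P >-> borelType (record R d)})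
    (w : 'I_T -> 'I_s -> 'I_d -> {RV P >-> R})
    (w' : 'I_T -> 'I_d -> {RV P >-> R}),
    glm_sample fx mu h c psi bstar D ->
    (forall t k j, has_laplace_law b (w t k j)) ->
    (forall t j, has_laplace_law b (w' t j)) ->
    noise_and_data_independent D w w' ->
    let M (data : 'I_n -> record R d) (o : O) : 'rV[R]_d :=
      private_glm tie (psi_sat psi chi Lpsi) Lx r eta data
        (fun t k j => w t k j o) (fun t j => w' t j o) in
    let err (o : O) : R := l2norm (M (fun i => D i o) o - bstar) ^+ 2 in
    [/\ differentially_private P M eps delta,
        ((1 - C' * n%:R ^- 3)%:E <= P [set o | (err o <= C'' * rate)%R])%E &
        ('E_P[err] <= (C'' * rate)%:E)%E].

Proof.
exists 101, 6, 4; split; first by [].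
(* The sign of [c2] is not yet known; [CR >= 1] gives [CR ^+ 2 >= CR >= 8 * c2]. *)
move=> c2; exists (1 + 8 * `|c2|); split; first by rewrite ltr_wpDr// mulr_ge0.
move=> C0 Cx Cpsi CR hC0 hCx hCpsi hCR C Kx c3 psi chi alpha gamma Ct Lsp gpsi gchi curvC clo cup clo0 clocup.
case: (curvC) => ag Lsp1 _.
have c20 := c2_gt0 gpsi.
(* A nonpositive [Kx] is incompatible with the covariate condition once [d >= 1], so any constants
   will do in that case. *)
have [K0|K0] := leP Kx 0.
  exists 1, 1, 1; split; first by [].
  move=> n d sstar bstar fx mu h c eps delta tie nd _ _ _ cD.
  have d0 : (0 < d)%N by case/andP: nd => n2; apply: leq_trans; exact: leq_trans n2.
  by have := subgaussian_constant_gt0 cD d0; rewrite ltNge K0.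
have hCx0 : 0 < Cx by lra.
have hCpsi0 : 0 < Cpsi by lra.
have hCR0 : 0 < CR by have := normr_ge0 c2; lra.
have hCR2 : 8 * c2 <= CR ^+ 2.
  have := ler_norm c2; have := normr_ge0 c2; nra.
have [C1 [Cb [[C10 Cb0] budget]]] := error_budget Ct ag hC0 hCx0 hCpsi0 hCR0 c20 K0 Lsp1
  (normr_ge0 (derive1 psi 0)) clo0 clocup.
have [/andP[q04 q01] /andP[lq0 _] rho01 rate] := rate_bounds ag.
pose A3 := (- ln (1 - 3 * alpha / (4 * gamma)))^-1 + 1.
have A30 : 0 <= A3 by rewrite /A3 addr_ge0// invr_ge0 ltW.
have C'0 : 0 < 9 + 4 * A3 by rewrite ltr_wpDr// mulr_ge0.
(* In units of [n ^- 3] the exceptional events weigh 1 for the curvature, 8 for the sample and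
   [4 * A3] for the noise. The second 4 in the last constant bounds the squared error off the good
   event. *)
exists C1, (9 + 4 * A3), (Cb * (1 + 4 * (9 + 4 * A3))); split.
  by split => //; rewrite mulr_gt0// ltr_wpDr// mulr_ge0// ltW.
move=> n d sstar bstar fx mu h c eps delta tie nd sd1 cb b1 cD cc glm tb eps01 dl
  s eta Lx Lpsi Spsi r B0 q0 T b rt sd size dO O P D w w' sample lapw lapw' ind M err.
have S1 : (1 <= sstar)%N by case/andP: sd1.
have [n8 n4 hCt Err2 [hB hn]] := budget n d sstar c eps delta nd S1 cc eps01 dl size.
clear size budget.
have n2 : (2 <= n)%N by case/andP: nd.
have n0 : (0 < n)%N by exact: leq_trans n2.
have nR0 : 0 < n%:R :> R by rewrite ltr0n.
have nR1 : 1 <= n%:R :> R by rewrite ler1n.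
have [l1 l2 l3 l4] := log_bounds nd dl.
have [dl0 dln] : 0 < delta /\ delta <= n%:R^-1 by apply/andP.
have delta4 : 4 <= ln delta^-1 by apply: le_trans l4; apply: le_trans n8; rewrite ler_nat.
have [sss _ Hrho] := sparsity_bounds ag hC0 S1; rewrite -/s in sss Hrho.
have [T4 _ TA] := stopping_time_bounds ag n8.
rewrite -/q0 -/T -/A3 in T4 TA.
have s0 : (0 < s)%N by exact: leq_ltn_trans sss.
have c0 : 0 < c by case/andP: cc => ? _; exact: lt_le_trans clo0 _.
have ln0 : 0 < ln n%:R :> R by apply: lt_le_trans n8; rewrite ltr0n.
have ld0 : 0 <= ln d%:R :> R by apply: le_trans l2; exact: ltW.
have Lx0 : 0 < Lx by rewrite /Lx !mulr_gt0// sqrtr_gt0 l3 ltr_wpDr.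
have CK0 : 0 <= Cpsi * Kx * Num.sqrt (ln n%:R) by rewrite !mulr_ge0 ?sqrtr_ge0 ?(ltW K0) ?(ltW hCpsi0).
have LL : Lsp <= Lpsi by rewrite /Lpsi lerDl.
have L1 : 1 <= Lpsi by exact: le_trans LL.
have L0 : 0 < Lpsi by exact: lt_le_trans L1.
have r0 : 0 < r.
  by rewrite /r ltr_wpDr ?mulr_ge0 ?sqrtr_ge0 ?(ltW hCR0)// ltr_wpDl// mulr_gt0.
have a0 : 0 < alpha by case/andP: ag.
have g0 : 0 < gamma by case/andP: ag => _; exact: lt_le_trans.
have eta0 : 0 < eta by rewrite divr_gt0// addr_gt0.
have mdpsi : measurable_fun setT (psi_sat' psi chi Lpsi).
  apply: continuous_measurable_fun; apply: is_derive_continuous => t.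
  exact: (psi_sat'_is_derive gpsi gchi).
have Hpsi := psi_sat_is_derive gpsi gchi Lpsi.
have dS t := psi_sat'_bound gpsi gchi t L1.
have [lam0 b0] := noise_scale_gt0 dS Lx0 r0 eta0 n0 s0 T4 eps01 dl0 delta4.
have dp : differentially_private P M eps delta.
  exact: (private_glm_dp tb ind Hpsi mdpsi dS Lx0 r0 eta0 n0 s0 T4 eps01 dl0 delta4 lapw lapw').
have merr : measurable_fun setT err.
  apply: measurable_funX; apply: measurable_l2norm; apply: measurable_rV => j.
  under eq_fun => o do rewrite mxE [X in _ + X]mxE.
  apply: measurable_funD; last exact: measurable_cst.
  apply: (measurable_coord (f := fun o => M (fun i => D i o) o)).
  apply: (measurable_private_glm tie r eta w w' Hpsi mdpsi Lx0 (Z := fun o i => D i o)).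
  by move=> i; exact: measurable_funPT.
have curv := curvature_event curvC nd S1 _ cb b1 cD glm sample LL (ltW r0) hCt.
have [|N1 [mN1 PN1 HN1]] := curv; first by rewrite (ltnW sss).
have [N2 [mN2 PN2 HN2]] := sample_event glm gpsi sample cD K0 n0 nd hCx hCpsi hCR0 hCR2 b1 n4.
have t0 : 0 <= 7 * ln d%:R :> R by exact: mulr_ge0.
have [N3 [mN3 PN3 HN3]] := noise_event b0 t0 lapw lapw'.
have size3 := union_size_bound nd sd A30 TA.
pose p := (9 + 4 * A3) * n%:R ^- 3.
have mN : measurable (N1 `|` N2 `|` N3) by do 2 apply: measurableU => //.
have PN : (P (N1 `|` N2 `|` N3) <= p%:E)%E.
  apply: (le_trans (measureU2 _ _ _)) => //; first exact: measurableU.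
  apply: (@le_trans _ _ ((n%:R ^- 3)%:E + (8 * n%:R ^- 3)%:E + (4 * A3 * n%:R ^- 3)%:E)%E).
    apply: leeD.
      by apply: (le_trans (measureU2 _ _ _)) => //; exact: leeD.
    by apply: (le_trans PN3); rewrite lee_fin.
  by rewrite -!EFinD lee_fin /p le_eqVlt; apply/orP; left; apply/eqP; ring.
have M1 o : l2norm (M (fun i => D i o) o) <= 1 by exact: proj_unit_ball_le1.
have err4 o : 0 <= err o <= 4.
  have M2 : l2norm (M (fun i => D i o) o - bstar) <= 2.
    apply: (le_trans (l2normD _ _)); rewrite l2normN.
    exact: (lerD (M1 o) b1).
  rewrite sqr_ge0/=; apply: (@le_trans _ _ (2 ^+ 2)); last by rewrite -natrX.
  by apply: lerXn2r => //; rewrite nnegrE ?l2norm_ge0.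
have good o : ~ (N1 `|` N2 `|` N3) o -> err o <= Cb * rt.
  move=> No.
  have curvo : curvature_ok s sstar bstar psi chi Lpsi r alpha gamma (fun i => D i o).
    by apply: HN1 => oN; apply: No; left; left.
  have [hx hb hr hs] : _ := HN2 o (fun oN => No (or_introl (or_intror oN))).
  have [hw hw'] := HN3 o (fun oN => No (or_intror oN)).
  have hbL i : `|dot (D i o).2 bstar| <= Lpsi.
    by apply: (le_trans (hb i)); rewrite /Lpsi lerDr; exact: le_trans Lsp1.
  have gradG := grad_at_truth_bound gpsi gchi L1 n0 hbL hr (lexx r) hs.
  have W0 : 0 <= 7 * ln d%:R * b by rewrite mulr_ge0// ltW.
  have := iht_error Hpsi (psi_sat'_is_derive gpsi gchi Lpsi) ag tb curvo hw hw' sd sss cb rho01 Hrho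
    gradG W0 (sqrtr_ge0 _) _ rate Err2 b1.
  have q00 : 0 <= 1 - 3 * alpha / (4 * gamma) < 1.
    by rewrite q01 andbT; apply: le_trans q04; rewrite invr_ge0.
  move=> /(_ q00) run.
  apply: le_trans hB; apply: lerXn2r; rewrite ?nnegrE ?l2norm_ge0//.
    by apply: (le_trans _ run); exact: l2norm_ge0.
  (* Clipping leaves the data unchanged on the good event, so the run is the one on raw data, which
     the curvature hypothesis governs. *)
  apply: le_trans run; rewrite /M /private_glm (clip_data_id hx).
  exact: proj_unit_ball_dist.
have rt0 : 0 <= Cb * rt by apply: le_trans hn; rewrite invr_ge0.
(* The failure probability is absorbed by the rate, whose statistical part is at least of order
   [1 / n]. *)
have n3 : n%:R ^- 3 <= Cb * rt.
  apply: le_trans hn; rewrite lef_pV2 ?posrE ?exprn_gt0// -[leLHS]expr1.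
  exact: ler_weXn2l.
have [H1 H2] := bounded_off_event merr mN PN rt0 (ler0n R 4) err4 good.
have rtE : Cb * (1 + 4 * (9 + 4 * A3)) * rt = Cb * rt + 4 * (9 + 4 * A3) * (Cb * rt).
  by ring.
have le1 : Cb * rt <= Cb * (1 + 4 * (9 + 4 * A3)) * rt.
  rewrite rtE lerDl.
  by rewrite mulr_ge0// mulr_ge0// ltW.
have le2 : Cb * rt + 4 * p <= Cb * (1 + 4 * (9 + 4 * A3)) * rt.
  rewrite rtE lerD2l /p mulrA.
  by apply: ler_wpM2l => //; rewrite mulr_ge0// ltW.
split => //.
- apply: (le_trans H1); apply: le_measure; rewrite ?inE.
  + rewrite (_ : [set o | _] = err @^-1` [set` `]-oo, Cb * rt]]).
      by rewrite -[X in measurable X]setTI; exact: merr.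
    by apply/seteqP; split => o /=; rewrite in_itv.
  + rewrite (_ : [set o | _] = err @^-1` [set` `]-oo, Cb * (1 + 4 * (9 + 4 * A3)) * rt]]).
      by rewrite -[X in measurable X]setTI; exact: merr.
    by apply/seteqP; split => o /=; rewrite in_itv.
  + by move=> o /= oB; exact: le_trans le1.
- by apply: (le_trans H2); rewrite lee_fin.
Qed.
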